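(* $$\mathbf{V}^{\rm el}_{h0}=\mathrm{span}\big(\{\boldsymbol{\psi}_e:\ e\in\mathcal{E}_h^i\}\cup\{\boldsymbol{\psi}_T:\ T\in\mathcal{T}_h^i\}\big).$$
   Context: $\Omega\subset\mathbb{R}^2$ is a simply connected polygonal domain and $\mathcal{T}_h$ is a (conforming) triangulation of $\Omega$ such that every boundary vertex is connected by an edge to at least one interior vertex, and every interior edge has at least one endpoint that is an interior vertex. $\mathcal{E}_h^i$ is the set of interior edges and $\mathcal{T}_h^i$ the set of cells all three of whose edges are interior (''interior cells''). For each edge, $\mathbf{t}$ denotes a unit tangential vector. $\operatorname{curl}\varphi=(\partial_y\varphi,-\partial_x\varphi)$. For a triangle $T$ with barycentric coordinates $\lambda_1,\lambda_2,\lambda_3$, let $\mathbf{P}^{1+}(T)=(P_1(T))^2\oplus\mathrm{span}\{\operatorname{curl}(\lambda_1\lambda_2\lambda_3)\}$. $\mathbf{V}^{\rm el}_{h0}$ is the space of all $\mathbf{v}_h\in H_0(\operatorname{div},\Omega)$ with $\mathbf{v}_h|_T\in\mathbf{P}^{1+}(T)$ for all $T\in\mathcal{T}_h$, such that $\int_e\mathbf{v}_h\cdot\mathbf{t}$ is continuous across every interior edge $e$ and vanishes on every boundary edge $e$. **Local functions.** Let $T$ be a triangle and $\lambda_a$ the barycentric coordinate of its vertex $a$. For an edge $e$ of $T$ with endpoints $b,c$ and opposite vertex $a$, set $\mathbf{w}_{T,e}=\operatorname{curl}(\lambda_b\lambda_c(3\lambda_a-1))$. For two edges $e',e''$ of $T$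 meeting at the vertex $a$, set $\mathbf{w}_{T,e',e''}=\operatorname{curl}(\lambda_a^2)$ and $\mathbf{y}_{T,e',e''}=-\frac{2}{d}\lambda_a\mathbf{n}$, where $d$ and $\mathbf{n}$ are the length and the unit outward normal of the edge of $T$ opposite to $a$. **Cell functions.** For $T_0\in\mathcal{T}_h^i$ with edges $e_1,e_2,e_3$, let $T_j$ be the cell sharing $e_j$ with $T_0$, and $S_j$ the area of $T_j$, $j=0,\dots,3$. Then $\boldsymbol{\psi}_{T_0}=\frac{S_j}{S_j+S_0}\mathbf{w}_{T_j,e_j}$ in $T_j$ ($j=1,2,3$), $$\boldsymbol{\psi}_{T_0}=\tfrac13\Big(\sum_{j=1}^3\tfrac{S_j-2S_0}{S_j+S_0}\mathbf{w}_{T_0,e_j}+\mathbf{w}_{T_0,e_2,e_3}+\mathbf{w}_{T_0,e_3,e_1}+\mathbf{w}_{T_0,e_1,e_2}\Big)\ \text{in }T_0,$$ and $\boldsymbol{\psi}_{T_0}=0$ elsewhere. **Edge functions.** Let $e\in\mathcal{E}_h^i$ have endpoints $A_1,A_3$ with $A_1$ an interior vertex. Let $T_1=A_1A_2A_3$ and $T_2=A_1A_3A_4$ be the two cells sharing $e$, with $T_1$ on the right and $T_2$ on the left of the directed segment from $A_1$ to $A_3$. Let $e_1=A_1A_2$, $e_2=A_2A_3$, $e_3=A_3A_4$, $e_4=A_4A_1$, with lengths $d_1,\dots,d_4$, and let $d$ be the length of $e$. Let $T_3,T_4$ be the cells other than $T_1,T_2$ containing $e_1,e_4$ respectively; when $A_3$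 is also interior, let $T_6,T_5$ be the cells other than $T_1,T_2$ containing $e_2,e_3$ respectively. $S_j$ is the area of $T_j$. Let $\alpha_1,\alpha_2,\beta_3$ be the angles of $T_1$ at $A_1,A_2,A_3$ and $\beta_1,\alpha_3,\beta_4$ the angles of $T_2$ at $A_1,A_3,A_4$. (i) If $A_3$ is a boundary vertex, put $c=\frac{\frac12d_2d_3\sin(\alpha_3+\beta_3)-(S_1+S_2)}{S_1+S_2}$ and - in $T_1$: $\boldsymbol{\psi}_e=\mathbf{y}_{T_1,e_1,e}+\frac{d_1\cos\alpha_2}{d_2}\mathbf{w}_{T_1,e_1,e}+\frac{S_3}{S_3+S_1}\mathbf{w}_{T_1,e_1}+c\,\mathbf{w}_{T_1,e}$; - in $T_2$: $\boldsymbol{\psi}_e=-\mathbf{y}_{T_2,e_4,e}+\frac{d_4\cos\beta_4}{d_3}\mathbf{w}_{T_2,e_4,e}+\frac{S_4}{S_4+S_2}\mathbf{w}_{T_2,e_4}+c\,\mathbf{w}_{T_2,e}$; - in $T_3$: $\boldsymbol{\psi}_e=\frac{S_3}{S_3+S_1}\mathbf{w}_{T_3,e_1}$; in $T_4$: $\boldsymbol{\psi}_e=\frac{S_4}{S_4+S_2}\mathbf{w}_{T_4,e_4}$. (ii) If $A_3$ is an interior vertex, put $K=\frac{\frac12d_2d_3\sin(\alpha_3+\beta_3)-\frac12d_1d_4\sin(\alpha_1+\beta_1)}{2(S_1+S_2)}$ and - in $T_1$: $\boldsymbol{\psi}_e=\big(\frac{S_3}{2(S_3+S_1)}-1\big)\mathbf{w}_{T_1,e_1}+\big(1-\frac{S_6}{2(S_6+S_1)}\big)\mathbf{w}_{T_1,e_2}+K\mathbf{w}_{T_1,e}+\big(\frac{d_2\cos\beta_3}{d}-\frac12\big)\mathbf{w}_{T_1,e_1,e_2}+\frac12\mathbf{w}_{T_1,e_1,e}-\frac12\mathbf{w}_{T_1,e_2,e}+\mathbf{y}_{T_1,e_1,e_2}$;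 - in $T_2$: $\boldsymbol{\psi}_e=\big(\frac{S_4}{2(S_4+S_2)}-1\big)\mathbf{w}_{T_2,e_4}+\big(1-\frac{S_5}{2(S_5+S_2)}\big)\mathbf{w}_{T_2,e_3}+K\mathbf{w}_{T_2,e}+\big(\frac12-\frac{d_4\cos\beta_1}{d}\big)\mathbf{w}_{T_2,e_3,e_4}+\frac12\mathbf{w}_{T_2,e_4,e}-\frac12\mathbf{w}_{T_2,e_3,e}-\mathbf{y}_{T_2,e_3,e_4}$; - in $T_3$: $\frac{S_3}{2(S_3+S_1)}\mathbf{w}_{T_3,e_1}$; in $T_4$: $\frac{S_4}{2(S_4+S_2)}\mathbf{w}_{T_4,e_4}$; in $T_5$: $-\frac{S_5}{2(S_5+S_2)}\mathbf{w}_{T_5,e_3}$; in $T_6$: $-\frac{S_6}{2(S_6+S_1)}\mathbf{w}_{T_6,e_2}$. In all cases $\boldsymbol{\psi}_e=0$ in the remaining cells. In degenerate cases where $T_3=T_4$ (or, in (ii), $T_5=T_6$), $\boldsymbol{\psi}_e$ on that common cell is the sum of the two listed contributions. In (ii) either endpoint may be called $A_1$; exchanging the roles only changes the sign of $\boldsymbol{\psi}_e$. *)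

(* Defs.v *)
From HB Require Import structures.
From mathcomp Require Import all_boot all_order all_algebra.
From mathcomp Require Import all_classical all_reals all_analysis.

Set Implicit Arguments.
Unset Strict Implicit.
Unset Printing Implicit Defensive.

Import Order.TTheory GRing.Theory Num.Theory.
Import numFieldNormedType.Exports.

Local Open Scope classical_set_scope.
Local Open Scope ring_scope.

Section plane.
Variable R : realType.


Implicit Types a b c : R * R.

Definition dot2 a b : R := a.1 * b.1 + a.2 * b.2.
Definition cross2 a b : R := a.1 * b.2 - a.2 * b.1.

(* The library norm of [R * R] is the sup norm, hence an explicit length. *)
Definition dist2 a b : R := Num.sqrt (dot2 (b - a) (b - a)).

Definition area a b c : R := `|cross2 (b - a) (c - a)| / 2.

(* The angle at [a] between the rays towards [b] and [c]. *)
Definition angle a b c : R :=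
  acos (dot2 (b - a) (c - a) / (dist2 a b * dist2 a c)).

Local Notation area2 := (@lebesgue_measure R \x @lebesgue_measure R)%E.

Definition dx (phi : R * R -> R) (x : R * R) : R := 'D_(1, 0) phi x.
Definition dy (phi : R * R -> R) (x : R * R) : R := 'D_(0, 1) phi x.
Definition grad (phi : R * R -> R) : R * R -> R * R :=
  fun x => (dx phi x, dy phi x).
Definition curl (phi : R * R -> R) : R * R -> R * R :=
  fun x => (dy phi x, - dx phi x).

Definition C1 (phi : R * R -> R) : Prop :=
  [/\ forall x, differentiable phi x,
      continuous (dx phi) & continuous (dy phi)].

(* In the functions below a triangle is given by its vertices [a], [b], [c];
   the first one is the vertex that carries the object, and the order of the
   other two is irrelevant.  [bary a b c] is the barycentric coordinate of
   [a], as a quotient of signed areas. *)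
Definition bary a b c (x : R * R) : R :=
  cross2 (b - x) (c - x) / cross2 (b - a) (c - a).

(* The unit normal of the side [b c], outward from the triangle. *)
Definition outward_normal a b c : R * R :=
  (Num.sg (cross2 (b - a) (c - a)) / dist2 b c)
    *: (c.2 - b.2, - (c.1 - b.1)).

(* w_{T,e} for the edge e = [b c], opposite to [a]. *)
Definition w_edge a b c : R * R -> R * R :=
  curl (fun x => bary b c a x * bary c a b x * (3 * bary a b c x - 1)).

(* w_{T,e',e''} and y_{T,e',e''} for the edges e', e'' meeting at [a]. *)
Definition w_vert a b c : R * R -> R * R :=
  curl (fun x => bary a b c x ^+ 2).
Definition y_vert a b c : R * R -> R * R :=
  fun x => (- (2 / dist2 b c) * bary a b c x) *: outward_normal a b c.

Definition affine2 (f : R * R -> R) : Prop :=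
  exists k k1 k2 : R, forall x, f x = k + k1 * x.1 + k2 * x.2.

Definition P1plus a b c : set (R * R -> R * R) :=
  [set q | exists f g : R * R -> R, exists k : R,
     [/\ affine2 f, affine2 g & forall x, q x = (f x, g x) +
        k *: curl (fun z => bary a b c z * bary b c a z * bary c a b z) x]].

(* The integral of q . t over the segment [a b], t pointing from a to b. *)
Definition tangential_integral (q : R * R -> R * R) a b : R :=
  dist2 a b * (\int[@lebesgue_measure R]_(s in `[0, 1]%classic)
    dot2 (q (a + s *: (b - a))) ((dist2 a b)^-1 *: (b - a)))%R.

Definition linear_span (A : set (R * R -> R * R)) : set (R * R -> R * R) :=
  [set v | exists (n : nat) (k : 'I_n -> R) (f : 'I_n -> (R * R -> R * R)),
     (forall i, A (f i)) /\ v = (fun x => \sum_(i < n) k i *: f i x)].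

Section domain.
Variable Omega : set (R * R).

Definition simply_connected : Prop :=
  forall gamma : R -> R * R,
    {within `[0, 1]%classic, continuous gamma} ->
    gamma @` `[0, 1]%classic `<=` Omega -> gamma 0 = gamma 1 ->
    exists H : R * R -> R * R,
      [/\ {within `[0, 1]%classic `*` `[0, 1]%classic, continuous H},
          H @` (`[0, 1]%classic `*` `[0, 1]%classic) `<=` Omega,
          forall t, `[0, 1]%classic t ->
            H (0, t) = gamma t /\ H (1, t) = gamma 0 &
          forall s, `[0, 1]%classic s ->
            H (s, 0) = gamma 0 /\ H (s, 1) = gamma 0].

(* The last condition excludes slits and punctures.  That the domain is
   bounded and polygonal comes with its triangulation below. *)
Definition simply_connected_domain : Prop :=
  [/\ open Omega, Omega !=set0, connected Omega, simply_connected &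
      (closure Omega)° = Omega].

Definition L2 (f : R * R -> R) : Prop :=
  (f \_ Omega : measurableTypeR R * measurableTypeR R -> R)
    \in Lfun area2 2%:E.

Definition L2_field (v : R * R -> R * R) : Prop :=
  L2 (fun x => (v x).1) /\ L2 (fun x => (v x).2).

(* Green's functional <v . n, phi> on the boundary, g being div v. *)
Definition green (v : R * R -> R * R) (g phi : R * R -> R) : R :=
  (\int[area2]_(x in Omega) (dot2 (v x) (grad phi x) + g x * phi x))%R.

Definition weak_div (v : R * R -> R * R) (g : R * R -> R) : Prop :=
  forall phi, C1 phi ->
    (exists K : set (R * R), [/\ compact K, K `<=` Omega &
       forall x, ~ K x -> phi x = 0]) ->
    green v g phi = 0.

(* H_0(div, Omega): v and div v are square integrable and the normal trace
   of v, defined through Green's formula, vanishes. *)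
Definition Hdiv0 (v : R * R -> R * R) : Prop :=
  L2_field v /\
  exists g : R * R -> R,
    [/\ L2 g, weak_div v g & forall phi, C1 phi -> green v g phi = 0].

(* The elements of [A] as classes of square-integrable fields modulo equality
   almost everywhere in Omega. *)
Definition ae_class (A : set (R * R -> R * R)) : set (R * R -> R * R) :=
  [set v | L2_field v /\ exists2 w, A w & v = w %[ae area2 in Omega]].

(* A triangulation is given by a finite type of vertices, their positions,
   and the set of cells, each cell being the set of its three vertices. *)
Variables (V : finType) (pos : V -> R * R) (Th : {set {set V}}).

Definition hull (A : {set V}) : set (R * R) :=
  [set x | exists k : V -> R,
     [/\ forall v, 0 <= k v, forall v, v \notin A -> k v = 0,
         \sum_v k v = 1 & x = \sum_v k v *: pos v]].

Definition triangulation : Prop :=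
  [/\ injective pos,
      forall v, exists2 T, T \in Th & v \in T,
      forall T, T \in Th -> #|T| = 3%N,
      forall a b c : V, [set a; b; c]%SET \in Th ->
        area (pos a) (pos b) (pos c) != 0 &
      (forall T T', T \in Th -> T' \in Th ->
         hull T `&` hull T' = hull (T :&: T')%SET) /\
      closure Omega = \bigcup_(T in [set` Th]) hull T].

Definition edge (e : {set V}) : Prop :=
  #|e| = 2%N /\ exists2 T, T \in Th & e \subset T.

Definition boundary_edge (e : {set V}) : Prop :=
  edge e /\ hull e `<=` closure Omega `\` Omega.
Definition interior_edge (e : {set V}) : Prop :=
  edge e /\ ~ (hull e `<=` closure Omega `\` Omega).

Definition interior_vertex (a : V) : Prop := Omega (pos a).
Definition boundary_vertex (a : V) : Prop :=
  (closure Omega `\` Omega) (pos a).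

Definition interior_cell (T : {set V}) : Prop :=
  T \in Th /\ forall e : {set V}, #|e| = 2%N -> e \subset T -> interior_edge e.

(* [q T] is the polynomial field that v coincides with on T; the traces of v on
   the edges of T are those of [q T]. *)
Definition Vel0 : set (R * R -> R * R) :=
  [set v | Hdiv0 v /\ exists q : {set V} -> (R * R -> R * R),
    [/\ forall T, T \in Th -> v = q T %[ae area2 in hull T],
        forall a b c : V, [set a; b; c]%SET \in Th ->
          P1plus (pos a) (pos b) (pos c) (q [set a; b; c]%SET),
        forall (a b : V) T T', interior_edge [set a; b]%SET ->
          T \in Th -> T' \in Th ->
          [set a; b]%SET \subset T -> [set a; b]%SET \subset T' ->
          tangential_integral (q T) (pos a) (pos b) =
          tangential_integral (q T') (pos a) (pos b) &
        forall (a b : V) T, boundary_edge [set a; b]%SET ->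
          T \in Th -> [set a; b]%SET \subset T ->
          tangential_integral (q T) (pos a) (pos b) = 0]].

(* The contribution [f] of the cell with vertices [a], [b], [c]; its values
   on the skeleton of the triangulation, a null set, are set to 0. *)
Definition on_cell (a b c : V) (f : R * R -> R * R) : R * R -> R * R :=
  patch (fun=> 0) (hull [set a; b; c]%SET)° f.

Local Notation S a b c := (area (pos a) (pos b) (pos c)).
Local Notation wE a b c := (w_edge (pos a) (pos b) (pos c)).
Local Notation wV a b c := (w_vert (pos a) (pos b) (pos c)).
Local Notation yV a b c := (y_vert (pos a) (pos b) (pos c)).
Local Notation d a b := (dist2 (pos a) (pos b)).
Local Notation ang a b c := (angle (pos a) (pos b) (pos c)).

(* T_0 = a1 a2 a3, e_j is opposite to a_j, and b_j is the vertex opposite to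
   e_j in T_j. *)
Definition psi_cell (a1 a2 a3 b1 b2 b3 : V) : R * R -> R * R :=
  let S0 := S a1 a2 a3 in
  let S1 := S b1 a2 a3 in
  let S2 := S b2 a3 a1 in
  let S3 := S b3 a1 a2 in
  fun x =>
    on_cell b1 a2 a3 (fun z => (S1 / (S1 + S0)) *: wE b1 a2 a3 z) x
  + on_cell b2 a3 a1 (fun z => (S2 / (S2 + S0)) *: wE b2 a3 a1 z) x
  + on_cell b3 a1 a2 (fun z => (S3 / (S3 + S0)) *: wE b3 a1 a2 z) x
  + on_cell a1 a2 a3 (fun z => (1 / 3) *: (
        ((S1 - 2 * S0) / (S1 + S0)) *: wE a1 a2 a3 z
      + ((S2 - 2 * S0) / (S2 + S0)) *: wE a2 a3 a1 z
      + ((S3 - 2 * S0) / (S3 + S0)) *: wE a3 a1 a2 z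
      + wV a1 a2 a3 z + wV a2 a3 a1 z + wV a3 a1 a2 z)) x.

Definition cell_functions : set (R * R -> R * R) :=
  [set psi | exists a1 a2 a3 b1 b2 b3 : V,
    [/\ interior_cell [set a1; a2; a3]%SET,
        [set b1; a2; a3]%SET \in Th /\ b1 != a1,
        [set b2; a3; a1]%SET \in Th /\ b2 != a2,
        [set b3; a1; a2]%SET \in Th /\ b3 != a3 &
        psi = psi_cell a1 a2 a3 b1 b2 b3]].

(* b3, b4, b5, b6 are the vertices of T_3, T_4, T_5, T_6 opposite to e_1, e_4,
   e_3, e_2.  Where two of these cells coincide the contributions add up. *)
Definition psi_edge_boundary (a1 a2 a3 a4 b3 b4 : V) : R * R -> R * R :=
  let S1 := S a1 a2 a3 in
  let S2 := S a1 a3 a4 in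
  let S3 := S a1 a2 b3 in
  let S4 := S a4 a1 b4 in
  let d1 := d a1 a2 in
  let d2 := d a2 a3 in
  let d3 := d a3 a4 in
  let d4 := d a4 a1 in
  let alpha2 := ang a2 a1 a3 in
  let beta3 := ang a3 a1 a2 in
  let alpha3 := ang a3 a1 a4 in
  let beta4 := ang a4 a1 a3 in
  let c := (1 / 2 * d2 * d3 * sin (alpha3 + beta3) - (S1 + S2)) / (S1 + S2) in
  fun x =>
    on_cell a1 a2 a3 (fun z =>
        yV a1 a2 a3 z
      + (d1 * cos alpha2 / d2) *: wV a1 a2 a3 z
      + (S3 / (S3 + S1)) *: wE a3 a1 a2 z
      + c *: wE a2 a1 a3 z) x
  + on_cell a1 a3 a4 (fun z =>
      - yV a1 a3 a4 z
      + (d4 * cos beta4 / d3) *: wV a1 a3 a4 z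
      + (S4 / (S4 + S2)) *: wE a3 a4 a1 z
      + c *: wE a4 a1 a3 z) x
  + on_cell a1 a2 b3 (fun z => (S3 / (S3 + S1)) *: wE b3 a1 a2 z) x
  + on_cell a4 a1 b4 (fun z => (S4 / (S4 + S2)) *: wE b4 a4 a1 z) x.

Definition psi_edge_interior (a1 a2 a3 a4 b3 b4 b5 b6 : V) :
    R * R -> R * R :=
  let S1 := S a1 a2 a3 in
  let S2 := S a1 a3 a4 in
  let S3 := S a1 a2 b3 in
  let S4 := S a4 a1 b4 in
  let S5 := S a3 a4 b5 in
  let S6 := S a2 a3 b6 in
  let d0 := d a1 a3 in
  let d1 := d a1 a2 in
  let d2 := d a2 a3 in
  let d3 := d a3 a4 in
  let d4 := d a4 a1 in
  let alpha1 := ang a1 a2 a3 in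
  let beta1 := ang a1 a3 a4 in
  let beta3 := ang a3 a1 a2 in
  let alpha3 := ang a3 a1 a4 in
  let K := (1 / 2 * d2 * d3 * sin (alpha3 + beta3)
            - 1 / 2 * d1 * d4 * sin (alpha1 + beta1)) / (2 * (S1 + S2)) in
  fun x =>
    on_cell a1 a2 a3 (fun z =>
        (S3 / (2 * (S3 + S1)) - 1) *: wE a3 a1 a2 z
      + (1 - S6 / (2 * (S6 + S1))) *: wE a1 a2 a3 z
      + K *: wE a2 a1 a3 z
      + (d2 * cos beta3 / d0 - 1 / 2) *: wV a2 a1 a3 z
      + (1 / 2) *: wV a1 a2 a3 z
      - (1 / 2) *: wV a3 a1 a2 z
      + yV a2 a1 a3 z) x
  + on_cell a1 a3 a4 (fun z =>
        (S4 / (2 * (S4 + S2)) - 1) *: wE a3 a4 a1 z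
      + (1 - S5 / (2 * (S5 + S2))) *: wE a1 a3 a4 z
      + K *: wE a4 a1 a3 z
      + (1 / 2 - d4 * cos beta1 / d0) *: wV a4 a1 a3 z
      + (1 / 2) *: wV a1 a3 a4 z
      - (1 / 2) *: wV a3 a1 a4 z
      - yV a4 a1 a3 z) x
  + on_cell a1 a2 b3 (fun z => (S3 / (2 * (S3 + S1))) *: wE b3 a1 a2 z) x
  + on_cell a4 a1 b4 (fun z => (S4 / (2 * (S4 + S2))) *: wE b4 a4 a1 z) x
  + on_cell a3 a4 b5 (fun z => - (S5 / (2 * (S5 + S2))) *: wE b5 a3 a4 z) x
  + on_cell a2 a3 b6 (fun z => - (S6 / (2 * (S6 + S1))) *: wE b6 a2 a3 z) x.

(* The edge functions, [start e] being the endpoint of [e] called A_1. *)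
Definition edge_functions (start : {set V} -> V) : set (R * R -> R * R) :=
  [set psi | exists a1 a2 a3 a4 b3 b4 : V,
    [/\ interior_edge [set a1; a3]%SET /\ start [set a1; a3]%SET = a1,
        [/\ [set a1; a2; a3]%SET \in Th, [set a1; a3; a4]%SET \in Th,
            cross2 (pos a3 - pos a1) (pos a2 - pos a1) < 0 &
            0 < cross2 (pos a3 - pos a1) (pos a4 - pos a1)],
        [set a1; a2; b3]%SET \in Th /\ b3 != a3,
        [set a4; a1; b4]%SET \in Th /\ b4 != a3 &
        (boundary_vertex a3 /\ psi = psi_edge_boundary a1 a2 a3 a4 b3 b4) \/
        (interior_vertex a3 /\ exists b5 b6 : V,
          [/\ [set a3; a4; b5]%SET \in Th /\ b5 != a1,
              [set a2; a3; b6]%SET \in Th /\ b6 != a1 &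
              psi = psi_edge_interior a1 a2 a3 a4 b3 b4 b5 b6])]].

End domain.
End plane.

(* Main.v *)
Require Import Defs.
From HB Require Import structures.
From mathcomp Require Import all_boot all_order all_algebra.
From mathcomp Require Import all_classical all_reals all_analysis.
From mathcomp Require Import measurable_realfun.
From mathcomp Require Import ring lra.

Set Implicit Arguments.
Unset Strict Implicit.
Unset Printing Implicit Defensive.

Import Order.TTheory GRing.Theory Num.Theory.
Import numFieldNormedType.Exports.

Local Open Scope classical_set_scope.
Local Open Scope ring_scope.

(* A field of P1+ on a triangle is determined by its traces on the edges: the
   affine normal component and the integral of the tangential one.  Call a family of
   such fields on the cells conforming if the traces on each edge agree between
   the two adjacent cells and vanish on the boundary.  By Green's formula on each
   cell, the boundary functional of a piecewise field is a sum over the edges of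
   integrals of jumps of the normal component.  Testing with a fixed bump on one
   edge times 1 / (1 + n t^2), t being the distance to its line, and letting n tend to
   infinity isolates this edge; hence Vel0 consists of the conforming families.

   Each psi_e is conforming, with flux 1 through e and 0 through the other edges,
   so subtracting multiples of the psi_e from a conforming family leaves one
   without flux.  On a cell T of such a family, the number
   2 N_1 + 2 D tau / L (on an edge of length sqrt L, N_1 / sqrt L is the final value
   of the normal component and tau the tangential integral; D is twice the signed area)
   is the same for the three edges.  It vanishes if T has a boundary edge, and the
   psi_T change it on T only, so it can be made zero on every cell.  Then each
   interior edge satisfies this equation for both its cells, with D of opposite
   signs, so N_1 = tau = 0 and all traces vanish. *)

(** * Green's formula on a triangle *)

(** P1+ has dimension 7, while the traces on three edges are nine numbers. For fields without flux
    the two missing relations are the equality of the three moments, so such a field has four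
    degrees of freedom: the common moment and one parameter per edge. w_{T,e} is the field of moment
    0 whose trace lives on e alone. Prescribing the moments in both cells of an edge fixes a trace
    without flux, as the two determinants differ; the moments -2 in T_0 and 0 in T_j give the ratio
    S_j / (S_j + S_0) in psi_T.

    In the passage from H_0(div) to conforming families the obstacle is the divergence g, known only
    to be square integrable and to satisfy Green's formula. The tests are dominated by the bump and
    tend to 0 off the open edge, so g minus the cellwise divergence drops out in the limit and need
    not be identified. On the edge itself the tests do not depend on n. An affine factor in the bump
    gives two independent tests per edge, as many as an affine normal component has parameters. *)

Section slices.
Variable R : realType.
Implicit Types a b c p r : R * R.
Local Notation mR2 := (measurableTypeR R * measurableTypeR R)%type.
Local Notation area2 := (@lebesgue_measure R \x @lebesgue_measure R)%E.

Lemma continuous_pair (T : topologicalType) (f g : T -> R) :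
  continuous f -> continuous g -> continuous (fun x => (f x, g x)).
Proof. by move=> cf cg x; exact: (cvg_pair (cf x) (cg x)). Qed.

Lemma ball_rat_box (x : R * R) (e : R) : 0 < e ->
  exists q1 q2 r : rat, ball (ratr q1 : R, ratr q2 : R) (ratr r : R) x /\
    ball (ratr q1 : R, ratr q2 : R) (ratr r : R) `<=` ball x e.
Proof.
move=> e0.
have [r] := rat_in_itvoo (divr_gt0 e0 (ltr0Sn R 1)).
rewrite in_itv /= => /andP[r0 re].
have close (y : R) : exists q : rat, `|ratr q - y| < ratr r.
  have [q] : exists q : rat, ratr q \in `]y, y + ratr r[.
    by apply: rat_in_itvoo; rewrite ltrDl.
  rewrite in_itv /= => /andP[yq qy].
  by exists q; rewrite ger0_norm ?subr_ge0 ?(ltW yq)// ltrBlDl.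
have [q1 hq1] := close x.1; have [q2 hq2] := close x.2.
exists q1, q2, r; split; first by split.
have tri (q y z : R) : `|q - y| < ratr r -> `|q - z| < ratr r -> `|y - z| < e.
  move=> h1 h2; have -> : y - z = (q - z) - (q - y) by ring.
  by rewrite (le_lt_trans (ler_normB _ _))//; lra.
by move=> z [z1 z2]; split; [apply: tri hq1 z1|apply: tri hq2 z2].
Qed.

(** Balls of the sup norm are rectangles, hence measurable for the product sigma-algebra, and by
    density those with rational centre and radius that lie in [U] cover it; there are countably
    many. *)
Lemma open_measurable2 (U : set (R * R)) : open U ->
  measurable (U : set mR2).
Proof.
move=> oU.
pose B (q1 q2 r : rat) : set (R * R) :=
  ball (ratr q1 : R, ratr q2 : R) (ratr r : R).
have mB q1 q2 (r : rat) : measurable (B q1 q2 r : set mR2).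
  rewrite (_ : B _ _ _ = ball (ratr q1 : R) (ratr r) `*` ball (ratr q2 : R) (ratr r)).
    by apply: measurableX; exact: measurable_ball.
  by [].
have -> : U = \bigcup_q1 \bigcup_q2 \bigcup_r
    (if pselect (B q1 q2 r `<=` U) then B q1 q2 r else set0).
  apply/seteqP; split => x.
    move=> Ux; have /nbhs_ballP[e /= e0 xeU] := open_nbhs_nbhs (conj oU Ux).
    have [q1 [q2 [r [xB Be]]]] := ball_rat_box x e0.
    exists q1 => //; exists q2 => //; exists r => //.
    case: (pselect (B q1 q2 r `<=` U)) => // nBU; exfalso; apply: nBU.
    exact: subset_trans Be xeU.
  move=> [q1 _ [q2 _ [r _]]]; by case: (pselect (B q1 q2 r `<=` U)) => // BU; exact: BU.
apply: bigcupT_measurable_rat => q1.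
apply: bigcupT_measurable_rat => q2.
apply: bigcupT_measurable_rat => r.
by case: (pselect (B q1 q2 r `<=` U)) => ?; [exact: mB|exact: measurable0].
Qed.

Lemma continuous_measurable2 (f : R * R -> R) :
  continuous f -> measurable_fun setT (f : mR2 -> R).
Proof.
move=> cf; apply: (measurability _ (RGenOInfty.measurableE R)) => //.
move=> _ [_ [a ->] <-]; rewrite setTI; apply: open_measurable2.
by move/continuousP: cf; apply; exact: rray_open.
Qed.

(** By Fubini: a line that is not vertical meets every vertical section in one point. A vertical
    line is a rectangle of measure 0 * oo, which is 0. *)
Lemma line_null (p u : R * R) : u != 0 ->
  area2 ([set x : R * R | cross2 u (x - p) = 0] : set mR2) = 0%E.
Proof.
move=> u0; pose A : set (R * R) := [set x | cross2 u (x - p) = 0].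
have [u1|u1] := eqVneq u.1 0.
  have u2 : u.2 != 0.
    by apply: contra_neq u0 => u2; rewrite [u]surjective_pairing u1 u2.
  have -> : [set x : R * R | cross2 u (x - p) = 0] = [set p.1] `*` setT.
    apply/seteqP; split => x /=; rewrite /cross2 /= u1.
      move=> h; split => //; apply/eqP; rewrite -subr_eq0.
      have /eqP : u.2 * (x.1 - p.1) = 0 by lra.
      by rewrite mulf_eq0 (negbTE u2).
    by move=> [-> _]; rewrite subrr; ring.
  rewrite product_measure1E//.
  transitivity (0 * lebesgue_measure [set: R])%E; last by rewrite mul0e.
  by congr (_ * _)%E; exact: lebesgue_measure_set1.
rewrite /product_measure1 integral0_eq// => x _ /=.
have [y0 hy0] : exists y0 : R, xsection [set x : R * R | cross2 u (x - p) = 0] x = [set y0].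
  exists (p.2 + u.2 * (x - p.1) / u.1).
  apply/seteqP; split => y; rewrite /xsection /= inE /cross2 /=.
    move=> h; have -> : y = p.2 + (u.1 * (y - p.2)) / u.1 by field.
    by have -> : u.1 * (y - p.2) = u.2 * (x - p.1) by lra.
  by move=> ->; field.
by rewrite hy0 lebesgue_measure_set1.
Qed.

(** Signed barycentric coordinates make this independent of the orientation. For a degenerate
    triangle they are 0 by division by zero, and the set is empty. *)
Definition open_tri (a b c : R * R) : set (R * R) :=
  [set x | [/\ 0 < bary a b c x, 0 < bary b c a x & 0 < bary c a b x]].

(** The integral in the parameter of the segment, without the length factor: the length enters
    through the tangent vectors [r - p], which are never normalised. *)
Definition seg_int (G : R * R -> R) (p r : R * R) : R :=
  (\int[@lebesgue_measure R]_(s in `[0, 1]%classic) G (p + s *: (r - p)))%R.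

Lemma slice_FTC (G : R * R -> R) (l r y : R) : C1 G -> l < r ->
  (\int[@lebesgue_measure R]_(x in `]l, r[%classic) (dx G (x, y))%:E =
   (G (r, y) - G (l, y))%:E)%E.
Proof.
move=> [dG cGx cGy] lr.
pose F : R -> R := fun x => G (x, y).
have quot x : (fun h : R => h^-1 *: ((F \o shift x) (h *: 1) - F x)) =
    (fun h : R => h^-1 *: ((G \o shift (x, y)) (h *: ((1, 0) : R * R)) - G (x, y))).
  apply/funext => h /=; rewrite /F; congr (_ *: (G _ - _)).
  by apply: injective_projections => /=; rewrite ?scaler0 ?add0r.
have FE x : F^`()%classic x = dx G (x, y).
  by rewrite derive1E /dx /derive quot.
have dF x : derivable F x 1.
  by rewrite /derivable quot; exact/diff_derivable/dG.
have cF : continuous F by move=> x; apply: differentiable_continuous; apply/derivable1_diffP.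
have cpair : continuous (fun x : R => (x, y)).
  by apply: continuous_pair => x; [exact: cvg_id|exact: cvg_cst].
rewrite -(integral_itv_bndoo true false); last first.
  apply/measurable_EFinP; apply: (measurable_funS measurableT) => //.
  apply: continuous_measurable_fun => x.
  by apply: (continuous_comp (cpair x)); exact: cGx.
have c1 : {within `[l, r]%classic, continuous (fun x : R => dx G (x, y))}.
  apply: continuous_subspaceT => x.
  by apply: (continuous_comp (cpair x)); exact: cGx.
have c2 : derivable_oo_LRcontinuous F l r.
  split; first by move=> x _; exact: dF.
  + by apply: cvg_at_right_filter; exact: cF.
  + by apply: cvg_at_left_filter; exact: cF.
exact: (continuous_FTC2 lr c1 c2 (fun x _ => FE x)).
Qed.

(** The abscissa at height [y] on the line through [p] and [r]. The value for a horizontal segment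
    is irrelevant, since [crossing] is then 0. *)
Definition xline (p r : R * R) (y : R) : R :=
  p.1 + (y - p.2) / (r.2 - p.2) * (r.1 - p.1).

(* The sign with which the segment [p r] crosses the height [y]. *)
Definition crossing (p r : R * R) (y : R) : R :=
  (p.2 < y < r.2)%R%:R - (r.2 < y < p.2)%R%:R.

Lemma xlineC p r y : p.2 != r.2 -> xline p r y = xline r p y.
Proof.
by move=> pr; rewrite /xline; field; rewrite !subr_eq0 pr eq_sym pr.
Qed.

Lemma crossingC p r y : crossing p r y = - crossing r p y.
Proof. by rewrite /crossing opprB. Qed.

Lemma tri_rot a b c : open_tri a b c = open_tri b c a.
Proof. by apply/seteqP; split => x [? ? ?]; split. Qed.

Lemma cross2_rot a b c : cross2 (b - a) (c - a) = cross2 (c - b) (a - b).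
Proof. by rewrite /cross2 /=; ring. Qed.

(** The second component of the identity saying that the weighted sum of [z - a], [z - b], [z - c]
    is 0. *)
Lemma bary_height a b c (z : R * R) : cross2 (b - a) (c - a) != 0 ->
  bary a b c z * (z.2 - a.2) + bary b c a z * (z.2 - b.2)
    + bary c a b z * (z.2 - c.2) = 0.
Proof.
move=> D0; rewrite /bary -(cross2_rot a b c) -(cross2_rot c a b).
rewrite ![_ / _ * _]mulrAC -!mulrDl.
rewrite [X in X / _](_ : _ = 0) ?mul0r//.
by rewrite /cross2 /=; ring.
Qed.

Lemma bary_swap a b c : bary a c b = bary a b c.
Proof.
apply/funext => z; rewrite /bary.
have -> : cross2 (c - z) (b - z) = - cross2 (b - z) (c - z).
  by rewrite /cross2 /=; ring.
have -> : cross2 (c - a) (b - a) = - cross2 (b - a) (c - a).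
  by rewrite /cross2 /=; ring.
by rewrite invrN mulrNN.
Qed.

Lemma cross2C (u v : R * R) : cross2 u v = - cross2 v u.
Proof. by rewrite /cross2; ring. Qed.

Lemma tri_swap a b c : open_tri a c b = open_tri a b c.
Proof.
apply/seteqP; split => z [h1 h2 h3].
  by split; rewrite bary_swap.
by split; rewrite bary_swap.
Qed.

(** Here [a] is alone on its side of the horizontal line at [y]. The line then crosses the two sides
    through [a], and these determine the section: by [bary_height] the coordinate of [a] is positive
    as soon as the other two are. The sign of [D * (y - a.2)] decides which side is on the left. *)
Lemma tri_section_alone a b c y : 0 < cross2 (b - a) (c - a) * (y - a.2) ->
  0 < (y - a.2) * (b.2 - y) -> 0 < (y - a.2) * (c.2 - y) ->
  [set x | open_tri a b c (x, y)] = `]xline a c y, xline a b y[%classic.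
Proof.
set D := cross2 _ _ => hD hb hc.
have D0 : D != 0 by apply: contraTneq hD => ->; rewrite mul0r ltxx.
have ya : 0 < (y - a.2) ^+ 2.
  rewrite exprn_even_gt0//=; apply: contraTneq hD => ->.
  by rewrite mulr0 ltxx.
have same u : 0 < (y - a.2) * (u - y) -> 0 < (u - a.2) / D.
  move=> hu; have : 0 < ((u - a.2) / D) * (D * (y - a.2)) ^+ 2.
    rewrite (_ : _ * _ = ((y - a.2) * (u - y) + (y - a.2) ^+ 2) * (D * (y - a.2))).
      by rewrite mulr_gt0// addr_gt0.
    by field.
  by rewrite pmulr_lgt0// exprn_gt0.
have kc := same _ hc; have kb := same _ hb.
have ca : c.2 - a.2 != 0 by apply: contraTneq kc => ->; rewrite mul0r ltxx.
have ba : b.2 - a.2 != 0 by apply: contraTneq kb => ->; rewrite mul0r ltxx.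
have Eb x : bary b c a (x, y) = (c.2 - a.2) / D * (x - xline a c y).
  rewrite /bary -(cross2_rot a b c) -/D /cross2 /xline /=; field.
  by rewrite D0 ca.
have Ec x : bary c a b (x, y) = (b.2 - a.2) / D * (xline a b y - x).
  rewrite /bary (cross2_rot c a b) -/D /cross2 /xline /=; field.
  by rewrite D0 ba.
have pos_b x : (0 < bary b c a (x, y)) = (xline a c y < x).
  by rewrite Eb pmulr_rgt0// subr_gt0.
have pos_c x : (0 < bary c a b (x, y)) = (x < xline a b y).
  by rewrite Ec pmulr_rgt0// subr_gt0.
apply/seteqP; split => x /=; rewrite in_itv /=.
  by move=> [_]; rewrite pos_b pos_c => -> ->.
move=> /andP[]; rewrite -pos_b -pos_c => lb lc; split => //.
rewrite -(pmulr_lgt0 _ ya).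
have := bary_height (x, y) D0; rewrite /= => hh.
have -> : bary a b c (x, y) * (y - a.2) ^+ 2 =
    bary b c a (x, y) * ((y - a.2) * (b.2 - y)) +
    bary c a b (x, y) * ((y - a.2) * (c.2 - y)).
  by apply/eqP; rewrite -subr_eq0; apply/eqP; rewrite -[RHS](mul0r (y - a.2)) -hh; ring.
by rewrite addr_gt0// mulr_gt0.
Qed.

Lemma tri_section_alone' a b c y : cross2 (b - a) (c - a) * (y - a.2) < 0 ->
  0 < (y - a.2) * (b.2 - y) -> 0 < (y - a.2) * (c.2 - y) ->
  [set x | open_tri a b c (x, y)] = `]xline a b y, xline a c y[%classic.
Proof.
move=> hD hb hc; rewrite -tri_swap; apply: tri_section_alone => //.
by rewrite cross2C mulNr oppr_gt0.
Qed.

Lemma tri_section_empty a b c y : cross2 (b - a) (c - a) != 0 ->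
  0 < (y - a.2) * (y - b.2) -> 0 < (y - a.2) * (y - c.2) ->
  [set x | open_tri a b c (x, y)] = set0.
Proof.
move=> D0 hb hc; apply/seteqP; split => x //= -[la lb lc].
have ya : 0 < (y - a.2) ^+ 2.
  rewrite exprn_even_gt0//=; apply: contraTneq hb => ->.
  by rewrite mul0r ltxx.
have := bary_height (x, y) D0; rewrite /= => hh.
suff : 0 < (bary a b c (x, y) * (y - a.2) + bary b c a (x, y) * (y - b.2)
    + bary c a b (x, y) * (y - c.2)) * (y - a.2) by rewrite hh mul0r ltxx.
rewrite [ltRHS](_ : _ = bary a b c (x, y) * (y - a.2) ^+ 2 +
   bary b c a (x, y) * ((y - a.2) * (y - b.2)) +
   bary c a b (x, y) * ((y - a.2) * (y - c.2))); last by ring.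
by rewrite !addr_gt0// mulr_gt0.
Qed.

Definition edge_term (G : R * R -> R) (p r : R * R) (y : R) : R :=
  crossing p r y * G (xline p r y, y).

Lemma crossing_between p r y : 0 < (y - p.2) * (r.2 - y) ->
  crossing p r y = Num.sg (y - p.2).
Proof.
rewrite /crossing; have [h|h|->] := ltgtP y p.2.
- rewrite nmulr_rgt0 ?subr_lt0// => ->.
  by rewrite ltr0_sg ?subr_lt0// /= sub0r.
- rewrite pmulr_rgt0 ?subr_gt0// => ->.
  by rewrite gtr0_sg ?subr_gt0// andbF subr0.
- by rewrite subrr mul0r ltxx.
Qed.

Lemma crossing_outside p r y : 0 < (y - p.2) * (y - r.2) -> crossing p r y = 0.
Proof.
rewrite /crossing; have [h|h|->] := ltgtP y p.2.
- by rewrite nmulr_rgt0 ?subr_lt0// => /ltW; rewrite leNgt => /negbTE ->; rewrite /= subrr.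
- by rewrite pmulr_rgt0 ?subr_gt0// => /ltW; rewrite leNgt => /negbTE ->; rewrite /= ?andbF subrr.
- by rewrite subrr mul0r ltxx.
Qed.

(** The fundamental theorem of calculus on the section leaves the difference of [G] at its ends.
    Which end belongs to which side depends on the sign of [D * (y - a.2)]; the factor [sg D] and
    the signs in [crossing] compensate for this, so both cases have the same formula. *)
Lemma tri_slice_alone (G : R * R -> R) a b c y : C1 G ->
  cross2 (b - a) (c - a) != 0 ->
  0 < (y - a.2) * (b.2 - y) -> 0 < (y - a.2) * (c.2 - y) ->
  (\int[@lebesgue_measure R]_(x in [set x | open_tri a b c (x, y)]) (dx G (x, y))%:E =
   (Num.sg (cross2 (b - a) (c - a)) *
    (edge_term G a b y + edge_term G b c y + edge_term G c a y))%:E)%E.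
Proof.
set D := cross2 _ _ => CG D0 hb hc.
have ya : 0 < (y - a.2) ^+ 2.
  rewrite exprn_even_gt0//=; apply: contraTneq hb => ->.
  by rewrite mul0r ltxx.
have same u : 0 < (y - a.2) * (u - y) -> 0 < (u - a.2) * (y - a.2).
  move=> hu; rewrite (_ : _ * _ = (y - a.2) * (u - y) + (y - a.2) ^+ 2); last by ring.
  exact: addr_gt0.
have kc := same _ hc; have kb := same _ hb.
have ca : c.2 - a.2 != 0 by apply: contraTneq kc => ->; rewrite mul0r ltxx.
have ba : b.2 - a.2 != 0 by apply: contraTneq kb => ->; rewrite mul0r ltxx.
rewrite /edge_term (crossing_between hb) [in X in _ + X](crossingC c a) (crossing_between hc).
rewrite (@crossing_outside b c); last first.
  suff : 0 < (y - b.2) * (y - c.2) * (y - a.2) ^+ 2 by rewrite pmulr_lgt0.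
  rewrite [ltRHS](_ : _ = ((y - a.2) * (b.2 - y)) * ((y - a.2) * (c.2 - y))); last by ring.
  exact: mulr_gt0.
rewrite (@xlineC c a); last by rewrite -subr_eq0.
have DX : (xline a b y - xline a c y) * (((b.2 - a.2) * (y - a.2)) * ((c.2 - a.2) * (y - a.2)))
    = D * (y - a.2) * (y - a.2) ^+ 2.
  by rewrite /xline /D /cross2 /=; field; rewrite ca ba.
have [h|h|] := ltgtP 0 (D * (y - a.2)).
- rewrite tri_section_alone// slice_FTC//; last first.
    by rewrite -subr_gt0 -(pmulr_lgt0 _ (mulr_gt0 kb kc)) DX mulr_gt0.
  congr (_%:E); rewrite mul0r addr0 mulNr -mulrBr mulrA -sgrM.
  by rewrite gtr0_sg ?mul1r.
- rewrite tri_section_alone'// slice_FTC//; last first.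
    by rewrite -subr_lt0 -(pmulr_llt0 _ (mulr_gt0 kb kc)) DX pmulr_llt0.
  congr (_%:E); rewrite mul0r addr0 mulNr -mulrBr mulrA -sgrM.
  by rewrite ltr0_sg// mulN1r opprB.
- move/esym/eqP; rewrite mulf_eq0 (negbTE D0)/= => /eqP e.
  by move: ya; rewrite e expr0n ltxx.
Qed.

(** If [y] differs from the heights of the vertices, either one vertex is alone on its side of the
    line, or all three are on the same side and the section is empty. The formula is invariant under
    rotation of the vertices. *)
Lemma tri_slice (G : R * R -> R) a b c y : C1 G ->
  cross2 (b - a) (c - a) != 0 -> y != a.2 -> y != b.2 -> y != c.2 ->
  (\int[@lebesgue_measure R]_(x in [set x | open_tri a b c (x, y)]) (dx G (x, y))%:E =
   (Num.sg (cross2 (b - a) (c - a)) *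
    (edge_term G a b y + edge_term G b c y + edge_term G c a y))%:E)%E.
Proof.
move=> CG D0.
have alone_a := tri_slice_alone (y := y) CG D0.
set P := (X in _ -> _ -> _ -> X).
have alone_b : 0 < (y - b.2) * (c.2 - y) -> 0 < (y - b.2) * (a.2 - y) -> P.
  have Db : cross2 (c - b) (a - b) != 0 by rewrite -cross2_rot.
  move=> h1 h2; have e := tri_slice_alone CG Db h1 h2.
  rewrite -cross2_rot in e; rewrite /P tri_rot e.
  by congr ((_ * _)%:E); rewrite [LHS]addrC addrA.
have alone_c : 0 < (y - c.2) * (a.2 - y) -> 0 < (y - c.2) * (b.2 - y) -> P.
  have Dc : cross2 (a - c) (b - c) != 0 by rewrite cross2_rot.
  move=> h1 h2; have e := tri_slice_alone CG Dc h1 h2.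
  rewrite cross2_rot in e; rewrite /P -tri_rot e.
  by congr ((_ * _)%:E); rewrite -[LHS]addrA addrC.
have empty : 0 < (y - a.2) * (y - b.2) -> 0 < (y - a.2) * (y - c.2) ->
P.
  move=> hb hc; rewrite /P tri_section_empty// integral_set0.
  rewrite /edge_term (crossing_outside hb) (crossingC c a) (crossing_outside hc).
  rewrite (@crossing_outside b c); first by rewrite oppr0 !mul0r !addr0 mulr0.
  have ya : 0 < (y - a.2) ^+ 2.
    rewrite exprn_even_gt0//=; apply: contraTneq hb => ->.
    by rewrite mul0r ltxx.
  suff : 0 < (y - b.2) * (y - c.2) * (y - a.2) ^+ 2 by rewrite pmulr_lgt0.
  rewrite [ltRHS](_ : _ = ((y - a.2) * (y - b.2)) * ((y - a.2) * (y - c.2))); last by ring.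
  exact: mulr_gt0.
have pp (u v : R) : 0 < u -> 0 < v -> 0 < u * v by exact: mulr_gt0.
have nn (u v : R) : u < 0 -> v < 0 -> 0 < u * v by move=> *; rewrite nmulr_rgt0.
move: alone_a alone_b alone_c empty.
have [ha|ha|//] := ltgtP y a.2; have [hb|hb|//] := ltgtP y b.2;
  have [hc|hc|//] := ltgtP y c.2 => A B C E _ _ _.
- by apply: E; apply: nn; rewrite ?subr_lt0 ?subr_gt0.
- by apply: C; apply: pp; rewrite ?subr_lt0 ?subr_gt0.
- by apply: B; apply: pp; rewrite ?subr_lt0 ?subr_gt0.
- by apply: A; apply: nn; rewrite ?subr_lt0 ?subr_gt0.
- by apply: A; apply: pp; rewrite ?subr_lt0 ?subr_gt0.
- by apply: B; apply: nn; rewrite ?subr_lt0 ?subr_gt0.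
- by apply: C; apply: nn; rewrite ?subr_lt0 ?subr_gt0.
- by apply: E; apply: pp; rewrite ?subr_lt0 ?subr_gt0.
Qed.

End slices.

(** * Integration over edges and triangles, and Green's formula for the first partial derivative *)

Section triangles.
Variable R : realType.
Implicit Types a b c p r : R * R.
Local Notation mR2 := (measurableTypeR R * measurableTypeR R)%type.
Local Notation area2 := (@lebesgue_measure R \x @lebesgue_measure R)%E.

Lemma integrable_segment (g : R -> R) (u v : R) : continuous g ->
  lebesgue_measure.-integrable `[u, v]%classic (EFin \o g).
Proof.
move=> cg; apply: continuous_compact_integrable; first exact: segment_compact.
exact: continuous_subspaceT.
Qed.

Lemma continuous_segment p r : continuous (fun s : R => p + s *: (r - p)).
Proof.
move=> s; apply: cvgD; first exact: cvg_cst.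
by apply: cvgZr_tmp; exact: cvg_id.
Qed.

Lemma seg_intC (G : R * R -> R) p r : continuous G ->
  seg_int G p r = seg_int G r p.
Proof.
move=> cG; rewrite /seg_int.
rewrite Rintegration_by_substitution_onem ?lexx ?ler01//; last first.
  apply: continuous_subspaceT => s.
  by apply: (continuous_comp (@continuous_segment p r s)); exact: cG.
rewrite /unstable.onem subrr; apply: eq_Rintegral => s _; congr G.
by apply: injective_projections => /=; rewrite /GRing.scale /=; ring.
Qed.

(** The substitution [y = p.2 + s * (r.2 - p.2)] turns the integral over heights into one over the
    parameter. It is increasing only for [p.2 < r.2]; a descending edge is treated by reversal, and
    a horizontal one contributes 0 on both sides. *)
Lemma edge_term_integral_lt (G : R * R -> R) p r : continuous G -> p.2 < r.2 ->
  lebesgue_measure.-integrable setT (EFin \o edge_term G p r) /\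
  (\int[@lebesgue_measure R]_y edge_term G p r y = (r.2 - p.2) * seg_int G p r)%R.
Proof.
move=> cG pr.
pose g y := G (xline p r y, y).
have cg : continuous g.
  have cx : continuous (xline p r).
    move=> y; apply: cvgD; first exact: cvg_cst.
    apply: cvgM; last exact: cvg_cst.
    apply: cvgM; last exact: cvg_cst.
    by apply: cvgB; [exact: cvg_id|exact: cvg_cst].
  move=> y; apply: (@continuous_comp _ _ _ (fun y => (xline p r y, y)) G); last exact: cG.
  by apply: continuous_pair => // z; exact: cvg_id.
have eE : edge_term G p r = g \_ `]p.2, r.2[%classic.
  apply/funext => y; rewrite /edge_term /crossing patchE mem_setE in_itv /=.
  have [/andP[py yr]|_] := boolP (p.2 < y < r.2).
    by rewrite [r.2 < y]ltNge (ltW yr) /= subr0 mul1r.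
  rewrite sub0r; have [/andP[ry yp]|_] := boolP (r.2 < y < p.2).
    by have := lt_trans pr (lt_trans ry yp); rewrite ltxx.
  by rewrite oppr0 mul0r.
have ig : lebesgue_measure.-integrable `]p.2, r.2[%classic (EFin \o g).
  apply: (integrableS _ _ _ (@integrable_segment g p.2 r.2 cg)) => //.
  by apply: subset_itv; rewrite bnd_simp.
split.
  have -> : EFin \o edge_term G p r = (EFin \o g) \_ `]p.2, r.2[%classic.
    by rewrite eE; apply/funext => y /=; rewrite !patchE; case: ifP.
  exact: (iffLR (integrable_mkcond _ _) ig).
rewrite eE -Rintegral_mkcond.
pose F (s : R) := p.2 + s * (r.2 - p.2).
have dF (s : R) : is_derive s 1 F (r.2 - p.2).
  by apply: is_derive_eq; rewrite add0r mul1r scaler0 add0r /GRing.scale /= mulr1.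
have F'E : F^`()%classic = cst (r.2 - p.2).
  by apply/funext => s; rewrite derive1E derive_val.
have cF : continuous F by move=> s; apply: differentiable_continuous; apply/derivable1_diffP.
have F0 : F 0 = p.2 by rewrite /F mul0r addr0.
have F1 : F 1 = r.2 by rewrite /F mul1r addrC subrK.
rewrite /Rintegral -(integral_itv_bndoo true false); last first.
  by apply/measurable_EFinP; apply: (measurable_funS measurableT) => //; exact: continuous_measurable_fun.
rewrite -F0 -F1 integration_by_substitution_increasing//; first last.
- exact: continuous_subspaceT.
- split; first by move=> s _; exact: (@ex_derive _ _ _ _ _ _ _ (dF s)).
  + by apply: cvg_at_right_filter; exact: cF.
  + by apply: cvg_at_left_filter; exact: cF.
- by rewrite F'E; exact: is_cvg_cst.
- by rewrite F'E; exact: is_cvg_cst.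
- by rewrite F'E => s _; exact: cvg_cst.
- by move=> s t _ _ st; rewrite /F ltrD2l ltr_pM2r ?subr_gt0.
rewrite F'E F0 F1 /seg_int -RintegralZl//; last first.
  apply: integrable_segment => s.
  by apply: (continuous_comp (@continuous_segment p r s)); exact: cG.
apply: eq_Rintegral => s _ /=.
rewrite mulrC; congr (_ * G _); apply: injective_projections => /=.
  rewrite /xline /F /GRing.scale /=; field.
  by rewrite subr_eq0 gt_eqF.
by rewrite /F /GRing.scale.
Qed.

Lemma edge_term_integral (G : R * R -> R) p r : continuous G ->
  lebesgue_measure.-integrable setT (EFin \o edge_term G p r) /\
  (\int[@lebesgue_measure R]_y edge_term G p r y = (r.2 - p.2) * seg_int G p r)%R.
Proof.
move=> cG; have [pr|rp|pr] := ltgtP p.2 r.2.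
- exact: edge_term_integral_lt.
- have [ie eE] := edge_term_integral_lt cG rp.
  have E : edge_term G p r = (fun y => -1 * edge_term G r p y).
    apply/funext => y; rewrite /edge_term crossingC xlineC ?gt_eqF//.
    by rewrite mulN1r mulNr.
  split.
    rewrite E (_ : EFin \o _ = (fun y => (-1)%:E * (EFin \o edge_term G r p) y)%E).
      exact: integrableZl.
    by apply/funext.
  rewrite E RintegralZl// eE seg_intC//; ring.
- have E : edge_term G p r = (fun=> 0).
    apply/funext => y; rewrite /edge_term /crossing pr.
    by rewrite subrr mul0r.
  by rewrite E pr subrr mul0r; split; [exact: integrable0|by rewrite /Rintegral integral0_eq].
Qed.

Lemma measurable_box (M : R) :
  measurable (`[- M, M]%classic `*` `[- M, M]%classic : set mR2).
Proof. by apply: measurableX. Qed.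

Lemma box_lty (M : R) :
  (area2 (`[(- M)%R, M]%classic `*` `[(- M)%R, M]%classic : set mR2) < +oo)%E.
Proof.
rewrite product_measure1E//.
have h : (lebesgue_measure (`[(- M)%R, M]%classic : set R) < +oo)%E.
  by rewrite lebesgue_measure_itv; case: ifP => _; rewrite ?ltry// -EFinB ltry.
by apply: lte_mul_pinfty => //; rewrite ge0_fin_numE.
Qed.

Lemma continuous_box_bounded (f : R * R -> R) (M : R) : continuous f ->
  exists K, forall x, (`[- M, M]%classic `*` `[- M, M]%classic) x -> `|f x| <= K.
Proof.
move=> cf.
have : compact (f @` (`[- M, M]%classic `*` `[- M, M]%classic)).
  apply: continuous_compact; first exact: continuous_subspaceT.
  by apply: compact_setX; exact: segment_compact.
move=> /compact_bounded[K [_ hK]].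
exists (K + 1) => x Bx; apply: (hK (K + 1)); first by rewrite ltrDl.
by exists x.
Qed.

Lemma integrable_box (f : R * R -> R) (A : set (R * R)) (M : R) :
  continuous f -> measurable (A : set mR2) ->
  A `<=` `[- M, M]%classic `*` `[- M, M]%classic ->
  area2.-integrable (A : set mR2) (EFin \o f).
Proof.
move=> cf mA AM; apply: measurable_bounded_integrable => //.
- apply: le_lt_trans (box_lty M); apply: le_measure => //; rewrite inE//.
  exact: measurable_box.
- by apply: (measurable_funS measurableT) => //; exact: continuous_measurable2.
- have [K hK] := continuous_box_bounded M cf.
  exists K; split; first exact: num_real.
  by move=> x Kx z /AM/hK /le_trans; apply; exact: ltW.
Qed.

Lemma affine2_continuous (f : R * R -> R) : affine2 f -> continuous f.
Proof.
move=> [k [k1 [k2 fE]]]; rewrite (_ : f = fun x => k + k1 * x.1 + k2 * x.2); last exact/funext.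
move=> x; apply: cvgD; first apply: cvgD; first exact: cvg_cst.
  by apply: cvgM; [exact: cvg_cst|exact: cvg_fst].
by apply: cvgM; [exact: cvg_cst|exact: cvg_snd].
Qed.

Lemma bary_affine a b c : affine2 (bary a b c).
Proof.
exists (cross2 b c / cross2 (b - a) (c - a)),
  ((b.2 - c.2) / cross2 (b - a) (c - a)), ((c.1 - b.1) / cross2 (b - a) (c - a)) => x.
rewrite /bary; set Di := _^-1; rewrite /cross2 /=; ring.
Qed.

Lemma bary_continuous a b c : continuous (bary a b c).
Proof. exact/affine2_continuous/bary_affine. Qed.

Lemma bary_sum a b c x : cross2 (b - a) (c - a) != 0 ->
  bary a b c x + bary b c a x + bary c a b x = 1.
Proof.
move=> D0; rewrite /bary -(cross2_rot a b c) (cross2_rot c a b) -!mulrDl.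
rewrite [X in X / _](_ : _ = cross2 (b - a) (c - a)) ?divff//.
by rewrite /cross2 /=; ring.
Qed.

Lemma bary_pos a b c x : cross2 (b - a) (c - a) != 0 ->
  bary a b c x *: a + bary b c a x *: b + bary c a b x *: c = x.
Proof.
move=> D0; rewrite /bary -(cross2_rot a b c) (cross2_rot c a b).
apply: injective_projections => /=; rewrite /GRing.scale /=;
  rewrite ![_ / _ * _]mulrAC -!mulrDl; apply: (canLR (mulfK D0));
  by rewrite /cross2 /=; ring.
Qed.

Lemma open_bary_gt0 a b c : open [set x | 0 < bary a b c x].
Proof.
rewrite (_ : [set x | _] = bary a b c @^-1` [set t | 0 < t])//.
by move/continuousP: (@bary_continuous a b c); apply; exact: open_gt.
Qed.

Lemma closed_bary_ge0 a b c : closed [set x | 0 <= bary a b c x].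
Proof.
rewrite (_ : [set x | _] = bary a b c @^-1` [set t | 0 <= t])//.
by apply: closed_comp => [x _|]; [exact: bary_continuous|exact: closed_ge].
Qed.

Lemma open_tri_open a b c : open (open_tri a b c).
Proof.
rewrite (_ : open_tri a b c = [set x | 0 < bary a b c x] `&`
   [set x | 0 < bary b c a x] `&` [set x | 0 < bary c a b x]); last first.
  by apply/seteqP; split => x [] // []; split.
by apply: openI; [apply: openI|]; exact: open_bary_gt0.
Qed.

Lemma open_tri_box a b c : exists M,
  open_tri a b c `<=` `[- M, M]%classic `*` `[- M, M]%classic.
Proof.
have [D0|D0] := eqVneq (cross2 (b - a) (c - a)) 0.
  (* A degenerate triangle is empty, its coordinates being 0 by division by zero. *)
  by exists 0 => x []; rewrite /bary D0 invr0 mulr0 ltxx.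
exists (`|a.1| + `|b.1| + `|c.1| + (`|a.2| + `|b.2| + `|c.2|)) => x [la lb lc].
have s1 := bary_sum x D0.
have key (u v w : R) : `|bary a b c x * u + bary b c a x * v + bary c a b x * w|
    <= `|u| + `|v| + `|w|.
  have h (l z : R) : 0 < l -> l <= 1 -> `|l * z| <= `|z|.
    by move=> l0 l1; rewrite normrM (gtr0_norm l0) ler_piMl.
  apply: (le_trans (ler_normD _ _)); apply: lerD; last by apply: h => //; lra.
  by apply: (le_trans (ler_normD _ _)); apply: lerD; apply: h => //; lra.
split; rewrite /= in_itv /= -ler_norml -[in X in X <= _](bary_pos x D0) /=.
- by rewrite (le_trans (key _ _ _))// lerDl !addr_ge0.
- by rewrite (le_trans (key _ _ _))// lerDr !addr_ge0.
Qed.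

Lemma open_tri_measurable a b c : measurable (open_tri a b c : set mR2).
Proof. by apply: open_measurable2; exact: open_tri_open. Qed.

Lemma integrable_tri (f : R * R -> R) a b c : continuous f ->
  area2.-integrable (open_tri a b c : set mR2) (EFin \o f).
Proof.
move=> cf; have [M hM] := open_tri_box a b c.
by apply: integrable_box hM => //; exact: open_tri_measurable.
Qed.

(** Fubini with horizontal slices: [tri_slice] applies at all heights but those of the three
    vertices, and each edge term integrates to a segment integral. *)
Lemma green_x (G : R * R -> R) a b c : C1 G -> cross2 (b - a) (c - a) != 0 ->
  (\int[area2]_(x in open_tri a b c) dx G x =
   Num.sg (cross2 (b - a) (c - a)) * ((b.2 - a.2) * seg_int G a b +
     (c.2 - b.2) * seg_int G b c + (a.2 - c.2) * seg_int G c a))%R.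
Proof.
move=> CG D0; have [dG cGx cGy] := CG.
have cG : continuous G by move=> x; exact/differentiable_continuous/dG.
have iG := @integrable_tri (dx G) a b c cGx.
have iG' := iffLR (integrable_mkcond _ (open_tri_measurable a b c)) iG.
set D := cross2 _ _ in D0 *.
have [iab Iab] := edge_term_integral a b cG.
have [ibc Ibc] := edge_term_integral b c cG.
have [ica Ica] := edge_term_integral c a cG.
rewrite -Iab -Ibc -Ica -RintegralD// -RintegralD//; last first.
  by have := integrableD measurableT iab ibc; apply: eq_integrable.
rewrite -RintegralZl//; last first.
  have := integrableD measurableT (integrableD measurableT iab ibc) ica.
  by apply: eq_integrable.
rewrite /Rintegral integral_mkcond -integral21_prod_meas1//.
congr fine; apply: ae_eq_integral => //.
- exact: (measurable_fubini_G iG').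
- apply/measurable_EFinP; apply: measurable_funM => //.
  by do !apply: measurable_funD; apply/measurable_EFinP; [case/integrableP: iab|case/integrableP: ibc|case/integrableP: ica].
- exists [set a.2; b.2; c.2]; split.
  + by apply: measurableU; [apply: measurableU|]; exact: measurable_set1.
  + apply: countable_lebesgue_measure0; apply: finite_set_countable.
    by rewrite !finite_setU; do !split; exact: finite_set1.
  + move=> y /= /not_implyP[_ hy]; apply: contrapT => ny; apply: hy.
    rewrite -tri_slice//; last 3 first.
    * by apply/eqP => e; apply: ny; left; left.
    * by apply/eqP => e; apply: ny; left; right.
    * by apply/eqP => e; apply: ny; right.
    rewrite /fubini_G [RHS]integral_mkcond; apply: eq_integral => x _.
    by rewrite !patchE; congr (if _ then _ else _); apply/idP/idP; rewrite !inE.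
Qed.

End triangles.

Lemma addr_rot (W : zmodType) (u v w : W) : u + v + w = v + w + u.
Proof. by rewrite -addrA addrC. Qed.

(** * Continuously differentiable functions of two variables *)

Section C1_calculus.
Variable R : realType.
Implicit Types (f g : R * R -> R) (x v : R * R).

Lemma differentiable_fst2 x : differentiable (fst : R * R -> R) x.
Proof. by apply: linear_differentiable => y; exact: cvg_fst. Qed.

Lemma differentiable_snd2 x : differentiable (snd : R * R -> R) x.
Proof. by apply: linear_differentiable => y; exact: cvg_snd. Qed.

Lemma derive_fst x v : 'D_v (fst : R * R -> R) x = v.1.
Proof.
rewrite deriveE; last exact: differentiable_fst2.
by rewrite diff_lin// => y; exact: cvg_fst.
Qed.

Lemma derive_snd x v : 'D_v (snd : R * R -> R) x = v.2.
Proof.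
rewrite deriveE; last exact: differentiable_snd2.
by rewrite diff_lin// => y; exact: cvg_snd.
Qed.

Lemma C1_continuous f : C1 f -> continuous f.
Proof. by move=> [df _ _] x; exact/differentiable_continuous/df. Qed.

Lemma C1_derivable f x v : C1 f -> derivable f x v.
Proof. by move=> [df _ _]; exact/diff_derivable/df. Qed.

Lemma C1_cst (k : R) : C1 (fun=> k).
Proof.
split => [x||]; first exact: differentiable_cst.
  by rewrite /dx => x; under eq_fun do rewrite derive_cst; exact: cvg_cst.
by rewrite /dy => x; under eq_fun do rewrite derive_cst; exact: cvg_cst.
Qed.

Lemma C1_fst : C1 (fst : R * R -> R).
Proof.
split => [x||]; first exact: differentiable_fst2.
  by rewrite /dx => x; under eq_fun do rewrite derive_fst; exact: cvg_cst.
by rewrite /dy => x; under eq_fun do rewrite derive_fst; exact: cvg_cst.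
Qed.

Lemma C1_snd : C1 (snd : R * R -> R).
Proof.
split => [x||]; first exact: differentiable_snd2.
  by rewrite /dx => x; under eq_fun do rewrite derive_snd; exact: cvg_cst.
by rewrite /dy => x; under eq_fun do rewrite derive_snd; exact: cvg_cst.
Qed.

Lemma derive_addf f g x v : C1 f -> C1 g ->
  'D_v (fun z => f z + g z) x = 'D_v f x + 'D_v g x.
Proof.
by move=> Cf Cg; rewrite (_ : (fun z => _) = f + g)// deriveD//; exact: C1_derivable.
Qed.

Lemma derive_mulf f g x v : C1 f -> C1 g ->
  'D_v (fun z => f z * g z) x = f x * 'D_v g x + g x * 'D_v f x.
Proof.
by move=> Cf Cg; rewrite (_ : (fun z => _) = f * g)// deriveM//; exact: C1_derivable.
Qed.

Lemma C1_add f g : C1 f -> C1 g -> C1 (fun x => f x + g x).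
Proof.
move=> Cf Cg; have [df fx fy] := Cf; have [dg gx gy] := Cg; split.
- by move=> x; exact: differentiableD.
- move=> x; rewrite /dx; under eq_fun do rewrite derive_addf//.
  by apply: cvgD; [exact: fx|exact: gx].
- move=> x; rewrite /dy; under eq_fun do rewrite derive_addf//.
  by apply: cvgD; [exact: fy|exact: gy].
Qed.

Lemma C1_mul f g : C1 f -> C1 g -> C1 (fun x => f x * g x).
Proof.
move=> Cf Cg; have [df fx fy] := Cf; have [dg gx gy] := Cg.
have cf := C1_continuous Cf; have cg := C1_continuous Cg; split.
- by move=> x; exact: differentiableM.
- move=> x; rewrite /dx; under eq_fun do rewrite derive_mulf//.
  by apply: cvgD; apply: cvgM; [exact: cf|exact: gx|exact: cg|exact: fx].
- move=> x; rewrite /dy; under eq_fun do rewrite derive_mulf//.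
  by apply: cvgD; apply: cvgM; [exact: cf|exact: gy|exact: cg|exact: fy].
Qed.

Lemma derive_compf (h h' : R -> R) f x v : C1 f ->
  (forall t : R, is_derive t (1 : R) h (h' t)) ->
  'D_v (fun z => h (f z)) x = h' (f x) * 'D_v f x.
Proof.
move=> [df _ _] dh.
have Dh t : differentiable h t by apply/derivable1_diffP; exact: (@ex_derive _ _ _ _ _ _ _ (dh t)).
have scale (w y : R) : 'D_w h y = w * h' y.
  rewrite -(@derive_val _ _ _ _ _ _ _ (dh y)) !deriveE//.
  by rewrite -[in LHS](mulr1 w); exact: (linearZ_LR ('d h y)).
rewrite mulrC deriveE; last exact: differentiable_comp.
by rewrite (diff_comp (df x) (Dh _)) /= -!deriveE// scale.
Qed.

Lemma C1_comp (h h' : R -> R) f : C1 f ->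
  (forall t : R, is_derive t (1 : R) h (h' t)) -> continuous h' -> C1 (fun x => h (f x)).
Proof.
move=> Cf dh ch'; have [df fx fy] := Cf; have cf := C1_continuous Cf.
have Dh t : differentiable h t by apply/derivable1_diffP; exact: (@ex_derive _ _ _ _ _ _ _ (dh t)).
split.
- by move=> x; exact: differentiable_comp.
- move=> x; rewrite /dx; under eq_fun do rewrite (derive_compf _ _ Cf dh).
  by apply: cvgM; [apply: continuous_comp; [exact: cf|exact: ch']|exact: fx].
- move=> x; rewrite /dy; under eq_fun do rewrite (derive_compf _ _ Cf dh).
  by apply: cvgM; [apply: continuous_comp; [exact: cf|exact: ch']|exact: fy].
Qed.

Lemma derive_affine f (k k1 k2 : R) x v :
  (forall z, f z = k + k1 * z.1 + k2 * z.2) -> 'D_v f x = k1 * v.1 + k2 * v.2.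
Proof.
move=> fE; have -> : f = fun z => k + k1 * z.1 + k2 * z.2 by exact/funext.
have C0 := C1_cst k.
have C1' := C1_mul (C1_cst k1) C1_fst; have C2 := C1_mul (C1_cst k2) C1_snd.
rewrite derive_addf ?(derive_addf _ _ C0 C1')//; last exact: C1_add.
rewrite (derive_mulf _ _ (C1_cst k1) C1_fst) (derive_mulf _ _ (C1_cst k2) C1_snd).
rewrite !derive_cst derive_fst derive_snd.
by rewrite !mulr0 !addr0 add0r.
Qed.

Lemma C1_affine f : affine2 f -> C1 f.
Proof.
move=> [k [k1 [k2 fE]]]; have -> : f = fun z => k + k1 * z.1 + k2 * z.2 by exact/funext.
apply: C1_add; first (apply: C1_add; first exact: C1_cst).
  by apply: C1_mul; [exact: C1_cst|exact: C1_fst].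
by apply: C1_mul; [exact: C1_cst|exact: C1_snd].
Qed.

Lemma derive_swap f x (v : R * R) :
  'D_v (fun z => f (z.2, z.1)) x = 'D_(v.2, v.1) f (x.2, x.1).
Proof.
rewrite /derive; congr (lim (_ @ _)); apply/funext => h /=; congr (_ *: (f _ - _)).
Qed.

(** Exchanging the coordinates reduces Green's formula in the second variable to that in the
    first. *)
Lemma C1_swap f : C1 f -> C1 (fun z => f (z.2, z.1)).
Proof.
move=> [df fx fy].
have csw : continuous (fun z : R * R => (z.2, z.1)).
  by apply: (@continuous_pair R _ (@snd R R) (@fst R R)) => z; [exact: cvg_snd|exact: cvg_fst].
split.
- move=> x; apply: (@differentiable_comp _ _ _ _ (fun z : R * R => (z.2, z.1)) f) => //.
  by apply: (@differentiable_pair _ _ _ _ (@snd R R) (@fst R R)); [exact: differentiable_snd2|exact: differentiable_fst2].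
- move=> x; rewrite /dx; under eq_fun do rewrite derive_swap /=.
  exact: (@continuous_comp _ _ _ (fun z : R * R => (z.2, z.1)) (dy f) x (csw x) (fy _)).
- move=> x; rewrite /dy; under eq_fun do rewrite derive_swap /=.
  exact: (@continuous_comp _ _ _ (fun z : R * R => (z.2, z.1)) (dx f) x (csw x) (fx _)).
Qed.

End C1_calculus.

(** * The divergence theorem on a triangle *)

Section triangle_green.
Variable R : realType.
Implicit Types a b c p r : R * R.
Local Notation mR2 := (measurableTypeR R * measurableTypeR R)%type.
Local Notation area2 := (@lebesgue_measure R \x @lebesgue_measure R)%E.

Lemma Rintegral_swap (f : R * R -> R) :
  area2.-integrable [set: mR2] (EFin \o f) ->
  area2.-integrable [set: mR2] (EFin \o (fun z => f (z.2, z.1))) ->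
  (\int[area2]_x f (x.2, x.1) = \int[area2]_x f x)%R.
Proof.
move=> if_ ifs; rewrite /Rintegral; congr fine.
by rewrite -(integral12_prod_meas1 ifs) -(integral21_prod_meas1 if_).
Qed.

Lemma open_tri_swap a b c (x : R * R) :
  open_tri (a.2, a.1) (b.2, b.1) (c.2, c.1) (x.2, x.1) <-> open_tri a b c x.
Proof.
have h p q r : bary (p.2, p.1) (q.2, q.1) (r.2, r.1) (x.2, x.1) = bary p q r x.
  rewrite /bary.
  have e (u v : R * R) : cross2 (u.2, u.1) (v.2, v.1) = - cross2 u v.
    by rewrite /cross2 /=; ring.
  by rewrite (e (q - x) (r - x)) (e (q - p) (r - p)) invrN mulrNN.
by split => -[h1 h2 h3]; split; rewrite ?h// -h.
Qed.

(** The exchange of coordinates reverses the orientation of the triangle, whence the minus sign. *)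
Lemma green_y (G : R * R -> R) a b c : C1 G -> cross2 (b - a) (c - a) != 0 ->
  (\int[area2]_(x in open_tri a b c) dy G x =
   - Num.sg (cross2 (b - a) (c - a)) * ((b.1 - a.1) * seg_int G a b +
     (c.1 - b.1) * seg_int G b c + (a.1 - c.1) * seg_int G c a))%R.
Proof.
move=> CG D0.
have D0' : cross2 ((b.2, b.1) - (a.2, a.1)) ((c.2, c.1) - (a.2, a.1)) =
    - cross2 (b - a) (c - a) by rewrite /cross2 /=; ring.
have := green_x (C1_swap CG) (a := (a.2, a.1)) (b := (b.2, b.1)) (c := (c.2, c.1)).
rewrite D0' oppr_eq0 sgrN => /(_ D0) /= <-.
rewrite Rintegral_mkcond [RHS]Rintegral_mkcond.
have [dG cGx cGy] := CG.
have iy := @integrable_tri _ (dy G) a b c cGy.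
have E : (dx (fun z => G (z.2, z.1)) \_ (open_tri (a.2, a.1) (b.2, b.1) (c.2, c.1)))
    = (fun z => (dy G \_ (open_tri a b c)) (z.2, z.1)).
  apply/funext => z; rewrite !patchE /dx derive_swap.
  have := open_tri_swap a b c (z.2, z.1); rewrite /= -surjective_pairing => h.
  by congr (if _ then _ else _); apply/idP/idP; rewrite !inE => /h.
rewrite E [RHS]Rintegral_swap//.
- have := iffLR (integrable_mkcond _ (open_tri_measurable a b c)) iy.
  by apply: eq_integrable => // z _ /=; rewrite !patchE; case: ifP.
- rewrite -E.
  have [_ + _] := C1_swap CG.
  move=> /(@integrable_tri _ _ (a.2, a.1) (b.2, b.1) (c.2, c.1)) i.
  have := iffLR (integrable_mkcond _ (open_tri_measurable _ _ _)) i.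
  by apply: eq_integrable => // z _ /=; rewrite !patchE; case: ifP.
Qed.

(** [cross2 (r - p) F] is minus the product of [F] with the vector of length |r - p| pointing to the
    right of the side. That vector is outward when the triangle is counterclockwise, which explains
    the factor [- sg D]. *)
Lemma green_tri (F1 F2 : R * R -> R) a b c : C1 F1 -> C1 F2 ->
  cross2 (b - a) (c - a) != 0 ->
  let flux p r := seg_int (fun x => cross2 (r - p) (F1 x, F2 x)) p r in
  (\int[area2]_(x in open_tri a b c) (dx F1 x + dy F2 x) =
   - Num.sg (cross2 (b - a) (c - a)) * (flux a b + flux b c + flux c a))%R.
Proof.
move=> C1F C2F D0 flux; have [_ c1 _] := C1F; have [_ _ c2] := C2F.
rewrite RintegralD; [|exact: open_tri_measurable|exact: integrable_tri|exact: integrable_tri].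
rewrite green_x// green_y//.
have fE p r : flux p r = (r.1 - p.1) * seg_int F2 p r - (r.2 - p.2) * seg_int F1 p r.
  have i (F : R * R -> R) : C1 F -> lebesgue_measure.-integrable `[0, 1]%classic
      (EFin \o (fun s => F (p + s *: (r - p)))).
    move=> CF; apply: integrable_segment => s.
    apply: (continuous_comp (@continuous_segment _ p r s)); exact: C1_continuous.
  have iZ (k : R) F : C1 F -> lebesgue_measure.-integrable `[0, 1]%classic
      (EFin \o (fun s => k * F (p + s *: (r - p)))).
    by move=> CF; exact: (i _ (C1_mul (C1_cst k) CF)).
  rewrite -(RintegralZl _ _ (i _ C2F))// -(RintegralZl _ _ (i _ C1F))//.
  by rewrite -(RintegralB _ (iZ _ _ C2F) (iZ _ _ C1F)).
by rewrite !fE; ring.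
Qed.

End triangle_green.

Ltac coords := rewrite /cross2 /dot2 /= /GRing.scale /= /GRing.scale /=.

(** * Fields of P1+ and their traces *)

Section local_fields.
Variable R : realType.
Implicit Types (a b c p r x : R * R) (q : R * R -> R * R).

(** The constant curl of a barycentric coordinate is parallel to the opposite side. *)
Definition curl_bary a b c : R * R := (cross2 (b - a) (c - a))^-1 *: (c - b).

Lemma curl_baryE a b c x : curl (bary a b c) x = curl_bary a b c.
Proof.
set Di := (cross2 (b - a) (c - a))^-1.
have E z : bary a b c z = cross2 b c * Di + ((b.2 - c.2) * Di) * z.1 + ((c.1 - b.1) * Di) * z.2.
  by rewrite /bary -/Di /cross2 /=; ring.
rewrite /curl /dx /dy !(derive_affine _ _ E) /curl_bary -/Di.
by apply: injective_projections => /=; rewrite /GRing.scale /= /GRing.scale /=; ring.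
Qed.

Lemma C1_bary a b c : C1 (bary a b c).
Proof. exact/C1_affine/bary_affine. Qed.

Lemma curl_mul (f g : R * R -> R) x : C1 f -> C1 g ->
  curl (fun z => f z * g z) x = f x *: curl g x + g x *: curl f x.
Proof.
move=> Cf Cg; rewrite /curl /dx /dy !derive_mulf//.
by apply: injective_projections => //=; rewrite /GRing.scale /= /GRing.scale /=; ring.
Qed.

Lemma w_vertE a b c x : w_vert a b c x = (2 * bary a b c x) *: curl_bary a b c.
Proof.
rewrite /w_vert.
have -> : (fun z => bary a b c z ^+ 2) = (fun z => bary a b c z * bary a b c z).
  by apply/funext => z; rewrite expr2.
rewrite (curl_mul _ (C1_bary a b c) (C1_bary a b c)) curl_baryE.
by apply: injective_projections => /=; rewrite /GRing.scale /= /GRing.scale /=; ring.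
Qed.

Definition bubble a b c x : R := bary a b c x * bary b c a x * bary c a b x.

Lemma curl_bubble a b c x : curl (bubble a b c) x =
  (bary b c a x * bary c a b x) *: curl_bary a b c +
  (bary c a b x * bary a b c x) *: curl_bary b c a +
  (bary a b c x * bary b c a x) *: curl_bary c a b.
Proof.
have C := C1_bary; rewrite (curl_mul _ (C1_mul (C a b c) (C b c a)) (C c a b)).
rewrite (curl_mul _ (C a b c) (C b c a)) !curl_baryE.
by apply: injective_projections => /=; rewrite /GRing.scale /= /GRing.scale /=; ring.
Qed.

Lemma w_edgeE a b c x : w_edge a b c x =
  (3 * bary b c a x * bary c a b x) *: curl_bary a b c +
  ((3 * bary a b c x - 1) * bary c a b x) *: curl_bary b c a +
  ((3 * bary a b c x - 1) * bary b c a x) *: curl_bary c a b.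
Proof.
have C := C1_bary.
have C3 : C1 (fun z => 3 * bary a b c z - 1).
  by apply: C1_add; [apply: C1_mul; [exact: C1_cst|exact: C]|exact: C1_cst].
have E : curl (fun z => 3 * bary a b c z - 1) x = 3 *: curl_bary a b c.
  have C3' : C1 (fun z => 3 * bary a b c z) := C1_mul (C1_cst 3) (C a b c).
  rewrite -(curl_baryE a b c x) /curl /dx /dy !(derive_addf _ _ C3' (C1_cst (-1))).
  rewrite !(derive_mulf _ _ (C1_cst 3) (C a b c)) !derive_cst.
  by apply: injective_projections => /=; rewrite /GRing.scale /= /GRing.scale /=; ring.
rewrite /w_edge; have := curl_mul x (C1_mul (C b c a) (C c a b)) C3.
rewrite /= => ->; rewrite E.
rewrite (curl_mul _ (C b c a) (C c a b)) !curl_baryE.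
by apply: injective_projections => /=; rewrite /GRing.scale /= /GRing.scale /=; ring.
Qed.

(** The two divisions by the length combine to the squared length, so no square root remains and all
    later trace identities are rational. *)
Lemma y_vertE a b c x : y_vert a b c x =
  (- 2 * Num.sg (cross2 (b - a) (c - a)) / dot2 (c - b) (c - b) * bary a b c x) *:
    ((c.2 - b.2, - (c.1 - b.1)) : R * R).
Proof.
have LE : dist2 b c * dist2 b c = dot2 (c - b) (c - b).
  by rewrite -expr2 sqr_sqrtr// addr_ge0// -expr2 sqr_ge0.
rewrite /y_vert /outward_normal scalerA -LE invfM; congr (_ *: _); ring.
Qed.

(* The third component is the tangential integral: Simpson's rule is exact, since
   the tangential component of a P1+ field is quadratic on any line. *)
Definition trace q p r : R * R * R :=
  (cross2 (r - p) (q p), cross2 (r - p) (q r),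
   (dot2 (r - p) (q p) + 4 * dot2 (r - p) (q (p + (1 / 2) *: (r - p)))
    + dot2 (r - p) (q r)) / 6).

Lemma pairP (u v : R * R * R) : u.1.1 = v.1.1 -> u.1.2 = v.1.2 -> u.2 = v.2 -> u = v.
Proof. by move: u v => [[u1 u2] u3] [[v1 v2] v3] /= -> -> ->. Qed.

Lemma trace_rev q p r : trace q r p =
  (- (trace q p r).1.2, - (trace q p r).1.1, - (trace q p r).2).
Proof.
rewrite /trace /=.
have -> : r + (1 / 2) *: (p - r) = p + (1 / 2) *: (r - p).
  by apply: injective_projections => /=; rewrite /GRing.scale /= /GRing.scale /=; field.
by apply: pairP => /=; rewrite /cross2 /dot2 /=; ring.
Qed.

Lemma trace_rev_eq q q' p r : trace q p r = trace q' p r -> trace q r p = trace q' r p.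
Proof. by move=> e; rewrite trace_rev e -trace_rev. Qed.

Lemma trace0 p r : trace (fun=> 0) p r = 0.
Proof. by apply: pairP => /=; rewrite /cross2 /dot2 /=; ring. Qed.

Lemma traceD q q' p r : trace (fun x => q x + q' x) p r = trace q p r + trace q' p r.
Proof. by apply: pairP => /=; rewrite /cross2 /dot2 /=; ring. Qed.

Lemma traceZ (k : R) q p r : trace (fun x => k *: q x) p r = k *: trace q p r.
Proof.
rewrite /trace; set m := p + _.
by apply: pairP => /=; rewrite /cross2 /dot2 /GRing.scale /= /GRing.scale /=; ring.
Qed.

Lemma traceN q p r : trace (fun x => - q x) p r = (-1) *: trace q p r.
Proof.
by rewrite -traceZ; congr trace; apply/funext => x; rewrite scaleN1r.
Qed.

Lemma bary_ends a b c : cross2 (b - a) (c - a) != 0 ->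
  [/\ bary a b c a = 1, bary a b c b = 0 & bary a b c c = 0].
Proof.
move=> D0; rewrite /bary divff// /cross2; split => //;
  apply/eqP; rewrite mulf_eq0; apply/orP; left; apply/eqP => /=; ring.
Qed.

Lemma bary_mid a b c (p r : R * R) :
  bary a b c (p + (1 / 2) *: (r - p)) = (bary a b c p + bary a b c r) / 2.
Proof.
rewrite /bary; set Di := (cross2 (b - a) (c - a))^-1; rewrite /cross2 /= /GRing.scale /= /GRing.scale /=; by field.
Qed.

(** The stream function vanishes on [a b] and [c a], hence so do the normal components there. On
    [a b] the tangential component is a multiple of (3 lambda_a - 1) lambda_b, whose integral over
    the edge is 0: this is the reason for the constants 3 and 1. The side [c a] is analogous. *)
Lemma trace_w_edge a b c : cross2 (b - a) (c - a) != 0 ->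
  [/\ trace (w_edge a b c) b c =
        (1, -1, dot2 (c - b) (c - b) / cross2 (b - a) (c - a)),
      trace (w_edge a b c) a b = 0 & trace (w_edge a b c) c a = 0].
Proof.
move=> D0.
have [a1 a2 a3] := bary_ends D0.
have D1 : cross2 (c - b) (a - b) != 0 by rewrite -cross2_rot.
have D2 : cross2 (a - c) (b - c) != 0 by rewrite cross2_rot.
have [b1 b2 b3] := bary_ends D1.
have [c1 c2 c3] := bary_ends D2.
have E1 := cross2_rot a b c; have E2 := cross2_rot c a b.
split; apply: pairP; rewrite /trace /= !w_edgeE ?bary_mid ?a1 ?a2 ?a3 ?b1 ?b2 ?b3 ?c1 ?c2 ?c3
  /curl_bary -?E1 ?E2; move: D0; coords => D0; by field.
Qed.

End local_fields.

Section fields_on_segments.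
Variable R : realType.
Implicit Types (a b c p r x : R * R) (q : R * R -> R * R).

Lemma trace_w_vert a b c : cross2 (b - a) (c - a) != 0 ->
  [/\ trace (w_vert a b c) a b =
        (2, 0, dot2 (b - a) (c - b) / cross2 (b - a) (c - a)),
      trace (w_vert a b c) c a =
        (0, - 2, dot2 (a - c) (c - b) / cross2 (b - a) (c - a)) &
      trace (w_vert a b c) b c = 0].
Proof.
move=> D0; have [a1 a2 a3] := bary_ends D0.
split; apply: pairP; rewrite /trace /= !w_vertE ?bary_mid ?a1 ?a2 ?a3 /curl_bary;
  move: D0; coords => D0; by field.
Qed.

Lemma trace_y_vert a b c : cross2 (b - a) (c - a) != 0 ->
  dot2 (c - b) (c - b) != 0 ->
  let s := Num.sg (cross2 (b - a) (c - a)) in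
  let L := dot2 (c - b) (c - b) in
  let D := cross2 (b - a) (c - a) in
  [/\ trace (y_vert a b c) a b = (2 * s * dot2 (b - a) (c - b) / L, 0, - s * D / L),
      trace (y_vert a b c) c a = (0, 2 * s * dot2 (a - c) (c - b) / L, s * D / L) &
      trace (y_vert a b c) b c = 0].
Proof.
move=> D0 L0 s L D; have [a1 a2 a3] := bary_ends D0.
split; apply: pairP; rewrite /trace /= !y_vertE ?bary_mid ?a1 ?a2 ?a3 -/s /L /D;
  move: L0; coords => L0; by field.
Qed.

Lemma affine2D (f g : R * R -> R) : affine2 f -> affine2 g ->
  affine2 (fun x => f x + g x).
Proof.
move=> [k [k1 [k2 fE]]] [l [l1 [l2 gE]]]; exists (k + l), (k1 + l1), (k2 + l2) => x.
by rewrite fE gE; ring.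
Qed.

Lemma affine2Z (m : R) (f : R * R -> R) : affine2 f -> affine2 (fun x => m * f x).
Proof.
move=> [k [k1 [k2 fE]]]; exists (m * k), (m * k1), (m * k2) => x.
by rewrite fE; ring.
Qed.

Lemma P1plusE a b c q : P1plus a b c q <->
  exists f g : R * R -> R, exists k : R,
    [/\ affine2 f, affine2 g & forall x, q x = (f x, g x) + k *: curl (bubble a b c) x].
Proof. by []. Qed.

Lemma P1plusD a b c q q' : P1plus a b c q -> P1plus a b c q' ->
  P1plus a b c (fun x => q x + q' x).
Proof.
move=> [f [g [k [Af Ag qE]]]] [f' [g' [k' [Af' Ag' qE']]]].
exists (fun x => f x + f' x), (fun x => g x + g' x), (k + k').
split; [exact: affine2D|exact: affine2D|] => x.
by rewrite qE qE' scalerDl addrACA.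
Qed.

Lemma P1plusZ (m : R) a b c q : P1plus a b c q -> P1plus a b c (fun x => m *: q x).
Proof.
move=> [f [g [k [Af Ag qE]]]].
exists (fun x => m * f x), (fun x => m * g x), (m * k).
split; [exact: affine2Z|exact: affine2Z|] => x.
by rewrite qE scalerDr scalerA.
Qed.

Lemma P1plus0 a b c : P1plus a b c (fun=> 0).
Proof.
exists (fun=> 0), (fun=> 0), 0; split.
- by exists 0, 0, 0 => x; rewrite !mul0r !addr0.
- by exists 0, 0, 0 => x; rewrite !mul0r !addr0.
- by move=> x; rewrite scale0r addr0.
Qed.

Lemma P1plus_rot a b c : P1plus b c a = P1plus a b c.
Proof.
have E : bubble b c a = bubble a b c by apply/funext => x; rewrite /bubble; ring.
by apply/seteqP; split => q /P1plusE; [rewrite E|rewrite -E].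
Qed.

Lemma P1plus_swap a b c : P1plus a c b = P1plus a b c.
Proof.
have E : bubble a c b = bubble a b c.
  apply/funext => x; rewrite /bubble bary_swap (bary_swap b a c) (bary_swap c a b).
  by rewrite mulrAC.
by apply/seteqP; split => q /P1plusE; [rewrite E|rewrite -E].
Qed.

Lemma affine2_bary_cst (m1 m2 : R) a b c : affine2 (fun x => bary a b c x * m1 + m2).
Proof.
have [k [k1 [k2 E]]] := bary_affine a b c.
by exists (k * m1 + m2), (k1 * m1), (k2 * m1) => x; rewrite E; ring.
Qed.

Lemma P1plus_w_vert a b c : P1plus a b c (w_vert a b c).
Proof.
exists (fun x => bary a b c x * (2 * (curl_bary a b c).1) + 0),
  (fun x => bary a b c x * (2 * (curl_bary a b c).2) + 0), 0.
split; [exact: affine2_bary_cst|exact: affine2_bary_cst|] => x.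
rewrite w_vertE scale0r addr0; apply: injective_projections => /=; rewrite addr0 /GRing.scale /=; ring.
Qed.

Lemma P1plus_y_vert a b c : P1plus a b c (y_vert a b c).
Proof.
set k := - 2 * Num.sg (cross2 (b - a) (c - a)) / dot2 (c - b) (c - b).
exists (fun x => bary a b c x * (k * (c.2 - b.2)) + 0),
  (fun x => bary a b c x * (k * - (c.1 - b.1)) + 0), 0.
split; [exact: affine2_bary_cst|exact: affine2_bary_cst|] => x.
rewrite y_vertE -/k scale0r addr0; apply: injective_projections => /=; rewrite addr0 /GRing.scale /=; ring.
Qed.

Lemma P1plus_w_edge a b c : P1plus a b c (w_edge a b c).
Proof.
exists (fun x => (bary c a b x * (- (curl_bary b c a).1) + 0) +
                 (bary b c a x * (- (curl_bary c a b).1) + 0)),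
  (fun x => (bary c a b x * (- (curl_bary b c a).2) + 0) +
                 (bary b c a x * (- (curl_bary c a b).2) + 0)), 3.
split; [by apply: affine2D; exact: affine2_bary_cst..|] => x.
rewrite w_edgeE -/(bubble a b c) curl_bubble.
by apply: injective_projections => /=; rewrite !addr0 /GRing.scale /= /GRing.scale /=; ring.
Qed.

Lemma affine2_line (f : R * R -> R) p r (s : R) : affine2 f ->
  f (p + s *: (r - p)) = f p + s * (f r - f p).
Proof. by move=> [k [k1 [k2 fE]]]; rewrite !fE /= /GRing.scale /=; ring. Qed.

Lemma P1plus_line a b c q p r : P1plus a b c q -> exists A B C : R,
  forall s : R, dot2 (r - p) (q (p + s *: (r - p))) = A + B * s + C * s ^+ 2.
Proof.
move=> [f [g [k [Af Ag qE]]]].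
have bl u v w s : bary u v w (p + s *: (r - p)) = bary u v w p + s * (bary u v w r - bary u v w p).
  exact/affine2_line/bary_affine.
pose A0 := curl_bary a b c; pose B0 := curl_bary b c a; pose C0 := curl_bary c a b.
pose a0 := bary a b c p; pose b0 := bary b c a p; pose c0 := bary c a b p.
pose a1 := bary a b c r - a0; pose b1 := bary b c a r - b0; pose c1 := bary c a b r - c0.
pose t := r - p.
exists (dot2 t (f p, g p) + k * (b0 * c0 * dot2 t A0 + c0 * a0 * dot2 t B0 + a0 * b0 * dot2 t C0)),
  (dot2 t (f r - f p, g r - g p) + k * ((b0 * c1 + b1 * c0) * dot2 t A0
     + (c0 * a1 + c1 * a0) * dot2 t B0 + (a0 * b1 + a1 * b0) * dot2 t C0)),
  (k * (b1 * c1 * dot2 t A0 + c1 * a1 * dot2 t B0 + a1 * b1 * dot2 t C0)) => s.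
rewrite qE curl_bubble !bl -/A0 -/B0 -/C0 -/a0 -/b0 -/c0 -/a1 -/b1 -/c1 !affine2_line// -/t.
move: A0 B0 C0 a0 b0 c0 a1 b1 c1 t => A0 B0 C0 a0 b0 c0 a1 b1 c1 t.
by coords; ring.
Qed.

Lemma dist2_sqr a b : dist2 a b ^+ 2 = dot2 (b - a) (b - a).
Proof. by rewrite sqr_sqrtr// addr_ge0// -expr2 sqr_ge0. Qed.

Lemma Rintegral_quadratic (A B C : R) :
  (\int[@lebesgue_measure R]_(s in `[0, 1]%classic) (A + B * s + C * s ^+ 2))%R =
  A + B / 2 + C / 3.
Proof.
pose F (s : R) := A * s + B / 2 * s ^+ 2 + C / 3 * s ^+ 3.
have dF (s : R) : is_derive s 1 F (A + B * s + C * s ^+ 2).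
  by apply: is_derive_eq; coords; field.
have cF : continuous F by move=> s; apply: differentiable_continuous; apply/derivable1_diffP.
have cf : continuous (fun s : R => A + B * s + C * s ^+ 2).
  move=> s; apply: cvgD; [apply: cvgD; first exact: cvg_cst|]; apply: cvgM; try exact: cvg_cst.
    exact: cvg_id.
  exact: exprn_continuous.
rewrite /Rintegral (@continuous_FTC2 _ _ F)//=.
- by rewrite /F; field.
- exact: continuous_subspaceT.
- split; first by move=> s _; exact: (@ex_derive _ _ _ _ _ _ _ (dF s)).
  + by apply: cvg_at_right_filter; exact: cF.
  + by apply: cvg_at_left_filter; exact: cF.
- by move=> s _; rewrite derive1E derive_val.
Qed.

Lemma tangential_integralE a b c q p r : P1plus a b c q -> dist2 p r != 0 ->
  tangential_integral q p r = (trace q p r).2.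
Proof.
move=> /(P1plus_line p r)[A [B [C E]]] d0; rewrite /tangential_integral.
have -> : (fun s => dot2 (q (p + s *: (r - p))) ((dist2 p r)^-1 *: (r - p))) =
    (fun s => (dist2 p r)^-1 * A + (dist2 p r)^-1 * B * s + (dist2 p r)^-1 * C * s ^+ 2).
  apply/funext => s; transitivity ((dist2 p r)^-1 * (A + B * s + C * s ^+ 2)); last by ring.
  by rewrite -E; set m := p + _; coords; ring.
rewrite Rintegral_quadratic /trace /=.
have e0 := E 0; have e1 := E 1; have e2 := E (1 / 2).
rewrite scale0r addr0 in e0; rewrite scale1r [p + _]addrC subrK in e1.
by rewrite e0 e1 e2; field.
Qed.

End fields_on_segments.

(** * Degrees of freedom of P1+ and the moment of a field without flux *)

Section unisolvence.
Variable R : realType.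
Implicit Types (a b c p r x : R * R) (q : R * R -> R * R).

(** On [b c] the coordinate of [a] vanishes, so of the curl of the bubble only a multiple of
    [curl_bary a b c] is left, which is tangential. The normal component is that of the affine
    part. *)
Lemma P1plus_normal a b c q (s : R) : P1plus a b c q ->
  cross2 (c - b) (q (b + s *: (c - b))) =
  (1 - s) * (trace q b c).1.1 + s * (trace q b c).1.2.
Proof.
move=> [f [g [k [Af Ag qE]]]].
have bl t : bary a b c (b + t *: (c - b)) = 0.
  by rewrite /bary [X in X / _](_ : _ = 0) ?mul0r//; coords; ring.
have C0 (l : R) : cross2 (c - b) (l *: curl_bary a b c) = 0.
  by rewrite /curl_bary; set Di := (cross2 (b - a) (c - a))^-1; coords; ring.
have nE t : cross2 (c - b) (q (b + t *: (c - b))) =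
    cross2 (c - b) (f (b + t *: (c - b)), g (b + t *: (c - b))).
  rewrite qE curl_bubble bl !(mulr0, mul0r, scale0r, addr0) scalerA.
  set m := b + _; move: (C0 (k * (bary b c a m * bary c a b m))).
  set u := _ *: curl_bary _ _ _; move: u => u; rewrite /cross2 /= => h.
  by rewrite -[RHS]addr0 -h; ring.
have n0 := nE 0; have n1 := nE 1.
rewrite scale0r addr0 in n0; rewrite scale1r [b + _]addrC subrK in n1.
rewrite /trace /= nE n0 n1 !affine2_line//.
by rewrite /cross2 /=; ring.
Qed.

(** The curl of the bubble vanishes at the vertices, so [A], [B], [C] are the vertex values of [q].
    The term with [6 * D] comes from the integral 1/6 of the product of two barycentric coordinates
    along a side. *)
Lemma P1plus_nodal a b c q : cross2 (b - a) (c - a) != 0 -> P1plus a b c q ->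
  exists A B C : R * R, exists k : R,
    let D := cross2 (b - a) (c - a) in
    [/\ forall x, q x = (bary a b c x *: A + bary b c a x *: B + bary c a b x *: C) +
                        k *: curl (bubble a b c) x,
      trace q a b = (cross2 (b - a) A, cross2 (b - a) B,
        dot2 (b - a) (A + B) / 2 + k * dot2 (b - a) (b - a) / (6 * D)),
      trace q b c = (cross2 (c - b) B, cross2 (c - b) C,
        dot2 (c - b) (B + C) / 2 + k * dot2 (c - b) (c - b) / (6 * D)) &
      trace q c a = (cross2 (a - c) C, cross2 (a - c) A,
        dot2 (a - c) (C + A) / 2 + k * dot2 (a - c) (a - c) / (6 * D))].
Proof.
move=> D0 [f [g [k [Af Ag qE]]]].
have affE (h : R * R -> R) x : affine2 h ->
    h x = bary a b c x * h a + bary b c a x * h b + bary c a b x * h c.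
  move=> [l [l1 [l2 hE]]]; rewrite !hE.
  have s1 := bary_sum x D0; have := bary_pos x D0.
  move: (bary a b c x) (bary b c a x) (bary c a b x) s1 => u v w s1 xE.
  rewrite -[l in LHS]mulr1 -s1 -[in LHS]xE /= /GRing.scale /=; ring.
pose A := (f a, g a); pose B := (f b, g b); pose C := (f c, g c).
have qE' x : q x = (bary a b c x *: A + bary b c a x *: B + bary c a b x *: C) +
                        k *: curl (bubble a b c) x.
  rewrite qE (affE f x Af) (affE g x Ag); congr (_ + _).
have [a1 a2 a3] := bary_ends D0.
have D1 : cross2 (c - b) (a - b) != 0 by rewrite -cross2_rot.
have D2 : cross2 (a - c) (b - c) != 0 by rewrite cross2_rot.
have [b1 b2 b3] := bary_ends D1; have [c1 c2 c3] := bary_ends D2.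
have E1 := cross2_rot a b c; have E2 := cross2_rot c a b.
exists A, B, C, k => D; split=> //; apply: pairP; rewrite /trace /= !qE' !curl_bubble
   ?bary_mid ?a1 ?a2 ?a3 ?b1 ?b2 ?b3 ?c1 ?c2 ?c3 /curl_bary -?E1 ?E2 -/D;
   move: (A) (B) (C) D0 => A' B' C'; rewrite -/D /D; coords => D0; by field.
Qed.

Lemma cross2_basis (u v w : R * R) : cross2 u v != 0 ->
  cross2 u w = 0 -> cross2 v w = 0 -> w = 0.
Proof.
move=> D0 hu hv; have [h1 h2] : cross2 u v * w.1 = 0 /\ cross2 u v * w.2 = 0.
  by split; [have -> : cross2 u v * w.1 = v.1 * cross2 u w - u.1 * cross2 v w
      by rewrite /cross2; ring|
    have -> : cross2 u v * w.2 = v.2 * cross2 u w - u.2 * cross2 v w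
      by rewrite /cross2; ring]; rewrite hu hv !mulr0 subrr.
by apply: injective_projections; apply/eqP; move/eqP: h1; move/eqP: h2;
  rewrite !mulf_eq0 (negbTE D0).
Qed.

(** At each vertex the normal components of two independent sides vanish, so the vertex values are
    0. A tangential integral then sees only the bubble and gives [k = 0]. *)
Lemma P1plus_unisolvent a b c q : cross2 (b - a) (c - a) != 0 ->
  dot2 (c - b) (c - b) != 0 -> P1plus a b c q ->
  trace q a b = 0 -> trace q b c = 0 -> trace q c a = 0 -> forall x, q x = 0.
Proof.
move=> D0 L0 /(P1plus_nodal D0)[A [B [C [k [qE -> -> ->]]]]].
move=> [hA hB _] [hB' hC' t] [hC hA' _].
have D1 : cross2 (c - b) (a - b) != 0 by rewrite -cross2_rot.
have D2 : cross2 (a - c) (b - c) != 0 by rewrite cross2_rot.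
have neg u v w : cross2 (u - v) w = 0 -> cross2 (v - u) w = 0.
  by move=> h; rewrite -oppr0 -h /cross2 /=; ring.
have A0 : A = 0 by apply: (cross2_basis D0) => //; exact: neg.
have B0 : B = 0 by apply: (cross2_basis D1) => //; exact: neg.
have C0 : C = 0 by apply: (cross2_basis D2) => //; exact: neg.
have k0 : k = 0.
  move: t; rewrite B0 C0 (_ : dot2 _ (0 + 0) = 0); last by coords; ring.
  by move=> /eqP; rewrite mul0r add0r !mulf_eq0 invr_eq0 mulf_eq0 (negbTE L0) (negbTE D0)
    (_ : (6 : R) == 0 = false) ?orbF// => [/eqP//|]; rewrite pnatr_eq0.
by move=> x; rewrite qE A0 B0 C0 k0 !scaler0 !scale0r !addr0.
Qed.

(* For a field whose normal components have mean zero on the three edges,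
   this functional takes the same value on each of them. *)
Definition moment q a b c : R :=
  2 * (trace q b c).1.2 +
  2 * cross2 (b - a) (c - a) * (trace q b c).2 / dot2 (c - b) (c - b).

Lemma cross2_parallel (u w : R * R) : dot2 u u != 0 -> cross2 u w = 0 ->
  w = (dot2 u w / dot2 u u) *: u.
Proof.
move=> L0 h; apply: injective_projections; apply: (mulfI L0);
  rewrite /= /GRing.scale /= mulrA mulrCA divff// mulr1.
- by rewrite -[RHS]subr0 -(mulr0 u.2) -h /dot2 /cross2; ring.
- by rewrite -[RHS]addr0 -(mulr0 u.1) -h /dot2 /cross2; ring.
Qed.

(** Zero mean of the normal component on a side means that the sum of the two vertex values is
    parallel to that side. From 2 C = (B + C) + (C + A) - (A + B), the normal value at [c]
    contributes [D] times the coefficients of the other two sides; the tangential term supplies that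
    of [b c] together with [k / 3]. The total is symmetric under rotation. *)
Lemma moment_nodal a b c (A B C : R * R) (k : R) :
  cross2 (b - a) (c - a) != 0 -> dot2 (b - a) (b - a) != 0 ->
  dot2 (c - b) (c - b) != 0 -> dot2 (a - c) (a - c) != 0 ->
  cross2 (b - a) (A + B) = 0 -> cross2 (c - b) (B + C) = 0 -> cross2 (a - c) (C + A) = 0 ->
  let D := cross2 (b - a) (c - a) in
  let mu u v := dot2 u v / dot2 u u in
  2 * cross2 (c - b) C + 2 * D * (dot2 (c - b) (B + C) / 2
      + k * dot2 (c - b) (c - b) / (6 * D)) / dot2 (c - b) (c - b) =
  D * (mu (b - a) (A + B) + mu (c - b) (B + C) + mu (a - c) (C + A)) + k / 3.
Proof.
move=> D0 Lc La Lb /(cross2_parallel Lc) + /(cross2_parallel La) + /(cross2_parallel Lb).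
move=> + + + D mu; rewrite -/(mu _ _) -/(mu _ _) -/(mu _ _).
set mc := mu (b - a) _; set ma := mu (c - b) _; set mb := mu (a - c) _ => hc ha hb.
have -> : 2 * D * (dot2 (c - b) (B + C) / 2 + k * dot2 (c - b) (c - b) / (6 * D))
    / dot2 (c - b) (c - b) = D * ma + k / 3.
  by rewrite /ma /mu; field; rewrite La.
have C1 : 2 * C.1 = ma * (c.1 - b.1) + mb * (a.1 - c.1) - mc * (b.1 - a.1).
  move: (congr1 fst hc) (congr1 fst ha) (congr1 fst hb); rewrite /= /GRing.scale /=.
  by lra.
have C2 : 2 * C.2 = ma * (c.2 - b.2) + mb * (a.2 - c.2) - mc * (b.2 - a.2).
  move: (congr1 snd hc) (congr1 snd ha) (congr1 snd hb); rewrite /= /GRing.scale /=.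
  by lra.
have -> : 2 * cross2 (c - b) C = (c.1 - b.1) * (2 * C.2) - (c.2 - b.2) * (2 * C.1).
  by rewrite /cross2 /=; ring.
by rewrite C1 C2 /D /cross2 /=; ring.
Qed.

(** The normal component is affine on an edge, so its mean vanishes exactly when the end values
    cancel. *)
Definition zero_flux (t : R * R * R) := t.1.1 + t.1.2 = 0.

Lemma moment_rot a b c q : cross2 (b - a) (c - a) != 0 ->
  dot2 (b - a) (b - a) != 0 -> dot2 (c - b) (c - b) != 0 -> dot2 (a - c) (a - c) != 0 ->
  P1plus a b c q ->
  zero_flux (trace q a b) -> zero_flux (trace q b c) -> zero_flux (trace q c a) ->
  moment q b c a = moment q a b c.
Proof.
move=> D0 Lc La Lb /(P1plus_nodal D0)[A [B [C [k [_ tc ta tb]]]]].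
have cD (u v w : R * R) : cross2 u (v + w) = cross2 u v + cross2 u w.
  by rewrite /cross2 /=; ring.
rewrite /zero_flux tc ta tb /= -!cD => hc ha hb.
rewrite /moment ta tb /= -(cross2_rot a b c) (moment_nodal k D0 Lc La Lb hc ha hb).
have := @moment_nodal b c a B C A k; rewrite -(cross2_rot a b c).
by move=> /(_ D0 La Lb Lc ha hb hc) -> /=; congr (_ * _ + _); rewrite -addr_rot.
Qed.

(** Reversing the side changes the sign of the determinant and of the tangential integral, and
    replaces the final normal value by minus the initial one, which is the same number when the flux
    is 0. *)
Lemma moment_swap a b c q : zero_flux (trace q b c) ->
  moment q a c b = moment q a b c.
Proof.
rewrite /zero_flux /moment [trace q c b]trace_rev.
move: (trace q b c) => t /(canRL (addrK _)) e /=; rewrite e sub0r opprK.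
have -> : cross2 (c - a) (b - a) = - cross2 (b - a) (c - a) by exact: cross2C.
have -> : dot2 (b - c) (b - c) = dot2 (c - b) (c - b) by rewrite /dot2 /=; ring.
by congr (_ + _ / _); ring.
Qed.

End unisolvence.

(** * Trigonometric coefficients as rational functions of the vertices *)

Section angles.
Variable R : realType.
Implicit Types (a b c p r x : R * R).

Lemma lagrange (u v : R * R) :
  dot2 u u * dot2 v v = dot2 u v ^+ 2 + cross2 u v ^+ 2.
Proof. by rewrite /dot2 /cross2; ring. Qed.

Lemma dist2C a b : dist2 a b = dist2 b a.
Proof. by rewrite /dist2; congr Num.sqrt; rewrite /dot2 /=; ring. Qed.

(** Lagrange's identity. It shows that the argument of [acos] lies in [-1, 1] and identifies the
    sine of the angle. *)
Lemma angle_bound a b c : dist2 a b != 0 -> dist2 a c != 0 ->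
  1 - (dot2 (b - a) (c - a) / (dist2 a b * dist2 a c)) ^+ 2 =
  (cross2 (b - a) (c - a) / (dist2 a b * dist2 a c)) ^+ 2.
Proof.
move=> d1 d2; rewrite !expr_div_n exprMn !dist2_sqr lagrange.
have : dot2 (b - a) (b - a) * dot2 (c - a) (c - a) != 0.
  by rewrite -!dist2_sqr mulf_neq0// sqrf_eq0.
by rewrite lagrange => L0; field.
Qed.

Lemma angle_itv a b c : dist2 a b != 0 -> dist2 a c != 0 ->
  -1 <= dot2 (b - a) (c - a) / (dist2 a b * dist2 a c) <= 1.
Proof.
move=> d1 d2; rewrite -ler_norml -(@ler_pXn2r _ 2)// ?nnegrE// expr1n real_normK ?num_real//.
by rewrite -subr_ge0 angle_bound// sqr_ge0.
Qed.

Lemma cos_angle a b c : dist2 a b != 0 -> dist2 a c != 0 ->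
  cos (angle a b c) = dot2 (b - a) (c - a) / (dist2 a b * dist2 a c).
Proof. by move=> d1 d2; rewrite /angle acosK// in_itv /= angle_itv. Qed.

Lemma sin_angle a b c : dist2 a b != 0 -> dist2 a c != 0 ->
  sin (angle a b c) = `|cross2 (b - a) (c - a)| / (dist2 a b * dist2 a c).
Proof.
move=> d1 d2; rewrite /angle sin_acos ?angle_itv// angle_bound// sqrtr_sqr.
by rewrite normrM normfV [`|_ * _ : R|]ger0_norm// mulr_ge0// sqrtr_ge0.
Qed.

(** The coefficients with a cosine are those of an orthogonal projection onto a side, hence
    rational. *)
Lemma cos_angle_proj a b c : dist2 b a != 0 -> dist2 b c != 0 ->
  dist2 a b * cos (angle b a c) / dist2 b c = dot2 (a - b) (c - b) / dot2 (c - b) (c - b).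
Proof.
move=> d1 d2; rewrite cos_angle// -dist2_sqr (dist2C a b); field.
by rewrite d1 d2.
Qed.

(** Turning counterclockwise from [r] to [p] and on to [q], the two angles are adjacent. Their sum
    may exceed pi; the sine then becomes negative, as does the determinant. *)
Lemma sin_angle_sum (o p q r : R * R) : dist2 o q != 0 -> dist2 o r != 0 ->
  0 < cross2 (r - o) (p - o) -> 0 < cross2 (p - o) (q - o) ->
  dist2 o q * dist2 o r * sin (angle o p r + angle o p q) = cross2 (r - o) (q - o).
Proof.
move=> dq dr h1 h2.
have L0 : dot2 (p - o) (p - o) != 0.
  apply: contraTneq h1 => /eqP; rewrite /dot2 -!expr2 paddr_eq0 ?sqr_ge0// !sqrf_eq0.
  by move=> /andP[/eqP e1 /eqP e2]; rewrite /cross2 e1 e2 !mulr0 subrr ltxx.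
have dp : dist2 o p != 0 by rewrite -sqrf_eq0 dist2_sqr.
rewrite sinD !cos_angle// !sin_angle//.
have -> : `|cross2 (p - o) (r - o)| = cross2 (r - o) (p - o).
  by rewrite cross2C normrN gtr0_norm.
rewrite (gtr0_norm h2).
have -> : dist2 o q * dist2 o r * (cross2 (r - o) (p - o) / (dist2 o p * dist2 o r) *
   (dot2 (p - o) (q - o) / (dist2 o p * dist2 o q)) +
   dot2 (p - o) (r - o) / (dist2 o p * dist2 o r) *
   (cross2 (p - o) (q - o) / (dist2 o p * dist2 o q))) =
  (cross2 (r - o) (p - o) * dot2 (p - o) (q - o) +
   dot2 (p - o) (r - o) * cross2 (p - o) (q - o)) / dist2 o p ^+ 2.
  by field; rewrite dp dq dr.
rewrite dist2_sqr; apply: (canLR (mulfK L0)); rewrite /cross2 /dot2 /=; ring.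
Qed.

End angles.

(** * Traces of the edge functions ending on the boundary *)

Section psi_traces.
Variable R : realType.
Implicit Types (a b c p r x : R * R) (D : R).

(** Traces in both directions of each side, with the determinant kept abstract so that any rotated
    or reflected expression for it can be used. *)
Lemma w_edge_table a b c D : cross2 (b - a) (c - a) = D -> D != 0 ->
  [/\ trace (w_edge a b c) b c = (1, -1, dot2 (c - b) (c - b) / D) /\
      trace (w_edge a b c) c b = (1, -1, - (dot2 (c - b) (c - b) / D)),
      trace (w_edge a b c) a b = 0 /\ trace (w_edge a b c) b a = 0 &
      trace (w_edge a b c) c a = 0 /\ trace (w_edge a b c) a c = 0].
Proof.
move=> <- D0; have [e1 e2 e3] := trace_w_edge D0.
by split; split => //; rewrite trace_rev ?e1 ?e2 ?e3 /= ?opprK ?oppr0.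
Qed.

Lemma w_vert_table a b c D : cross2 (b - a) (c - a) = D -> D != 0 ->
  let t := dot2 (b - a) (c - b) / D in
  let t' := dot2 (a - c) (c - b) / D in
  [/\ trace (w_vert a b c) a b = (2, 0, t) /\ trace (w_vert a b c) b a = (0, -2, - t),
      trace (w_vert a b c) c a = (0, -2, t') /\ trace (w_vert a b c) a c = (2, 0, - t') &
      trace (w_vert a b c) b c = 0 /\ trace (w_vert a b c) c b = 0].
Proof.
move=> <- D0; have [e1 e2 e3] := trace_w_vert D0.
by split; split => //; rewrite trace_rev ?e1 ?e2 ?e3 /= ?opprK ?oppr0.
Qed.

Lemma y_vert_table a b c D : cross2 (b - a) (c - a) = D -> D != 0 ->
  dot2 (c - b) (c - b) != 0 ->
  let L := dot2 (c - b) (c - b) in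
  let n := 2 * Num.sg D * dot2 (b - a) (c - b) / L in
  let n' := 2 * Num.sg D * dot2 (a - c) (c - b) / L in
  let t := Num.sg D * D / L in
  [/\ trace (y_vert a b c) a b = (n, 0, - t) /\ trace (y_vert a b c) b a = (0, - n, t),
      trace (y_vert a b c) c a = (0, n', t) /\ trace (y_vert a b c) a c = (- n', 0, - t) &
      trace (y_vert a b c) b c = 0 /\ trace (y_vert a b c) c b = 0].
Proof.
move=> <- D0 L0; have [e1 e2 e3] := trace_y_vert D0 L0; rewrite !mulNr in e1.
by split; split => //; rewrite trace_rev ?e1 ?e2 ?e3 /= ?opprK ?oppr0.
Qed.

Lemma trace_comb4 (q0 q1 q2 q3 : R * R -> R * R) (k1 k2 k3 : R) p r :
  trace (fun z => q0 z + k1 *: q1 z + k2 *: q2 z + k3 *: q3 z) p r =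
  trace q0 p r + k1 *: trace q1 p r + k2 *: trace q2 p r + k3 *: trace q3 p r.
Proof. by rewrite !traceD !traceZ. Qed.

Lemma norm_pos a b c : 0 < cross2 (b - a) (c - a) ->
  area a b c = cross2 (b - a) (c - a) / 2.
Proof. by move=> h; rewrite /area gtr0_norm. Qed.

Lemma norm_neg a b c : cross2 (b - a) (c - a) < 0 ->
  area a b c = - cross2 (b - a) (c - a) / 2.
Proof. by move=> h; rewrite /area ltr0_norm. Qed.

Lemma dot2_neq0_cross (u v : R * R) : cross2 u v != 0 -> dot2 u u != 0.
Proof.
apply: contra_neq => /eqP; rewrite /dot2 -!expr2 paddr_eq0 ?sqr_ge0// !sqrf_eq0.
by move=> /andP[/eqP e1 /eqP e2]; rewrite /cross2 e1 e2 !mul0r subrr.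
Qed.

Lemma dist2_neq0 a b c : cross2 (b - a) (c - a) != 0 -> dist2 a b != 0.
Proof.
by move=> h; have := dot2_neq0_cross h; rewrite -dist2_sqr sqrf_eq0.
Qed.

Section boundary_edge_function.
Variables a1 a2 a3 a4 b3 b4 : R * R.
Let D1 := cross2 (a2 - a1) (a3 - a1).
Let D2 := cross2 (a3 - a1) (a4 - a1).
Let D3 := cross2 (a2 - a1) (b3 - a1).
Let D4 := cross2 (a1 - a4) (b4 - a4).
Hypotheses (D1_gt0 : 0 < D1) (D2_gt0 : 0 < D2) (D3_lt0 : D3 < 0) (D4_lt0 : D4 < 0).
(** The projection coefficient [k1] makes the y and w_vert parts in T_1 cancel in the normal
    component on [a1 a2], leaving the values 2 and 0 on [a1 a3]; this is the flux of the function.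
    [k2] does the same in T_2. As [D3 < 0 < D1], the number [s3] is the ratio S_3 / (S_3 + S_1), and
    [s4] likewise. *)
Let k1 := dot2 (a1 - a2) (a3 - a2) / dot2 (a3 - a2) (a3 - a2).
Let k2 := dot2 (a1 - a4) (a3 - a4) / dot2 (a3 - a4) (a3 - a4).
Let s3 := D3 / (D3 - D1).
Let s4 := D4 / (D4 - D2).
Let c := (cross2 (a4 - a3) (a2 - a3) - (D1 + D2)) / (D1 + D2).

Let f1 z := y_vert a1 a2 a3 z + k1 *: w_vert a1 a2 a3 z + s3 *: w_edge a3 a1 a2 z
  + c *: w_edge a2 a1 a3 z.
Let f2 z := - y_vert a1 a3 a4 z + k2 *: w_vert a1 a3 a4 z + s4 *: w_edge a3 a4 a1 z
  + c *: w_edge a4 a1 a3 z.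
Let f3 z := s3 *: w_edge b3 a1 a2 z.
Let f4 z := s4 *: w_edge b4 a4 a1 z.

#[local] Opaque w_edge w_vert y_vert trace.
(** After the choice of [k1] and [k2] the normal components match for any [c], being [2 + c] and
    [- c] at the ends of [a1 a3]. The value of [c] makes the two tangential integrals on this edge
    equal; [s3] and [s4] achieve this on [a1 a2] and [a4 a1]. *)
Lemma boundary_edge_traces :
  [/\ [/\ trace f1 a1 a2 = trace f3 a1 a2, trace f1 a1 a3 = trace f2 a1 a3 &
          trace f2 a4 a1 = trace f4 a4 a1],
      trace f1 a2 a3 = 0 /\ trace f2 a3 a4 = 0,
      [/\ trace f3 a2 b3 = 0, trace f3 b3 a1 = 0, trace f4 a1 b4 = 0 & trace f4 b4 a4 = 0] &
      [/\ zero_flux (trace f3 a1 a2), zero_flux (trace f4 a4 a1) &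
          (trace f1 a1 a3).1.1 + (trace f1 a1 a3).1.2 = 2]].
Proof.
have [D10 D20 D30 D40] : [/\ D1 != 0, D2 != 0, D3 != 0 & D4 != 0].
  by split; [rewrite gt_eqF|rewrite gt_eqF|rewrite lt_eqF|rewrite lt_eqF].
have c312 : cross2 (a1 - a3) (a2 - a3) = D1 by rewrite /D1 cross2_rot cross2_rot.
have c213 : cross2 (a1 - a2) (a3 - a2) = - D1.
  by rewrite /D1 /cross2 /=; ring.
have c341 : cross2 (a4 - a3) (a1 - a3) = D2 by rewrite /D2 -cross2_rot.
have c413 : cross2 (a1 - a4) (a3 - a4) = D2 by rewrite /D2 cross2_rot.
have d312 : cross2 (a1 - b3) (a2 - b3) = D3 by rewrite /D3 cross2_rot.
have d441 : cross2 (a4 - b4) (a1 - b4) = D4 by rewrite /D4 cross2_rot.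
have L23 : dot2 (a3 - a2) (a3 - a2) != 0.
  by apply: (@dot2_neq0_cross _ (a1 - a2)); rewrite -cross2_rot.
have L34 : dot2 (a4 - a3) (a4 - a3) != 0.
  by apply: (@dot2_neq0_cross _ (a1 - a3)); rewrite c341.
have L13 : dot2 (a3 - a1) (a3 - a1) != 0 by apply: (@dot2_neq0_cross _ (a4 - a1)).
have D10' : - D1 != 0 by rewrite oppr_eq0.
have [[y12 _] [_ y13] [y23 _]] := y_vert_table (erefl D1) D10 L23.
have [[v12 _] [_ v13] [v23 _]] := w_vert_table (erefl D1) D10.
have [[e12 _] [_ e13] [e23 _]] := w_edge_table c312 D10.
have [[g13 _] [_ g12] [_ g23]] := w_edge_table c213 D10'.
have [[z13 _] [z41 _] [z34 _]] := y_vert_table (erefl D2) D20 L34.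
have [[u13 _] [u41 _] [u34 _]] := w_vert_table (erefl D2) D20.
have [[h41 _] [h34 _] [h13 h31]] := w_edge_table c341 D20.
have [[i13 _] [i41 _] [i34 _]] := w_edge_table c413 D20.
have [[j12 _] [j31 _] [j23 _]] := w_edge_table d312 D30.
have [[m41 _] [m44 _] [m14 _]] := w_edge_table d441 D40.
have F1 p r := trace_comb4 (y_vert a1 a2 a3) (w_vert a1 a2 a3) (w_edge a3 a1 a2)
  (w_edge a2 a1 a3) k1 s3 c p r.
have F2 p r := trace_comb4 (fun z => - y_vert a1 a3 a4 z) (w_vert a1 a3 a4)
  (w_edge a3 a4 a1) (w_edge a4 a1 a3) k2 s4 c p r.
have F3 p r : trace f3 p r = s3 *: trace (w_edge b3 a1 a2) p r := traceZ _ _ _ _.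
have F4 p r : trace f4 p r = s4 *: trace (w_edge b4 a4 a1) p r := traceZ _ _ _ _.
have := F1 a1 a2; rewrite y12 v12 e12 g12 -/f1 => ->.
have := F1 a1 a3; rewrite y13 v13 e13 g13 -/f1 => ->.
have := F1 a2 a3; rewrite y23 v23 e23 g23 -/f1 => ->.
have := F2 a1 a3; rewrite traceN z13 u13 h13 i13 -/f2 => ->.
have := F2 a4 a1; rewrite traceN z41 u41 h41 i41 -/f2 => ->.
have := F2 a3 a4; rewrite traceN z34 u34 h34 i34 -/f2 => ->.
rewrite !F3 !F4 j12 j31 j23 m41 m44 m14 !gtr0_sg//.
have s30 : D3 - D1 != 0 by rewrite lt_eqF// subr_lt0 (lt_trans D3_lt0).
have s40 : D4 - D2 != 0 by rewrite lt_eqF// subr_lt0 (lt_trans D4_lt0).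
have c0 : D1 + D2 != 0 by rewrite gt_eqF// addr_gt0.
(* All differences are written in terms of the three vectors from [a1]. The vertices [b3] and [b4]
   enter only through [D3] and [D4], so what remains are rational identities in eight unknowns. *)
have dq (x y : R * R) : x - y = (x - a1) - (y - a1) by rewrite opprB addrA subrK.
have d12 : a1 - a2 = - (a2 - a1) by rewrite opprB.
have d13 : a1 - a3 = - (a3 - a1) by rewrite opprB.
have d14 : a1 - a4 = - (a4 - a1) by rewrite opprB.
have d32 := dq a3 a2; have d23 := dq a2 a3; have d43 := dq a4 a3; have d34 := dq a3 a4.
have dl : dot2 (a3 - a4) (a3 - a4) = dot2 (a4 - a3) (a4 - a3) by rewrite /dot2 /=; ring.
split; [split|split|split|split]; try apply: pairP => /=;
  move: D10 D20 L23 L34 L13 s30 s40 c0 D30 D40;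
  rewrite /zero_flux /s3 /s4 /k1 /k2 /c ?dl /D1 /D2;
  rewrite ?d12 ?d13 ?d14 ?d32 ?d23 ?d43 ?d34;
  generalize D3 D4 (a2 - a1) (a3 - a1) (a4 - a1) => D3' D4' p u r;
  coords => h1 h2 h3 h4 h5 h6 h7 h8 h9 h10;
  clear - h1 h2 h3 h4 h5 h6 h7 h8 h9 h10 R a1 a2 a3 a4 b3 b4
    D1 D2 D3 D4 D1_gt0 D2_gt0 D3_lt0 D4_lt0 k1 k2 s3 s4 c f1 f2 f3 f4;
  rewrite /GRing.scale /= /GRing.scale /=;
  by field; rewrite ?h1 ?h2 ?h3 ?h4 ?h5 ?h6 ?h7 ?h8 ?h9 ?h10.
Qed.
#[local] Transparent w_edge w_vert y_vert trace.
End boundary_edge_function.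
End psi_traces.

(** * Traces of the edge functions between two interior vertices *)

Section psi_interior.
Variable R : realType.
Implicit Types (a b c p r x : R * R) (D : R).

Lemma trace_comb7 (q1 q2 q3 q4 q5 q6 q7 : R * R -> R * R) (k1 k2 k3 k4 k5 k6 k7 : R) p r :
  trace (fun z => k1 *: q1 z + k2 *: q2 z + k3 *: q3 z + k4 *: q4 z + k5 *: q5 z
    + k6 *: q6 z + k7 *: q7 z) p r =
  k1 *: trace q1 p r + k2 *: trace q2 p r + k3 *: trace q3 p r + k4 *: trace q4 p r
    + k5 *: trace q5 p r + k6 *: trace q6 p r + k7 *: trace q7 p r.
Proof. by rewrite !traceD !traceZ. Qed.

Variables a1 a2 a3 a4 b3 b4 b5 b6 : R * R.
Let D1 := cross2 (a2 - a1) (a3 - a1).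
Let D2 := cross2 (a3 - a1) (a4 - a1).
Let D3 := cross2 (a2 - a1) (b3 - a1).
Let D4 := cross2 (a1 - a4) (b4 - a4).
Let D5 := cross2 (a4 - a3) (b5 - a3).
Let D6 := cross2 (a3 - a2) (b6 - a2).
Hypotheses (D1_gt0 : 0 < D1) (D2_gt0 : 0 < D2) (D3_lt0 : D3 < 0) (D4_lt0 : D4 < 0).
Hypotheses (D5_lt0 : D5 < 0) (D6_lt0 : D6 < 0).
Let L := dot2 (a3 - a1) (a3 - a1).
Let k1 := dot2 (a1 - a3) (a2 - a3) / L.
Let k2 := dot2 (a4 - a1) (a3 - a1) / L.
Let s3 := D3 / (2 * (D3 - D1)).
Let s4 := D4 / (2 * (D4 - D2)).
Let s5 := D5 / (2 * (D5 - D2)).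
Let s6 := D6 / (2 * (D6 - D1)).
Let K := (cross2 (a4 - a3) (a2 - a3) - cross2 (a2 - a1) (a4 - a1)) / (2 * (D1 + D2)).

Let f1 z := (s3 - 1) *: w_edge a3 a1 a2 z + (1 - s6) *: w_edge a1 a2 a3 z
  + K *: w_edge a2 a1 a3 z + (k1 - 1 / 2) *: w_vert a2 a1 a3 z
  + (1 / 2) *: w_vert a1 a2 a3 z + (- (1 / 2)) *: w_vert a3 a1 a2 z + 1 *: y_vert a2 a1 a3 z.
Let f2 z := (s4 - 1) *: w_edge a3 a4 a1 z + (1 - s5) *: w_edge a1 a3 a4 z
  + K *: w_edge a4 a1 a3 z + (1 / 2 - k2) *: w_vert a4 a1 a3 z
  + (1 / 2) *: w_vert a1 a3 a4 z + (- (1 / 2)) *: w_vert a3 a1 a4 z + (-1) *: y_vert a4 a1 a3 z.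
Let f3 z := s3 *: w_edge b3 a1 a2 z.
Let f4 z := s4 *: w_edge b4 a4 a1 z.
Let f5 z := (- s5) *: w_edge b5 a3 a4 z.
Let f6 z := (- s6) *: w_edge b6 a2 a3 z.

#[local] Opaque w_edge w_vert y_vert trace.
(** The two halves of w_vert at [a1] and [a3] give the constant normal component 1 on [a1 a3], and
    [K] changes its end values to [1 + K] and [1 - K] so that the tangential integrals agree. The
    terms at [a2] and [a4] remove the flux from the outer edges, on which the s_j adjust the
    tangential integrals. *)
Lemma interior_edge_traces :
  [/\ [/\ trace f1 a1 a2 = trace f3 a1 a2, trace f1 a1 a3 = trace f2 a1 a3,
          trace f2 a4 a1 = trace f4 a4 a1, trace f2 a3 a4 = trace f5 a3 a4 &
          trace f1 a2 a3 = trace f6 a2 a3],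
      [/\ trace f3 a2 b3 = 0, trace f3 b3 a1 = 0, trace f4 a1 b4 = 0 & trace f4 b4 a4 = 0],
      [/\ trace f5 a4 b5 = 0, trace f5 b5 a3 = 0, trace f6 a3 b6 = 0 & trace f6 b6 a2 = 0],
      [/\ zero_flux (trace f3 a1 a2), zero_flux (trace f4 a4 a1),
          zero_flux (trace f5 a3 a4) & zero_flux (trace f6 a2 a3)] &
      (trace f1 a1 a3).1.1 + (trace f1 a1 a3).1.2 = 2].
Proof.
have [D10 D20] : D1 != 0 /\ D2 != 0 by rewrite !gt_eqF.
have [D30 D40 D50 D60] : [/\ D3 != 0, D4 != 0, D5 != 0 & D6 != 0].
  by split; rewrite lt_eqF.
have D10' : - D1 != 0 by rewrite oppr_eq0.
have D20' : - D2 != 0 by rewrite oppr_eq0.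
have c312 : cross2 (a1 - a3) (a2 - a3) = D1 by rewrite /D1 cross2_rot cross2_rot.
have c213 : cross2 (a1 - a2) (a3 - a2) = - D1 by rewrite /D1 /cross2 /=; ring.
have c341 : cross2 (a4 - a3) (a1 - a3) = D2 by rewrite /D2 -cross2_rot.
have c413 : cross2 (a1 - a4) (a3 - a4) = D2 by rewrite /D2 cross2_rot.
have c314 : cross2 (a1 - a3) (a4 - a3) = - D2 by rewrite /D2 /cross2 /=; ring.
have d312 : cross2 (a1 - b3) (a2 - b3) = D3 by rewrite /D3 cross2_rot.
have d441 : cross2 (a4 - b4) (a1 - b4) = D4 by rewrite /D4 cross2_rot.
have d534 : cross2 (a3 - b5) (a4 - b5) = D5 by rewrite /D5 cross2_rot.
have d623 : cross2 (a2 - b6) (a3 - b6) = D6 by rewrite /D6 cross2_rot.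
have L0 : dot2 (a3 - a1) (a3 - a1) != 0 by apply: (@dot2_neq0_cross _ _ (a4 - a1)).
have [[A12 _] [_ A13] [A23 _]] := w_edge_table c312 D10.
have [[B23 _] [B12 _] [_ B13]] := w_edge_table (erefl D1) D10.
have [[C13 _] [_ C12] [_ C23]] := w_edge_table c213 D10'.
have [[_ E12] [_ E23] [E13 _]] := w_vert_table c213 D10'.
have [[F12 _] [_ F13] [F23 _]] := w_vert_table (erefl D1) D10.
have [[_ G13] [G23 _] [G12 _]] := w_vert_table c312 D10.
have [[_ Y12] [_ Y23] [Y13 _]] := y_vert_table c213 D10' L0.
have [[A41 _] [A34 _] [A13' _]] := w_edge_table c341 D20.
have [[B34 _] [B13' _] [B41 _]] := w_edge_table (erefl D2) D20.
have [[C13' _] [C41 _] [C34 _]] := w_edge_table c413 D20.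
have [[E41 _] [E34 _] [E13' _]] := w_vert_table c413 D20.
have [[F13' _] [F41 _] [F34 _]] := w_vert_table (erefl D2) D20.
have [[_ G13'] [_ G34] [_ G41]] := w_vert_table c314 D20'.
have [[Y41 _] [Y34 _] [Y13' _]] := y_vert_table c413 D20 L0.
have [[p12 _] [p31 _] [p23 _]] := w_edge_table d312 D30.
have [[p41 _] [p44 _] [p14 _]] := w_edge_table d441 D40.
have [[p34 _] [p53 _] [p45 _]] := w_edge_table d534 D50.
have [[q23 _] [q62 _] [q36 _]] := w_edge_table d623 D60.
have T1 p r := trace_comb7 (w_edge a3 a1 a2) (w_edge a1 a2 a3) (w_edge a2 a1 a3)
  (w_vert a2 a1 a3) (w_vert a1 a2 a3) (w_vert a3 a1 a2) (y_vert a2 a1 a3)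
  (s3 - 1) (1 - s6) K (k1 - 1 / 2) (1 / 2) (- (1 / 2)) 1 p r.
have T2 p r := trace_comb7 (w_edge a3 a4 a1) (w_edge a1 a3 a4) (w_edge a4 a1 a3)
  (w_vert a4 a1 a3) (w_vert a1 a3 a4) (w_vert a3 a1 a4) (y_vert a4 a1 a3)
  (s4 - 1) (1 - s5) K (1 / 2 - k2) (1 / 2) (- (1 / 2)) (-1) p r.
have T3 p r : trace f3 p r = s3 *: trace (w_edge b3 a1 a2) p r := traceZ _ _ _ _.
have T4 p r : trace f4 p r = s4 *: trace (w_edge b4 a4 a1) p r := traceZ _ _ _ _.
have T5 p r : trace f5 p r = (- s5) *: trace (w_edge b5 a3 a4) p r := traceZ _ _ _ _.
have T6 p r : trace f6 p r = (- s6) *: trace (w_edge b6 a2 a3) p r := traceZ _ _ _ _.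
have s30 : D3 - D1 != 0 by rewrite lt_eqF// subr_lt0 (lt_trans D3_lt0).
have s40 : D4 - D2 != 0 by rewrite lt_eqF// subr_lt0 (lt_trans D4_lt0).
have s50 : D5 - D2 != 0 by rewrite lt_eqF// subr_lt0 (lt_trans D5_lt0).
have s60 : D6 - D1 != 0 by rewrite lt_eqF// subr_lt0 (lt_trans D6_lt0).
have c0 : D1 + D2 != 0 by rewrite gt_eqF// addr_gt0.
have sg1 : Num.sg (- D1) = -1 by rewrite sgrN gtr0_sg.
have sg2 : Num.sg D2 = 1 by rewrite gtr0_sg.
rewrite sg1 in Y12 Y23 Y13; rewrite sg2 in Y41 Y34 Y13'.
have V12 := T1 a1 a2; rewrite A12 B12 C12 E12 F12 G12 Y12 -/f1 in V12.
have V13 := T1 a1 a3; rewrite A13 B13 C13 E13 F13 G13 Y13 -/f1 in V13.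
have V23 := T1 a2 a3; rewrite A23 B23 C23 E23 F23 G23 Y23 -/f1 in V23.
have W41 := T2 a4 a1; rewrite A41 B41 C41 E41 F41 G41 Y41 -/f2 in W41.
have W13 := T2 a1 a3; rewrite A13' B13' C13' E13' F13' G13' Y13' -/f2 in W13.
have W34 := T2 a3 a4; rewrite A34 B34 C34 E34 F34 G34 Y34 -/f2 in W34.
have X12 := T3 a1 a2; rewrite p12 in X12.
have X41 := T4 a4 a1; rewrite p41 in X41.
have X34 := T5 a3 a4; rewrite p34 in X34.
have X23 := T6 a2 a3; rewrite q23 in X23.
have dq (x y : R * R) : x - y = (x - a1) - (y - a1) by rewrite opprB addrA subrK.
have d12 : a1 - a2 = - (a2 - a1) by rewrite opprB.
have d13 : a1 - a3 = - (a3 - a1) by rewrite opprB.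
have d14 : a1 - a4 = - (a4 - a1) by rewrite opprB.
have d32 := dq a3 a2; have d23 := dq a2 a3; have d43 := dq a4 a3; have d34 := dq a3 a4.
split.
- split; [rewrite V12 X12|rewrite V13 W13|rewrite W41 X41|rewrite W34 X34|rewrite V23 X23];
    apply: pairP => /=;
    move: D10 D20 L0 s30 s40 s50 s60 c0 D30 D40 D50 D60;
    rewrite /s3 /s4 /s5 /s6 /k1 /k2 /K /L /D1 /D2;
    rewrite ?d12 ?d13 ?d14 ?d32 ?d23 ?d43 ?d34;
    generalize D3 D4 D5 D6 (a2 - a1) (a3 - a1) (a4 - a1) => D3' D4' D5' D6' p u r;
    coords => h1 h2 h3 h4 h5 h6 h7 h8 h9 h10 h11 h12;
    clear - h1 h2 h3 h4 h5 h6 h7 h8 h9 h10 h11 h12 R a1 a2 a3 a4 b3 b4 b5 b6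
      D1 D2 D3 D4 D5 D6 D1_gt0 D2_gt0 D3_lt0 D4_lt0 D5_lt0 D6_lt0
      L k1 k2 s3 s4 s5 s6 K f1 f2 f3 f4 f5 f6;
    rewrite /GRing.scale /= /GRing.scale /=;
    by field; rewrite ?h1 ?h2 ?h3 ?h4 ?h5 ?h6 ?h7 ?h8 ?h9 ?h10 ?h11 ?h12.
- by rewrite !T3 !T4 p23 p31 p14 p44 !scaler0.
- by rewrite !T5 !T6 p45 p53 q36 q62 !scaler0.
- by rewrite /zero_flux X12 X41 X34 X23 /= /GRing.scale /= /GRing.scale /= !mulr1 !mulrN1 !subrr.
- by rewrite V13 /= /GRing.scale /= /GRing.scale /=; field.
Qed.
#[local] Transparent w_edge w_vert y_vert trace.

End psi_interior.

(** * Traces of the cell functions *)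

Section psi_cell_traces.
Variable R : realType.
Implicit Types (a b c p r x : R * R) (D : R).

Lemma trace_comb6 (q1 q2 q3 q4 q5 q6 : R * R -> R * R) (k k1 k2 k3 : R) p r :
  trace (fun z => k *: (k1 *: q1 z + k2 *: q2 z + k3 *: q3 z + q4 z + q5 z + q6 z)) p r =
  k *: (k1 *: trace q1 p r + k2 *: trace q2 p r + k3 *: trace q3 p r + trace q4 p r
    + trace q5 p r + trace q6 p r).
Proof. by rewrite traceZ !traceD !traceZ. Qed.

(** The restriction of psi_T to T itself, with the area ratios as parameters. Its invariance under
    rotation reduces the three edges to one. *)
Definition psi_center (r1 r2 r3 : R) a1 a2 a3 : R * R -> R * R := fun z =>
  (1 / 3) *: (r1 *: w_edge a1 a2 a3 z + r2 *: w_edge a2 a3 a1 z + r3 *: w_edge a3 a1 a2 z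
    + w_vert a1 a2 a3 z + w_vert a2 a3 a1 z + w_vert a3 a1 a2 z).

Lemma psi_center_rot (r1 r2 r3 : R) a1 a2 a3 :
  psi_center r1 r2 r3 a1 a2 a3 = psi_center r2 r3 r1 a2 a3 a1.
Proof.
apply/funext => z; rewrite /psi_center; congr (_ *: _).
move: (_ *: _) (_ *: _) (_ *: _) (w_vert _ _ _ _) (w_vert _ _ _ _) (w_vert _ _ _ _).
by move=> u v w u' v' w'; apply: injective_projections => /=; ring.
Qed.

#[local] Opaque w_edge w_vert trace.
(** The trace on [a2 a3] depends on [r1] only, because each w_edge has a trace on a single side; so
    the three ratios can be fitted to the three neighbours separately. *)
Lemma psi_center_trace (r1 r2 r3 : R) a1 a2 a3 b1 :
  let D := cross2 (a2 - a1) (a3 - a1) in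
  let E := cross2 (a3 - a2) (b1 - a2) in
  D * E < 0 -> r1 = (E + 2 * D) / (E - D) ->
  trace (psi_center r1 r2 r3 a1 a2 a3) a2 a3 =
  trace (fun z => (E / (E - D)) *: w_edge b1 a2 a3 z) a2 a3 /\
  trace (fun z => (E / (E - D)) *: w_edge b1 a2 a3 z) a2 a3 =
   (E / (E - D), - (E / (E - D)), dot2 (a3 - a2) (a3 - a2) / (E - D)).
Proof.
move=> D E DE r1E.
have D0 : D != 0 by apply: contraTneq DE => ->; rewrite mul0r ltxx.
have E0 : E != 0 by apply: contraTneq DE => ->; rewrite mulr0 ltxx.
have ED0 : E - D != 0.
  by apply: contraTneq DE => /eqP; rewrite subr_eq0 => /eqP ->; rewrite -leNgt -expr2 sqr_ge0.
have e1 : cross2 (a3 - a2) (a1 - a2) = D := esym (cross2_rot a1 a2 a3).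
have e2 : cross2 (a1 - a3) (a2 - a3) = D := cross2_rot a3 a1 a2.
have d1 : cross2 (a2 - b1) (a3 - b1) = E := cross2_rot b1 a2 a3.
have [[A _] _ _] := w_edge_table (erefl D) D0.
have [_ [B _] _] := w_edge_table e1 D0.
have [_ _ [C _]] := w_edge_table e2 D0.
have [_ _ [F _]] := w_vert_table (erefl D) D0.
have [[G _] _ _] := w_vert_table e1 D0.
have [_ [H _] _] := w_vert_table e2 D0.
have [[K _] _ _] := w_edge_table d1 E0.
have T := trace_comb6 (w_edge a1 a2 a3) (w_edge a2 a3 a1) (w_edge a3 a1 a2)
  (w_vert a1 a2 a3) (w_vert a2 a3 a1) (w_vert a3 a1 a2) (1 / 3) r1 r2 r3 a2 a3.
rewrite A B C F G H -/(psi_center r1 r2 r3 a1 a2 a3) in T.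
have T' := traceZ (E / (E - D)) (w_edge b1 a2 a3) a2 a3; rewrite K in T'.
rewrite T T' r1E; clear - D0 E0 ED0.
have -> : dot2 (a3 - a2) (a2 - a1) = - dot2 (a3 - a2) (a3 - a2) - dot2 (a3 - a2) (a1 - a3).
  by rewrite /dot2 /=; ring.
move: D0 E0 ED0; generalize D E => D' E' D0 E0 ED0.
split; apply: pairP => /=; rewrite /GRing.scale /= /GRing.scale /=; by field; rewrite ?D0 ?E0 ?ED0.
Qed.
#[local] Transparent w_edge w_vert trace.

(** The cell is not assumed to be oriented. Reversing its orientation changes the sign of both [D]
    and [E], which leaves the quotients unchanged. *)
Lemma area_ratio a1 a2 a3 b1 :
  let D := cross2 (a2 - a1) (a3 - a1) in
  let E := cross2 (a3 - a2) (b1 - a2) in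
  D * E < 0 ->
  area b1 a2 a3 / (area b1 a2 a3 + area a1 a2 a3) = E / (E - D) /\
  (area b1 a2 a3 - 2 * area a1 a2 a3) / (area b1 a2 a3 + area a1 a2 a3) =
    (E + 2 * D) / (E - D).
Proof.
move=> D E DE.
have D0 : D != 0 by apply: contraTneq DE => ->; rewrite mul0r ltxx.
have ED0 : E - D != 0.
  by apply: contraTneq DE => /eqP; rewrite subr_eq0 => /eqP ->; rewrite -leNgt -expr2 sqr_ge0.
rewrite /area (cross2_rot b1 a2 a3) -/D -/E.
have [D_gt0|D_lt0|D_0] := ltgtP 0 D; last by rewrite -D_0 eqxx in D0.
- have E_lt0 : E < 0 by rewrite -(pmulr_rlt0 _ D_gt0).
  rewrite (gtr0_norm D_gt0) (ltr0_norm E_lt0).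

  by split; field; rewrite ED0; apply: contra_neq ED0 => h; lra.
- have E_gt0 : 0 < E by rewrite -(nmulr_rlt0 _ D_lt0).
  rewrite (ltr0_norm D_lt0) (gtr0_norm E_gt0).
  by split; field; rewrite ?ED0 //; apply: contra_neq ED0 => h; lra.
Qed.

End psi_cell_traces.

(** * Geometry of the triangulation *)

Section geometry.
Variable R : realType.
Variables (Omega : set (R * R)) (V : finType) (pos : V -> R * R).
Variable Th : {set {set V}}.
Implicit Types (a b c u v : V) (T : {set V}) (x y z : R * R).

Definition det3 a b c : R := cross2 (pos b - pos a) (pos c - pos a).
Local Notation bar a b c := (bary (pos a) (pos b) (pos c)).

Lemma det3_rot a b c : det3 b c a = det3 a b c.
Proof. by rewrite /det3 -cross2_rot. Qed.

Lemma det3_swap a b c : det3 a c b = - det3 a b c.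
Proof. exact: cross2C. Qed.

Lemma baryE a b c x : bar a b c x =
  cross2 (pos c - pos b) (x - pos b) / det3 a b c.
Proof. by rewrite /bary /det3; congr (_ / _); rewrite /cross2 /=; ring. Qed.

Lemma bary_combine a b c (ka kb kc : R) : det3 a b c != 0 -> ka + kb + kc = 1 ->
  bar a b c (ka *: pos a + kb *: pos b + kc *: pos c) = ka.
Proof.
move=> D0 /(canRL (addrK _)) /(canRL (addrK _)) ->; rewrite /bary -/(det3 a b c).
apply: (canLR (mulfK D0)); rewrite /det3 /cross2 /= /GRing.scale /=; ring.
Qed.

Hypothesis tri : triangulation Omega pos Th.

Lemma cell_card T : T \in Th -> #|T| = 3.
Proof. by case: tri => _ _ h _ _; exact: h. Qed.

Lemma cell_elim T : T \in Th -> exists a b c, T = [set a; b; c]%SET.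
Proof.
move=> /cell_card; rewrite cardE -{2}(set_enum T).
case: (enum T) => [|a [|b [|c []]]]//= _; exists a, b, c.
by apply/setP => v; rewrite !inE orbA.
Qed.

Lemma cell_det a b c : [set a; b; c]%SET \in Th -> det3 a b c != 0.
Proof.
case: tri => _ _ _ h _ /h; rewrite /area /det3; apply: contraNneq => ->.
by rewrite normr0 mul0r.
Qed.

Lemma cell_uniq a b c : [set a; b; c]%SET \in Th -> [/\ a != b, b != c & a != c].
Proof.
move=> /cell_det; rewrite /det3 => D0; split; apply: contraNneq D0 => ->;
  by rewrite /cross2 /=; apply/eqP; ring.
Qed.

Lemma set3_rot a b c : [set a; b; c]%SET = [set b; c; a]%SET.
Proof. by apply/setP => v; rewrite !inE; do 3 case: (v == _). Qed.

Lemma set3_swap a b c : [set a; b; c]%SET = [set a; c; b]%SET.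
Proof. by apply/setP => v; rewrite !inE; do 3 case: (v == _). Qed.

Lemma cell_at a b T : T \in Th -> a \in T -> b \in T -> a != b ->
  exists c, T = [set a; b; c]%SET.
Proof.
move=> /cell_elim[p [q [r ->]]]; rewrite !inE => /orP[/orP[]|] /eqP -> /orP[/orP[]|] /eqP -> //;
  rewrite ?eqxx// => _.
- by exists r.
- by exists q; rewrite set3_swap.
- by exists r; rewrite set3_rot set3_swap set3_rot -set3_rot set3_rot set3_swap.
- by exists p; rewrite set3_rot.
- by exists q; rewrite set3_rot set3_rot.
- by exists p; rewrite set3_rot set3_rot set3_swap.
Qed.

Lemma sum_cell a b c (W : zmodType) (k : V -> W) :
  [set a; b; c]%SET \in Th -> (forall v, v \notin [set a; b; c]%SET -> k v = 0) ->
  \sum_v k v = k a + k b + k c.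
Proof.
move=> /cell_uniq[ab bc ac] k0.
rewrite (bigD1 a)// (bigD1 b) 1?eq_sym//= (bigD1 c) /=; last first.
  by rewrite eq_sym ac eq_sym bc.
rewrite big1 ?addr0 ?addrA// => v /andP[/andP[va vb] vc]; apply: k0.
by rewrite !inE !negb_or va vb.
Qed.

(** Through this lemma the condition on the intersection of two hulls becomes usable: for a point of
    the hull of a common face, the barycentric coordinates of the vertices off that face vanish. *)
Lemma hull_bary a b c (S : {set V}) x : [set a; b; c]%SET \in Th ->
  S \subset [set a; b; c]%SET -> hull pos S x ->
  exists k : V -> R, [/\ forall v, 0 <= k v, forall v, v \notin S -> k v = 0 &
    [/\ bar a b c x = k a, bar b c a x = k b & bar c a b x = k c]].
Proof.
move=> T_Th ST [k [k0 kS k1 xE]]; exists k; split => //.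
have kT v : v \notin [set a; b; c]%SET -> k v = 0.
  by move=> vT; apply: kS; apply: contraNN vT; exact: (fintype.subsetP ST).
have D0 := cell_det T_Th.
have s1 : k a + k b + k c = 1 by rewrite -(sum_cell T_Th kT).
have -> : x = k a *: pos a + k b *: pos b + k c *: pos c.
  by rewrite xE (sum_cell T_Th)// => v /kT ->; rewrite scale0r.
have D1 : det3 b c a != 0 by rewrite det3_rot.
have D2 : det3 c a b != 0 by rewrite -det3_rot.
have s2 : k b + k c + k a = 1 by rewrite -s1 -addr_rot.
have s3 : k c + k a + k b = 1 by rewrite -s1 addr_rot.
split; first exact: bary_combine.
- by rewrite addr_rot (bary_combine D1 s2).
- by rewrite -addr_rot (bary_combine D2 s3).
Qed.

Lemma hull_cellE a b c x : [set a; b; c]%SET \in Th ->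
  hull pos [set a; b; c]%SET x <->
  [/\ 0 <= bar a b c x, 0 <= bar b c a x & 0 <= bar c a b x].
Proof.
move=> T_Th; split.
  by move=> /(hull_bary T_Th (subxx _))[k [k0 _ [-> -> ->]]]; split.
have D0 := cell_det T_Th; have [ab bc ac] := cell_uniq T_Th.
move=> [la lb lc].
pose k v := if v == a then bar a b c x else if v == b then bar b c a x
  else if v == c then bar c a b x else 0.
have ka : k a = bar a b c x by rewrite /k eqxx.
have kb : k b = bar b c a x by rewrite /k eq_sym (negbTE ab) eqxx.
have kc : k c = bar c a b x by rewrite /k eq_sym (negbTE ac) eq_sym (negbTE bc) eqxx.
have kT v : v \notin [set a; b; c]%SET -> k v = 0.
  by rewrite !inE !negb_or /k => /andP[/andP[/negbTE -> /negbTE ->] /negbTE ->].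
exists k; split => //.
- by move=> v; rewrite /k; do !case: ifP => _.
- by rewrite (sum_cell T_Th kT) ka kb kc bary_sum.
- rewrite (sum_cell T_Th); last by move=> v /kT ->; rewrite scale0r.
  by rewrite ka kb kc bary_pos.
Qed.

Local Notation otri a b c := (open_tri (pos a) (pos b) (pos c)).

Lemma open_tri_hull a b c : [set a; b; c]%SET \in Th ->
  otri a b c `<=` hull pos [set a; b; c]%SET.
Proof. by move=> T_Th x [la lb lc]; apply/(hull_cellE _ T_Th); split; exact: ltW. Qed.

Lemma bary_vertex a b c : det3 a b c != 0 ->
  [/\ bar a b c (pos a) = 1, bar a b c (pos b) = 0 & bar a b c (pos c) = 0].
Proof.
by move=> D0; rewrite !baryE; split; first (apply: (canLR (mulfK D0))); rewrite ?subrr;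
  [|apply/eqP; rewrite mulf_eq0; apply/orP; left; apply/eqP..];
  rewrite /det3 /cross2 /=; ring.
Qed.

Lemma bary_line a b c (s : R) x y :
  bar a b c (x + s *: (y - x)) = (1 - s) * bar a b c x + s * bar a b c y.
Proof. by rewrite !baryE /cross2 /= /GRing.scale /=; ring. Qed.

Lemma near_line x y (U : set (R * R)) : nbhs x U ->
  exists2 t : R, 0 < t < 1 & U (x + t *: (y - x)).
Proof.
move=> Ux.
have cvg : (fun t : R => x + t *: (y - x)) t @[t --> (0 : R)] --> x.
  have := @continuous_segment _ x y 0; by rewrite /continuous_at scale0r addr0.
have /nbhs_ballP[e /= e0 he] := cvg _ Ux.
pose t := Num.min (1 / 2) (e / 2).
have t0 : 0 < t by rewrite lt_min !divr_gt0.
exists t; first by rewrite t0 gt_min ltr_pdivrMr// mul1r ltr1n.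
apply: he; rewrite /ball /= sub0r normrN gtr0_norm// gt_min.
by apply/orP; right; rewrite ltr_pdivrMr// ltr_pMr// ltr1n.
Qed.

(** At a point of the hull where the coordinate of [u] is 0, moving away from the vertex [u] makes
    this coordinate negative at once, so the point is not interior. *)
Lemma interior_cell_hull a b c : [set a; b; c]%SET \in Th ->
  (hull pos [set a; b; c]%SET)° = otri a b c.
Proof.
have key u v w x : [set u; v; w]%SET \in Th ->
    (hull pos [set u; v; w]%SET)° x -> 0 < bar u v w x.
  move=> T_Th ix; have D0 := cell_det T_Th.
  have /(hull_cellE _ T_Th)[l0 _ _] := interior_subset ix.
  rewrite lt_neqAle l0 andbT; apply/eqP => /esym l0'.
  have [t /andP[t0 _] /(hull_cellE _ T_Th)[+ _ _]] := near_line (x - (pos u - x)) ix.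
  rewrite bary_line l0' mulr0 add0r.
  rewrite (_ : x - (pos u - x) = x + (-1) *: (pos u - x)); last by rewrite scaleN1r.
  have [e1 _ _] := bary_vertex D0.
  by rewrite bary_line l0' mulr0 add0r e1 mulr1 mulrN1 oppr_ge0 leNgt t0.
move=> T_Th; apply/seteqP; split => x.
  move=> ix; split; first exact: key ix.
  - by apply: key; rewrite -set3_rot.
  - by apply: key; rewrite set3_rot.
move=> ox; apply: (filterS (open_tri_hull T_Th)).
by apply: open_nbhs_nbhs; split => //; exact: open_tri_open.
Qed.

Lemma hull_meet T T' x : T \in Th -> T' \in Th ->
  hull pos T x -> hull pos T' x -> hull pos (T :&: T')%SET x.
Proof. by case: tri => _ _ _ _ [h _] T1 T2 h1 h2; rewrite -h. Qed.

(** All three coordinates of the point are positive, so every vertex of the first cell lies in [T'];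
    both have three vertices. *)
Lemma open_cell_meet a b c T' x : [set a; b; c]%SET \in Th -> T' \in Th ->
  otri a b c x -> hull pos T' x -> T' = [set a; b; c]%SET.
Proof.
move=> T_Th T'_Th ox hx; have [la lb lc] := ox.
have := hull_meet T_Th T'_Th (open_tri_hull T_Th ox) hx.
move=> /(hull_bary T_Th (subsetIl _ _))[k [_ kS [ea eb ec]]].
have sub : [set a; b; c]%SET \subset T'.
  apply/fintype.subsetP => v vT; apply/negPn/negP => vT'.
  have kv : k v = 0 by apply: kS; rewrite inE (negbTE vT') andbF.
  move: vT la lb lc; rewrite !inE ea eb ec => /orP[/orP[]|] /eqP vE; move: kv; rewrite vE => ->;
    by rewrite ltxx.
by apply/esym/eqP; rewrite eqEcard sub (cell_card T_Th) (cell_card T'_Th).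
Qed.

Lemma edge_point_meet a b c T' x : [set a; b; c]%SET \in Th -> T' \in Th ->
  0 < bar a b c x -> 0 < bar b c a x -> bar c a b x = 0 ->
  hull pos T' x -> (a \in T') && (b \in T').
Proof.
move=> T_Th T'_Th la lb lc hx.
have hTx : hull pos [set a; b; c]%SET x.
  by apply/(hull_cellE _ T_Th); split; [exact: ltW|exact: ltW|rewrite lc].
have := hull_meet T_Th T'_Th hTx hx.
move=> /(hull_bary T_Th (subsetIl _ _))[k [_ kS [ea eb ec]]].
apply/andP; split; apply/negPn/negP => vT'.
- by move: la; rewrite ea kS ?ltxx// inE (negbTE vT') andbF.
- by move: lb; rewrite eb kS ?ltxx// inE (negbTE vT') andbF.
Qed.

Lemma bary_vertices a b c : det3 a b c != 0 ->
  [/\ [/\ bar a b c (pos a) = 1, bar a b c (pos b) = 0 & bar a b c (pos c) = 0],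
      [/\ bar b c a (pos a) = 0, bar b c a (pos b) = 1 & bar b c a (pos c) = 0] &
      [/\ bar c a b (pos a) = 0, bar c a b (pos b) = 0 & bar c a b (pos c) = 1]].
Proof.
move=> D0; have [? ? ?] := bary_vertex D0.
have [? ? ?] : [/\ bar b c a (pos b) = 1, bar b c a (pos c) = 0 & bar b c a (pos a) = 0].
  by apply: bary_vertex; rewrite det3_rot.
have [? ? ?] : [/\ bar c a b (pos c) = 1, bar c a b (pos a) = 0 & bar c a b (pos b) = 0].
  by apply: bary_vertex; rewrite -det3_rot.
by [].
Qed.

Lemma nbhs_bary_gt0 a b c x : 0 < bar a b c x -> nbhs x [set z | 0 < bar a b c z].
Proof.
by move=> lx; apply: open_nbhs_nbhs; split => //; exact: open_bary_gt0.
Qed.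

Definition midpoint a b : R * R := pos a + (1 / 2) *: (pos b - pos a).

Lemma bary_midpoint a b c : det3 a b c != 0 ->
  [/\ bar a b c (midpoint a b) = 1 / 2, bar b c a (midpoint a b) = 1 / 2 &
      bar c a b (midpoint a b) = 0].
Proof.
move=> D0; have [[va vb _] [va' vb' _] [va'' vb'' _]] := bary_vertices D0.
by rewrite !bary_line va vb va' vb' va'' vb''; split; lra.
Qed.

Lemma bary_opposite a b c x : bar c a b x = cross2 (pos b - pos a) (x - pos a) / det3 a b c.
Proof. by rewrite baryE (det3_rot c a b). Qed.

(** If [c] and [c'] are on the same side of [a b], a point slightly off the midpoint towards [c] is
    interior to the first cell and lies in the second, so the cells are equal. *)
Lemma same_side a b c c' : [set a; b; c]%SET \in Th -> [set a; b; c']%SET \in Th ->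
  0 < det3 a b c * det3 a b c' -> c = c'.
Proof.
move=> T_Th T'_Th DD; have D0 := cell_det T_Th; have D0' := cell_det T'_Th.
have [m1 m2 m3] := bary_midpoint D0; have [n1 n2 n3] := bary_midpoint D0'.
have [[_ _ vc] [_ _ vc'] [_ _ vc'']] := bary_vertices D0.
have [t /andP[t0 t1] [ha hb]] : exists2 t : R, 0 < t < 1 &
    ([set x | 0 < bar a b c' x] `&` [set x | 0 < bar b c' a x])
      (midpoint a b + t *: (pos c - midpoint a b)).
  by apply: near_line; apply: filterI; apply: nbhs_bary_gt0; rewrite ?n1 ?n2 divr_gt0.
set x := _ + _ in ha hb.
have c't : 0 < bar c' a b x.
  rewrite bary_line n3 mulr0 add0r mulr_gt0// bary_opposite -/(det3 a b c).
  rewrite (_ : _ / _ = det3 a b c * det3 a b c' / det3 a b c' ^+ 2); last by field.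
  by rewrite divr_gt0// exprn_even_gt0.
have hT' : hull pos [set a; b; c']%SET x.
  by apply/(hull_cellE _ T'_Th); split; exact: ltW.
have oT : otri a b c x.
  rewrite /x; split; rewrite bary_line ?m1 ?m2 ?m3 ?vc ?vc' ?vc''; lra.
have := open_cell_meet T_Th T'_Th oT hT'.
move=> /setP/(_ c'); rewrite !inE eqxx orbT => /esym.
have [_ /negbTE bc' /negbTE ac'] := cell_uniq T'_Th.
by rewrite !(eq_sym c') ac' bc' => /eqP.
Qed.

Lemma hull_sub_closure T : T \in Th -> hull pos T `<=` closure Omega.
Proof. by case: tri => _ _ _ _ [_ ->] T_Th x hx; exists T. Qed.

Lemma opposite_sides a b c c' : [set a; b; c]%SET \in Th ->
  [set a; b; c']%SET \in Th -> c != c' -> det3 a b c * det3 a b c' < 0.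
Proof.
move=> h h' cc'; rewrite lt_neqAle mulf_neq0 ?(cell_det h) ?(cell_det h')//=.
by rewrite leNgt; apply: contra_neqN cc' => /(same_side h h').
Qed.

Hypothesis regular_Omega : (closure Omega)° = Omega.

(** The two cells lie on opposite sides of the edge and together cover a neighbourhood of its
    midpoint. It is thus interior to the closure of [Omega], which is where regularity of the domain
    enters. *)
Lemma midpoint_interior a b c c' : [set a; b; c]%SET \in Th ->
  [set a; b; c']%SET \in Th -> c != c' -> Omega (midpoint a b).
Proof.
move=> T_Th T'_Th cc'; have DD := opposite_sides T_Th T'_Th cc'.
have D0 := cell_det T_Th; have D0' := cell_det T'_Th.
have [m1 m2 m3] := bary_midpoint D0; have [n1 n2 n3] := bary_midpoint D0'.
rewrite -regular_Omega.
have pos12 : 0 < 1 / 2 :> R by rewrite divr_gt0.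
rewrite /interior; near=> z.
have la : 0 < bar a b c z by near: z; apply: nbhs_bary_gt0; rewrite m1.
have lb : 0 < bar b c a z by near: z; apply: nbhs_bary_gt0; rewrite m2.
have la' : 0 < bar a b c' z by near: z; apply: nbhs_bary_gt0; rewrite n1.
have lb' : 0 < bar b c' a z by near: z; apply: nbhs_bary_gt0; rewrite n2.
have [lc|lc] := leP 0 (bar c a b z).
  by apply: (hull_sub_closure T_Th); apply/(hull_cellE _ T_Th); split => //; exact: ltW.
apply: (hull_sub_closure T'_Th); apply/(hull_cellE _ T'_Th); split; [exact: ltW|exact: ltW|].
move: lc; rewrite !bary_opposite; set k := cross2 _ _ => lc.
have -> : k / det3 a b c' = (k / det3 a b c) * (det3 a b c * det3 a b c') / det3 a b c' ^+ 2.
  by field; rewrite D0 D0'.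
by rewrite divr_ge0 ?sqr_ge0// ltW// nmulr_rgt0.
Unshelve. all: by end_near. Qed.

Lemma sum_edge a b (W : zmodType) (k : V -> W) : a != b ->
  (forall v, v \notin [set a; b]%SET -> k v = 0) -> \sum_v k v = k a + k b.
Proof.
move=> ab k0; rewrite (bigD1 a)// (bigD1 b) 1?eq_sym//=.
rewrite big1 ?addr0// => v /andP[va vb]; apply: k0.
by rewrite !inE negb_or va vb.
Qed.

Lemma midpoint_hull a b : a != b -> hull pos [set a; b]%SET (midpoint a b).
Proof.
move=> ab; pose k v : R := if v \in [set a; b]%SET then 1 / 2 else 0.
have ka : k a = 1 / 2 by rewrite /k !inE eqxx.
have kb : k b = 1 / 2 by rewrite /k !inE eqxx orbT.
have k0 v : v \notin [set a; b]%SET -> k v = 0 by rewrite /k => /negbTE ->.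
exists k; split => //.
- by move=> v; rewrite /k; case: ifP => // _; rewrite divr_ge0.
- by rewrite (sum_edge ab)// ka kb; lra.
- rewrite (sum_edge ab); last by move=> v /k0 ->; rewrite scale0r.
  rewrite ka kb /midpoint.
  by apply: injective_projections => /=; rewrite /GRing.scale /=; lra.
Qed.

Lemma cell_edge a b c : [set a; b; c]%SET \in Th -> edge Th [set a; b]%SET.
Proof.
move=> T_Th; have [ab _ _] := cell_uniq T_Th; split; first by rewrite cards2 ab.
by exists [set a; b; c]%SET => //; apply/fintype.subsetP => v; rewrite !inE => ->.
Qed.

Lemma two_cells_interior a b c c' : [set a; b; c]%SET \in Th ->
  [set a; b; c']%SET \in Th -> c != c' -> interior_edge Omega pos Th [set a; b]%SET.
Proof.
move=> T_Th T'_Th cc'; split; first exact: cell_edge T_Th.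
have [ab _ _] := cell_uniq T_Th.
by move=> /(_ _ (midpoint_hull ab))[_]; apply; exact: midpoint_interior cc'.
Qed.

Lemma boundary_one_cell a b c c' : boundary_edge Omega pos Th [set a; b]%SET ->
  [set a; b; c]%SET \in Th -> [set a; b; c']%SET \in Th -> c = c'.
Proof.
move=> [_ be] T_Th T'_Th; apply/eqP/negPn/negP => cc'.
by have [_ []] := two_cells_interior T_Th T'_Th cc'.
Qed.

Lemma hull_edgeE a b x : a != b -> hull pos [set a; b]%SET x ->
  exists2 s : R, 0 <= s <= 1 & x = pos a + s *: (pos b - pos a).
Proof.
move=> ab [k [k0 kS k1 xE]].
rewrite (sum_edge ab kS) in k1.
rewrite (sum_edge ab) in xE; last by move=> v /kS ->; rewrite scale0r.
exists (k b); first by rewrite k0 -k1 lerDr k0.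
rewrite xE -(addrK (k b) (k a)) k1.
by apply: injective_projections => /=; rewrite /GRing.scale /=; ring.
Qed.

Hypothesis open_Omega : open Omega.

Lemma dot2_gt0 a b c : det3 a b c != 0 ->
  0 < dot2 (pos b - pos a) (pos b - pos a).
Proof.
move=> D0; rewrite lt_neqAle; apply/andP; split; last by rewrite addr_ge0// -expr2 sqr_ge0.
apply: contraNneq D0 => /esym/eqP.
rewrite /dot2 -!expr2 paddr_eq0 ?sqr_ge0// !sqrf_eq0 => /andP[/eqP h1 /eqP h2].
by rewrite /det3 /cross2 h1 h2; apply/eqP; ring.
Qed.

(** The point of the edge inside [Omega] may be an endpoint. As [Omega] is open, it can be moved
    slightly towards the midpoint. *)
Lemma interior_edge_point a b : interior_edge Omega pos Th [set a; b]%SET ->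
  exists c s, [/\ [set a; b; c]%SET \in Th, 0 < s < 1 & Omega (pos a + s *: (pos b - pos a))].
Proof.
move=> [[/eqP e2 [T T_Th eT]] ni].
have ab : a != b by move: e2; rewrite cards2 eqSS eqb1.
have aT : a \in T by apply: (fintype.subsetP eT); rewrite !inE eqxx.
have bT : b \in T by apply: (fintype.subsetP eT); rewrite !inE eqxx orbT.
have [c TE] := cell_at T_Th aT bT ab; rewrite TE in T_Th.
have [x hx Ox] : exists2 x, hull pos [set a; b]%SET x & Omega x.
  apply: contrapT => nex; apply: ni => x hx; split.
    apply: (hull_sub_closure T_Th); have [k [k0 kS k1 xE]] := hx; exists k; split => // v.
    by rewrite !inE negb_or => /andP[vab _]; apply: kS; rewrite !inE.
  by move=> Ox; apply: nex; exists x.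
have [s /andP[s0 s1] xE] := hull_edgeE ab hx.
have Ux : nbhs x Omega by exact: open_nbhs_nbhs.
have [t /andP[t0 t1] Ot] := near_line (midpoint a b) Ux.
exists c, ((1 - t) * s + t / 2); split => //; first by apply/andP; split; nra.
move: Ot; rewrite xE /midpoint; congr (Omega _).
by apply: injective_projections => /=; rewrite /GRing.scale /=; field.
Qed.

(** The boolean selects the side. A point displaced from the edge to that side is still in [Omega],
    hence in some cell; if it is near enough, this cell must contain both endpoints, and the sign of
    its determinant is that of the displacement. *)
Lemma interior_edge_side a b (e : bool) : interior_edge Omega pos Th [set a; b]%SET ->
  exists2 c, [set a; b; c]%SET \in Th & 0 < (-1) ^+ e * det3 a b c.
Proof.
move=> /interior_edge_point[c [s [T_Th /andP[s0 s1] Oy]]].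
have [ab _ _] := cell_uniq T_Th; have D0 := cell_det T_Th.
set y := _ + _ in Oy.
have [[va vb _] [va' vb' _] [va'' vb'' _]] := bary_vertices D0.
have ya : 0 < bar a b c y by rewrite bary_line va vb; lra.
have yb : 0 < bar b c a y by rewrite bary_line va' vb'; lra.
have yc : bar c a b y = 0 by rewrite bary_line va'' vb''; lra.
have closed_cell T : T \in Th -> closed (hull pos T).
  move=> hT; have [p [q [r TE]]] := cell_elim hT; rewrite TE in hT *.
  rewrite (_ : hull _ _ = [set z | 0 <= bar p q r z] `&` [set z | 0 <= bar q r p z]
     `&` [set z | 0 <= bar r p q z]); first by apply: closedI; [apply: closedI|]; exact: closed_bary_ge0.
  apply/seteqP; split => z.
    by move=> /(hull_cellE _ hT)[].
  by move=> [[? ?] ?]; apply/(hull_cellE _ hT).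
(* There are finitely many cells, their hulls are closed, and those containing [y] contain [a] and
   [b]. *)
have away : \forall z \near y, forall T, T \in Th -> hull pos T z -> (a \in T) && (b \in T).
  apply: (@filter_forall _ _ (fun (T : {set V}) z => T \in Th -> hull pos T z ->
    (a \in T) && (b \in T)) (nbhs y)) => T.
  have [hT|/negP hT] := boolP (T \in Th); last first.
    by apply: nearW => z Tz; exfalso; exact: hT.
  have [hy|hy] := pselect (hull pos T y).
    by have -> := edge_point_meet T_Th hT ya yb yc hy; apply: nearW.
  have := closed_openC (closed_cell _ hT); move=> /(_ _ hy).
  by apply: filterS => z nz _ /nz.
have Uy : nbhs y (Omega `&` [set z | forall T, T \in Th -> hull pos T z ->
     (a \in T) && (b \in T)]).
  by apply: filterI => //; exact: open_nbhs_nbhs.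
pose n : R * R := (- (pos b - pos a).2, (pos b - pos a).1).
have [t /andP[t0 _] [Oz hz]] := near_line (y + (-1) ^+ e *: n) Uy.
rewrite [y + _ *: n]addrC addrK in Oz hz; set z := y + _ in Oz hz.
have [_ _ _ _ [_ cover]] := tri.
have : closure Omega z by exact: subset_closure.
rewrite cover => -[T /= hT hTz].
have /andP[aT bT] := hz _ hT hTz.
have [d TE] := cell_at hT aT bT ab; rewrite TE in hT hTz.
exists d => //.
have /(hull_cellE _ hT)[_ _] := hTz; rewrite bary_opposite.
have -> : cross2 (pos b - pos a) (z - pos a) = t * ((-1) ^+ e * dot2 (pos b - pos a) (pos b - pos a)).
  by rewrite /z /y /n /cross2 /dot2 /= /GRing.scale /=; ring.
have N0 := dot2_gt0 D0; have D0' := cell_det hT.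
move=> h; have : 0 <= t * dot2 (pos b - pos a) (pos b - pos a) / det3 a b d ^+ 2 * ((-1) ^+ e * det3 a b d).
  by rewrite (_ : _ * _ = t * ((-1) ^+ e * dot2 (pos b - pos a) (pos b - pos a)) / det3 a b d)//; field.
rewrite pmulr_rge0; last by apply: divr_gt0; [exact: mulr_gt0|rewrite exprn_even_gt0].
by rewrite le_eqVlt eq_sym mulf_eq0 signr_eq0 (negbTE D0').
Qed.

Lemma interior_vertex_edge a b : interior_vertex Omega pos a ->
  edge Th [set a; b]%SET -> interior_edge Omega pos Th [set a; b]%SET.
Proof.
move=> Oa eab; split => // /(_ (pos a)); case; last by [].
exists (fun v => (v == a)%:R); split.
- by move=> v; rewrite ler0n.
- by move=> v; rewrite !inE negb_or => /andP[/negbTE ->].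
- by rewrite (bigD1 a)//= eqxx big1 ?addr0// => v /negbTE ->.
- by rewrite (bigD1 a)//= eqxx scale1r big1 ?addr0// => v /negbTE ->; rewrite scale0r.
Qed.

Lemma cell_subset_Omega a b c : [set a; b; c]%SET \in Th -> otri a b c `<=` Omega.
Proof.
move=> T_Th x ox; rewrite -regular_Omega.
apply: (filterS (hull_sub_closure T_Th)); apply: (filterS (open_tri_hull T_Th)).
by apply: open_nbhs_nbhs; split => //; exact: open_tri_open.
Qed.

Lemma Omega_cover x : Omega x -> exists2 T, T \in Th & hull pos T x.
Proof.
move=> /(@subset_closure _ Omega); have [_ _ _ _ [_ ->]] := tri.
by move=> [T /= hT hx]; exists T.
Qed.

End geometry.

(** * Conforming families and the functions psi *)

Section families.
Variable R : realType.
Variables (Omega : set (R * R)) (V : finType) (pos : V -> R * R).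
Variable Th : {set {set V}}.
Implicit Types (a b c p r u v : V) (T : {set V}) (x y z : R * R).
Hypothesis tri : triangulation Omega pos Th.
Hypothesis regular_Omega : (closure Omega)° = Omega.
Local Notation tr q a b := (trace q (pos a) (pos b)).
Local Notation field := (R * R -> R * R).

Definition conforming (q : {set V} -> field) : Prop :=
  [/\ forall a b c, [set a; b; c]%SET \in Th ->
        P1plus (pos a) (pos b) (pos c) (q [set a; b; c]%SET),
      forall T T' a b, T \in Th -> T' \in Th -> a \in T -> b \in T ->
        a \in T' -> b \in T' -> a != b -> tr (q T) a b = tr (q T') a b &
      forall T a b, boundary_edge Omega pos Th [set a; b]%SET -> T \in Th ->
        a \in T -> b \in T -> a != b -> tr (q T) a b = 0].

Definition onT T0 (f : field) : {set V} -> field :=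
  fun T x => if T == T0 then f x else 0.

(** The part of the trace of [f] carried by the edge [E]. Splitting the traces of a piece on its
    cell in this way lets the matching be checked edge by edge. *)
Definition edge_trace (E : {set V}) (f : field) p r : R * R * R :=
  if [set p; r]%SET == E then tr f p r else 0.

Lemma set2_eq a b p r : [set p; r]%SET = [set a; b]%SET ->
  (p = a /\ r = b) \/ (p = b /\ r = a).
Proof.
move=> e.
have hp : p \in [set a; b]%SET by rewrite -e set21.
have hr : r \in [set a; b]%SET by rewrite -e set22.
have ha : a \in [set p; r]%SET by rewrite e set21.
have hb : b \in [set p; r]%SET by rewrite e set22.
move: hp hr ha hb; rewrite !in_set2.
by move=> /orP[] /eqP -> /orP[] /eqP -> /orP[] /eqP h1 /orP[] /eqP h2; [left|..]; auto.
Qed.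

Lemma edge_trace_eq a b f f' p r : tr f a b = tr f' a b ->
  edge_trace [set a; b]%SET f p r = edge_trace [set a; b]%SET f' p r.
Proof.
move=> e; rewrite /edge_trace; case: eqP => // /set2_eq[[-> ->]//|[-> ->]].
exact: trace_rev_eq.
Qed.

Lemma edge_trace0 a b f p r : tr f a b = 0 -> edge_trace [set a; b]%SET f p r = 0.
Proof.
move=> e; rewrite /edge_trace; case: eqP => // /set2_eq[[-> ->]//|[-> ->]].
by rewrite trace_rev e /= oppr0.
Qed.

Lemma trace_onT a b c T f p r : [set a; b; c]%SET \in Th -> T \in Th ->
  p \in T -> r \in T -> p != r ->
  tr (onT [set a; b; c]%SET f T) p r =
  if T == [set a; b; c]%SET then edge_trace [set a; b]%SET f p r +
    edge_trace [set b; c]%SET f p r + edge_trace [set c; a]%SET f p r else 0.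
Proof.
move=> T0_Th T_Th pT rT pr; rewrite /onT; case: eqP => [TE|_]; last exact: trace0.
rewrite TE in pT rT T_Th; have [ab bc ac] := cell_uniq tri T_Th.
have ba : b != a by rewrite eq_sym.
have cb : c != b by rewrite eq_sym.
have ca : c != a by rewrite eq_sym.
have ne u v s t : u != s -> u != t -> ([set u; v]%SET == [set s; t]%SET) = false.
  move=> us ut; apply/negP => /eqP/setP/(_ u).
  by rewrite !inE eqxx (negbTE us) (negbTE ut).
have ne' u v s t : v != s -> v != t -> ([set u; v]%SET == [set s; t]%SET) = false.
  by move=> h1 h2; rewrite (finset.setUC [set u]%SET) ne.
have C u v : [set u; v]%SET = [set v; u]%SET by rewrite finset.setUC.
rewrite /edge_trace; move: pT rT pr; rewrite !inE.
move=> /orP[/orP[]|] /eqP -> /orP[/orP[]|] /eqP -> //; rewrite ?eqxx// => _.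
- by rewrite ?eqxx (ne _ _ b c)// (ne' _ _ c a)// !addr0.
- by rewrite (ne' _ _ a b)// (ne _ _ b c)// (C c a) ?eqxx !add0r.
- by rewrite (C b a) ?eqxx (ne _ _ b c)// (ne' _ _ c a)// !addr0.
- by rewrite (ne' _ _ a b)// ?eqxx (ne _ _ c a)// add0r addr0.
- by rewrite (ne _ _ a b)// (ne' _ _ b c)// ?eqxx !add0r.
- by rewrite (C c b) (ne' _ _ a b)// ?eqxx (ne _ _ c a)// add0r addr0.
Qed.

Lemma cell_dichotomy a b c c' T : [set a; b; c]%SET \in Th ->
  [set a; b; c']%SET \in Th -> c != c' -> T \in Th -> a \in T -> b \in T ->
  T = [set a; b; c]%SET \/ T = [set a; b; c']%SET.
Proof.
move=> h h' cc' T_Th aT bT; have [ab _ _] := cell_uniq tri h.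
have [d TE] := cell_at tri T_Th aT bT ab; rewrite TE in T_Th *.
have DD := opposite_sides tri h h' cc'.
have D0 := cell_det tri T_Th.
have [dc|dc] := ltP 0 (det3 pos a b d * det3 pos a b c).
  by left; rewrite (same_side tri T_Th h dc).
right; rewrite (@same_side _ _ _ _ _ tri a b d c')//.
have : det3 pos a b d * det3 pos a b c < 0.
  by rewrite lt_neqAle dc mulf_neq0// (cell_det tri h).
nra.
Qed.

(** A cell containing the edge is exactly one of its two neighbours, so the two indicators add up to
    1 there. Two pieces with the same trace on a common edge thus contribute a term independent of
    the cell. *)
Lemma edge_trace_pair a b c c' T f p r : [set a; b; c]%SET \in Th ->
  [set a; b; c']%SET \in Th -> c != c' -> T \in Th -> p \in T -> r \in T ->
  (if T == [set a; b; c]%SET then edge_trace [set a; b]%SET f p r else 0) +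
  (if T == [set a; b; c']%SET then edge_trace [set a; b]%SET f p r else 0) =
  edge_trace [set a; b]%SET f p r.
Proof.
move=> h h' cc' T_Th pT rT; rewrite /edge_trace; case: (eqVneq [set p; r]%SET) => [e|_].
  have /andP[aT bT] : (a \in T) && (b \in T).
    by case: (set2_eq e) => -[<- <-]; rewrite ?pT ?rT.
  have ne : [set a; b; c]%SET != [set a; b; c']%SET :> {set V}.
    apply: contra_neq cc' => /setP/(_ c); rewrite !inE eqxx orbT => /esym.
    have [_ bc ac] := cell_uniq tri h.
    by rewrite (eq_sym c a) (eq_sym c b) (negbTE ac) (negbTE bc) => /eqP.
  case: (cell_dichotomy h h' cc' T_Th aT bT) => ->; rewrite eqxx.
    by rewrite (negbTE ne) addr0.
  by rewrite eq_sym (negbTE ne) add0r.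
by rewrite !if_same addr0.
Qed.

Lemma edge_trace_boundary a b c c' f p r : [set a; b; c]%SET \in Th ->
  [set a; b; c']%SET \in Th -> c != c' ->
  boundary_edge Omega pos Th [set p; r]%SET -> edge_trace [set a; b]%SET f p r = 0.
Proof.
move=> h h' cc' be; rewrite /edge_trace; case: eqP => // e.
rewrite e in be.
by have := boundary_one_cell tri regular_Omega be h h' => /eqP; rewrite (negbTE cc').
Qed.

(** A formula for the traces that does not mention the cell gives all compatibility conditions at
    once. *)
Lemma conforming_of_trace (q : {set V} -> field) (G : V -> V -> R * R * R) :
  (forall a b c, [set a; b; c]%SET \in Th ->
        P1plus (pos a) (pos b) (pos c) (q [set a; b; c]%SET)) ->
  (forall T p r, T \in Th -> p \in T -> r \in T -> p != r -> tr (q T) p r = G p r) ->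
  (forall p r, boundary_edge Omega pos Th [set p; r]%SET -> G p r = 0) ->
  conforming q.
Proof.
move=> qP qG G0; split => //.
- by move=> T T' a b *; rewrite !qG.
- by move=> T a b be *; rewrite qG// G0.
Qed.

Lemma P1plus_cell a b c a' b' c' (q : field) : [set a; b; c]%SET \in Th ->
  [set a; b; c]%SET = [set a'; b'; c']%SET ->
  P1plus (pos a) (pos b) (pos c) q -> P1plus (pos a') (pos b') (pos c') q.
Proof.
move=> h e; have h' := h; rewrite e in h'; have [ab bc ac] := cell_uniq tri h'.
have ia : a' \in [set a; b; c]%SET by rewrite e !inE eqxx.
have ib : b' \in [set a; b; c]%SET by rewrite e !inE eqxx orbT.
have ic : c' \in [set a; b; c]%SET by rewrite e !inE eqxx orbT.
(* One transposition and one rotation generate all orders of the three vertices. *)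
suff sym (Q : V -> V -> V -> Prop) : (forall x y z : V, Q x y z -> Q x z y) ->
    (forall x y z : V, Q x y z -> Q y z x) -> Q a b c -> Q a' b' c'.
  apply: (sym (fun x y z : V => P1plus (pos x) (pos y) (pos z) q) _ _) => x y z.
    by rewrite P1plus_swap.
  by move=> h1; rewrite P1plus_rot.
clear - ia ib ic ab bc ac; move=> S Ro P; move: ia ib ic ab bc ac; rewrite !inE.
move=> /orP[/orP[]|] /eqP -> /orP[/orP[]|] /eqP ->; rewrite ?eqxx//;
  move=> /orP[/orP[]|] /eqP ->; rewrite ?eqxx// => _ _ _; by auto.
Qed.

Lemma P1plus_onT a b c f : P1plus (pos a) (pos b) (pos c) f ->
  forall a' b' c', [set a'; b'; c']%SET \in Th ->
  P1plus (pos a') (pos b') (pos c') (onT [set a; b; c]%SET f [set a'; b'; c']%SET).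
Proof.
move=> Pf a' b' c' h; rewrite /onT; case: eqP => [e|_]; last exact: P1plus0.
rewrite e in h.
exact: (P1plus_cell h (esym e)).
Qed.

Lemma on_cell_onT a b c f T x : [set a; b; c]%SET \in Th -> T \in Th ->
  (hull pos T)° x -> on_cell pos a b c f x = onT [set a; b; c]%SET f T x.
Proof.
move=> h T_Th ix; rewrite /on_cell /onT patchE; case: eqP => [TE|TE].
  by rewrite mem_set// -TE.
case: ifPn => //; rewrite inE => hx; exfalso; apply: TE.
have [p [q [r E]]] := cell_elim tri T_Th; rewrite E in T_Th ix *.
rewrite (interior_cell_hull tri T_Th) in ix.
by apply/esym; apply: (open_cell_meet tri T_Th h ix); exact: interior_subset.
Qed.

End families.

(** * The cell functions as conforming families *)

Section psi_specs.
Variable R : realType.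
Variables (Omega : set (R * R)) (V : finType) (pos : V -> R * R).
Variable Th : {set {set V}}.
Implicit Types (a b c p r u v : V) (T : {set V}) (x y z : R * R).
Hypothesis tri : triangulation Omega pos Th.
Hypothesis regular_Omega : (closure Omega)° = Omega.
Local Notation tr q a b := (trace q (pos a) (pos b)).
Local Notation field := (R * R -> R * R).

(** Only interiors of cells are compared: on the skeleton the functions psi are 0 by convention,
    whereas the polynomials of the family need not be. *)
Definition agrees (psi : field) (q : {set V} -> field) :=
  forall T x, T \in Th -> (hull pos T)° x -> psi x = q T x.

Definition mean_free (q : {set V} -> field) :=
  forall T p r, T \in Th -> p \in T -> r \in T -> p != r -> zero_flux (tr (q T) p r).

Definition cell_moment (q : {set V} -> field) a b c :=
  moment (q [set a; b; c]%SET) (pos a) (pos b) (pos c).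

Lemma cell_dot a b c : [set a; b; c]%SET \in Th ->
  [/\ cross2 (pos b - pos a) (pos c - pos a) != 0,
      dot2 (pos b - pos a) (pos b - pos a) != 0,
      dot2 (pos c - pos b) (pos c - pos b) != 0 &
      dot2 (pos a - pos c) (pos a - pos c) != 0].
Proof.
move=> h; have D0 := cell_det tri h; split => //.
- exact: dot2_neq0_cross D0.
- by apply: (@dot2_neq0_cross _ _ (pos a - pos b)); rewrite -cross2_rot.
- by apply: (@dot2_neq0_cross _ _ (pos b - pos c)); rewrite cross2_rot.
Qed.

Lemma cell_mem a b c : [/\ a \in [set a; b; c]%SET, b \in [set a; b; c]%SET &
  c \in [set a; b; c]%SET].
Proof. by rewrite !inE !eqxx !orbT. Qed.

Lemma cell_moment_rot q a b c : conforming Omega pos Th q -> mean_free q ->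
  [set a; b; c]%SET \in Th -> cell_moment q b c a = cell_moment q a b c.
Proof.
move=> [qP _ _] qf h; have [D0 L1 L2 L3] := cell_dot h.
have [ab bc ac] := cell_uniq tri h; have [ia ib ic] := cell_mem a b c.
rewrite /cell_moment -set3_rot; apply: moment_rot => //; first exact: qP.
- exact: qf.
- exact: qf.
- by apply: qf; rewrite // eq_sym.
Qed.

Lemma cell_moment_swap q a b c : mean_free q ->
  [set a; b; c]%SET \in Th -> cell_moment q a c b = cell_moment q a b c.
Proof.
move=> qf h; have [ab bc ac] := cell_uniq tri h; have [ia ib ic] := cell_mem a b c.
by rewrite /cell_moment -set3_swap; apply: moment_swap; exact: qf.
Qed.

Lemma cell_moment_order q a b c a' b' c' : conforming Omega pos Th q -> mean_free q ->
  [set a; b; c]%SET \in Th -> [set a; b; c]%SET = [set a'; b'; c']%SET ->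
  cell_moment q a' b' c' = cell_moment q a b c.
Proof.
move=> qc qf h e; have h' := h; rewrite e in h'; have [ab bc ac] := cell_uniq tri h'.
have ia : a' \in [set a; b; c]%SET by rewrite e !inE eqxx.
have ib : b' \in [set a; b; c]%SET by rewrite e !inE eqxx orbT.
have ic : c' \in [set a; b; c]%SET by rewrite e !inE eqxx orbT.
have h1 : [set b; c; a]%SET \in Th by rewrite -set3_rot.
have h2 : [set c; a; b]%SET \in Th by rewrite set3_rot.
have e1 := cell_moment_rot qc qf h; have e2 := cell_moment_rot qc qf h1.
have e3 := cell_moment_swap qf h; have e4 := cell_moment_swap qf h1.
have e5 := cell_moment_swap qf h2.
move: ia ib ic ab bc ac; rewrite !inE.
move=> /orP[/orP[]|] /eqP -> /orP[/orP[]|] /eqP ->; rewrite ?eqxx//;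
  by move=> /orP[/orP[]|] /eqP ->; rewrite ?eqxx// => _ _ _; congruence.
Qed.

(** All that the span argument needs from psi_T. The value -2 is the normalisation implied by the
    given coefficients. *)
Definition cell_spec (psi : field) (T0 : {set V}) :=
  exists q, [/\ conforming Omega pos Th q, agrees psi q, mean_free q &
    forall a b c, [set a; b; c]%SET \in Th ->
      cell_moment q a b c = if [set a; b; c]%SET == T0 then -2 else 0].

(* A normal component is affine on an edge, so the sum of its end values is twice
   its integral over the edge. *)
Definition edge_spec (psi : field) (a1 a3 : V) :=
  exists q, [/\ conforming Omega pos Th q, agrees psi q &
    forall T p r, T \in Th -> p \in T -> r \in T -> p != r ->
      (tr (q T) p r).1.1 + (tr (q T) p r).1.2 =
      if (p, r) == (a1, a3) then 2 else if (p, r) == (a3, a1) then -2 else 0].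

Lemma opposite_det a b c c' : [set a; b; c]%SET \in Th ->
  [set a; b; c']%SET \in Th -> c' != c ->
  cross2 (pos b - pos a) (pos c - pos a) * cross2 (pos b - pos a) (pos c' - pos a) < 0.
Proof. by move=> h h' cc'; apply: (opposite_sides tri h h'); rewrite eq_sym. Qed.

Lemma zero_flux_edge_trace E f p r : (forall u v, [set u; v]%SET = E -> zero_flux (tr f u v)) ->
  zero_flux (edge_trace pos E f p r).
Proof.
rewrite /edge_trace => h; case: eqP => [e|_]; first exact: h.
by rewrite /zero_flux /= addr0.
Qed.

Lemma zero_flux_rev q a b : zero_flux (tr q a b) -> zero_flux (tr q b a).
Proof.
rewrite /zero_flux [tr q b a]trace_rev; move: (tr q a b) => t /= h.
by rewrite -opprD addrC h oppr0.
Qed.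

Lemma zero_fluxD (s t : R * R * R) : zero_flux s -> zero_flux t -> zero_flux (s + t).
Proof. by rewrite /zero_flux /= addrACA => -> ->; rewrite addr0. Qed.

Lemma zero_flux_pair a b f p r : zero_flux (tr f a b) ->
  zero_flux (edge_trace pos [set a; b]%SET f p r).
Proof.
move=> h; apply: zero_flux_edge_trace => u v /set2_eq[[-> ->]//|[-> ->]].
exact: zero_flux_rev.
Qed.

Lemma if_addr (W : zmodType) (e : bool) (u v : W) :
  (if e then u + v else 0) = (if e then u else 0) + (if e then v else 0).
Proof. by case: e; rewrite ?addr0. Qed.

Lemma trace_onT_edge a b c T f p r : [set a; b; c]%SET \in Th -> T \in Th ->
  p \in T -> r \in T -> p != r -> tr f a b = 0 -> tr f c a = 0 ->
  tr (onT [set a; b; c]%SET f T) p r =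
  if T == [set a; b; c]%SET then edge_trace pos [set b; c]%SET f p r else 0.
Proof.
move=> h T_Th pT rT pr z1 z2; rewrite (trace_onT tri f h T_Th pT rT pr).
by rewrite (edge_trace0 _ _ z1) (edge_trace0 _ _ z2) add0r addr0.
Qed.

Lemma trace_w_edge_piece (k : R) u v w T p r : [set u; v; w]%SET \in Th -> T \in Th ->
  p \in T -> r \in T -> p != r ->
  let f z := k *: w_edge (pos u) (pos v) (pos w) z in
  tr (onT [set u; v; w]%SET f T) p r =
  if T == [set u; v; w]%SET then edge_trace pos [set v; w]%SET f p r else 0.
Proof.
move=> h T_Th pT rT pr f; have [d0 _ _ _] := cell_dot h.
have [_ z1 z2] := trace_w_edge d0.
have Z p' r' : tr f p' r' = k *: tr (w_edge (pos u) (pos v) (pos w)) p' r' := traceZ _ _ _ _.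
by apply: trace_onT_edge => //; rewrite Z ?z1 ?z2 scaler0.
Qed.

Lemma trace_sum4 (f1 f2 f3 f4 : field) (y z : R * R) :
  trace (fun x => f1 x + f2 x + f3 x + f4 x) y z =
  trace f1 y z + trace f2 y z + trace f3 y z + trace f4 y z.
Proof. by rewrite !traceD. Qed.

Lemma add_pairs3 (W : zmodType) (u1 u2 u3 v1 v2 v3 g1 g2 g3 : W) :
  v1 + u1 = g1 -> v2 + u2 = g2 -> v3 + u3 = g3 ->
  v1 + v2 + v3 + (u3 + u1 + u2) = g1 + g2 + g3.
Proof.
by move=> <- <- <-; rewrite [in RHS](addrACA v1 u1) [RHS]addrACA (addr_rot u3).
Qed.

Lemma P1plus_psi_center (r1 r2 r3 : R) (x1 x2 x3 : R * R) :
  P1plus x1 x2 x3 (psi_center r1 r2 r3 x1 x2 x3).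
Proof.
have e2 : P1plus x1 x2 x3 (w_edge x2 x3 x1).
  by rewrite -P1plus_rot; exact: P1plus_w_edge.
have e3 : P1plus x1 x2 x3 (w_edge x3 x1 x2).
  by rewrite P1plus_rot; exact: P1plus_w_edge.
have v2 : P1plus x1 x2 x3 (w_vert x2 x3 x1).
  by rewrite -P1plus_rot; exact: P1plus_w_vert.
have v3 : P1plus x1 x2 x3 (w_vert x3 x1 x2).
  by rewrite P1plus_rot; exact: P1plus_w_vert.
apply: P1plusZ; apply: P1plusD v3; apply: P1plusD v2.
apply: P1plusD (P1plus_w_vert _ _ _).
apply: P1plusD (P1plusZ _ e3); apply: P1plusD (P1plusZ _ e2).
exact: P1plusZ (P1plus_w_edge _ _ _).
Qed.

(** The weight [E / (E - D)] makes the result independent of [E]: neighbours of different areas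
    induce the same moment on the three edges of the central cell, as [moment_rot] requires. *)
Lemma moment_center q (x1 x2 x3 : R * R) (D E : R) : cross2 (x2 - x1) (x3 - x1) = D ->
  E - D != 0 -> dot2 (x3 - x2) (x3 - x2) != 0 ->
  trace q x2 x3 = (E / (E - D), - (E / (E - D)), dot2 (x3 - x2) (x3 - x2) / (E - D)) ->
  moment q x1 x2 x3 = -2.
Proof. by move=> DE ED L0 t; rewrite /moment t DE /=; field; rewrite L0 ED. Qed.

(** The same trace seen from the neighbour, whose determinant is [E]; there the normal and the
    tangential part cancel. *)
Lemma moment_neighbour q (x1 x2 x3 : R * R) (D E : R) : cross2 (x2 - x1) (x3 - x1) = E ->
  E - D != 0 -> dot2 (x3 - x2) (x3 - x2) != 0 ->
  trace q x2 x3 = (E / (E - D), - (E / (E - D)), dot2 (x3 - x2) (x3 - x2) / (E - D)) ->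
  moment q x1 x2 x3 = 0.
Proof. by move=> DE ED L0 t; rewrite /moment t DE /=; field; rewrite L0 ED. Qed.

Lemma edge_trace_same a b f : edge_trace pos [set a; b]%SET f a b = tr f a b.
Proof. by rewrite /edge_trace eqxx. Qed.

Lemma edge_trace_next a b c f : a != b -> b != c -> a != c ->
  edge_trace pos [set b; c]%SET f a b = 0 /\ edge_trace pos [set c; a]%SET f a b = 0.
Proof.
move=> ab bc ac; rewrite /edge_trace; split; case: eqP => // /setP.
  by move=> /(_ a); rewrite !inE eqxx (negbTE ab) (negbTE ac).
by move=> /(_ b); rewrite !inE eqxx orbT (negbTE bc) eq_sym (negbTE ab).
Qed.

Lemma psi_cellP a1 a2 a3 b1 b2 b3 :
  [set a1; a2; a3]%SET \in Th ->
  [set b1; a2; a3]%SET \in Th /\ b1 != a1 -> [set b2; a3; a1]%SET \in Th /\ b2 != a2 ->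
  [set b3; a1; a2]%SET \in Th /\ b3 != a3 ->
  cell_spec (psi_cell pos a1 a2 a3 b1 b2 b3) [set a1; a2; a3]%SET.
Proof.
move=> h0 [h1 n1] [h2 n2] [h3 n3].
pose E1 := cross2 (pos a3 - pos a2) (pos b1 - pos a2).
pose E2 := cross2 (pos a1 - pos a3) (pos b2 - pos a3).
pose E3 := cross2 (pos a2 - pos a1) (pos b3 - pos a1).
pose D := cross2 (pos a2 - pos a1) (pos a3 - pos a1).
have h0' : [set a2; a3; a1]%SET \in Th by rewrite -set3_rot.
have h0'' : [set a3; a1; a2]%SET \in Th by rewrite set3_rot.
have h1' : [set a2; a3; b1]%SET \in Th by rewrite -set3_rot.
have h2' : [set a3; a1; b2]%SET \in Th by rewrite -set3_rot.
have h3' : [set a1; a2; b3]%SET \in Th by rewrite -set3_rot.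
have D' : cross2 (pos a3 - pos a2) (pos a1 - pos a2) = D := esym (cross2_rot _ _ _).
have D'' : cross2 (pos a1 - pos a3) (pos a2 - pos a3) = D := cross2_rot _ _ _.
have DE1 : D * E1 < 0 by rewrite -D'; exact: opposite_det h0' h1' n1.
have DE2 : D * E2 < 0 by rewrite -D''; exact: opposite_det h0'' h2' n2.
have DE3 : D * E3 < 0 by exact: opposite_det h0 h3' n3.
have DE2' : cross2 (pos a3 - pos a2) (pos a1 - pos a2) * E2 < 0 by rewrite D'.
have DE3' : cross2 (pos a1 - pos a3) (pos a2 - pos a3) * E3 < 0 by rewrite D''.
have [s1 r1] := area_ratio DE1; rewrite -/D -/E1 in s1 r1.
have [s2 r2] := area_ratio DE2'; rewrite D' -/E2 in s2 r2.
have [s3 r3] := area_ratio DE3'; rewrite D'' -/E3 in s3 r3.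
have A2 : area (pos a2) (pos a3) (pos a1) = area (pos a1) (pos a2) (pos a3).
  by rewrite /area D'.
have A3 : area (pos a3) (pos a1) (pos a2) = area (pos a1) (pos a2) (pos a3).
  by rewrite /area D''.
rewrite A2 in s2 r2; rewrite A3 in s3 r3.
pose ra E := (E + 2 * D) / (E - D); pose si E := E / (E - D).
pose f0 := psi_center (ra E1) (ra E2) (ra E3) (pos a1) (pos a2) (pos a3).
pose f1 z := si E1 *: w_edge (pos b1) (pos a2) (pos a3) z.
pose f2 z := si E2 *: w_edge (pos b2) (pos a3) (pos a1) z.
pose f3 z := si E3 *: w_edge (pos b3) (pos a1) (pos a2) z.
have [t1 u1] : tr f0 a2 a3 = tr f1 a2 a3 /\ tr f1 a2 a3 =
    (si E1, - si E1, dot2 (pos a3 - pos a2) (pos a3 - pos a2) / (E1 - D)).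
  exact: psi_center_trace.
have [t2 u2] : tr f0 a3 a1 = tr f2 a3 a1 /\ tr f2 a3 a1 =
    (si E2, - si E2, dot2 (pos a1 - pos a3) (pos a1 - pos a3) / (E2 - D)).
  have := @psi_center_trace R (ra E2) (ra E3) (ra E1) _ _ _ (pos b2) DE2'.
  by rewrite D' -/E2 /f0 (psi_center_rot (ra E1)) => /(_ erefl).
have [t3 u3] : tr f0 a1 a2 = tr f3 a1 a2 /\ tr f3 a1 a2 =
    (si E3, - si E3, dot2 (pos a2 - pos a1) (pos a2 - pos a1) / (E3 - D)).
  have := @psi_center_trace R (ra E3) (ra E1) (ra E2) _ _ _ (pos b3) DE3'.
  by rewrite D'' -/E3 /f0 (psi_center_rot (ra E1)) (psi_center_rot (ra E2)) => /(_ erefl).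
pose q T x := onT [set b1; a2; a3]%SET f1 T x + onT [set b2; a3; a1]%SET f2 T x
  + onT [set b3; a1; a2]%SET f3 T x + onT [set a1; a2; a3]%SET f0 T x.
(* On each edge of the central cell the trace is taken from the neighbour. *)
pose G p r := edge_trace pos [set a2; a3]%SET f1 p r + edge_trace pos [set a3; a1]%SET f2 p r
  + edge_trace pos [set a1; a2]%SET f3 p r.
have qG T p r : T \in Th -> p \in T -> r \in T -> p != r -> tr (q T) p r = G p r.
  move=> T_Th pT rT pr.
  have O1 := trace_w_edge_piece (si E1) h1 T_Th pT rT pr.
  have O2 := trace_w_edge_piece (si E2) h2 T_Th pT rT pr.
  have O3 := trace_w_edge_piece (si E3) h3 T_Th pT rT pr.
  have O4 := trace_onT tri f0 h0 T_Th pT rT pr.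
  have S := trace_sum4 (onT [set b1; a2; a3]%SET f1 T) (onT [set b2; a3; a1]%SET f2 T)
    (onT [set b3; a1; a2]%SET f3 T) (onT [set a1; a2; a3]%SET f0 T) (pos p) (pos r).
  rewrite O1 O2 O3 O4 !if_addr in S.
  rewrite (edge_trace_eq _ _ t1) (edge_trace_eq _ _ t2) (edge_trace_eq _ _ t3) in S.
  have := edge_trace_pair tri f1 h1' h0' n1 T_Th pT rT.
  have := edge_trace_pair tri f2 h2' h0'' n2 T_Th pT rT.
  have := edge_trace_pair tri f3 h3' h0 n3 T_Th pT rT.
  rewrite -(set3_rot a1 a2 a3) (set3_rot a3 a1 a2) -(set3_rot b1 a2 a3) -(set3_rot b2 a3 a1)
    -(set3_rot b3 a1 a2) => P3 P2 P1.
  rewrite /G; apply: (etrans S); apply: add_pairs3 P1 P2 P3.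
have [a12 a23 a13] := cell_uniq tri h0.
have [a21 a32 a31] : [/\ a2 != a1, a3 != a2 & a3 != a1] by split; rewrite eq_sym.
have G23 : G a2 a3 = tr f1 a2 a3.
  have [g1 _] := edge_trace_next f2 a23 a31 a21; have [_ g2] := edge_trace_next f3 a23 a31 a21.
  by rewrite /G edge_trace_same g1 g2 !addr0.
have G31 : G a3 a1 = tr f2 a3 a1.
  have [g1 _] := edge_trace_next f3 a31 a12 a32; have [_ g2] := edge_trace_next f1 a31 a12 a32.
  by rewrite /G edge_trace_same g1 g2 add0r addr0.
have G12 : G a1 a2 = tr f3 a1 a2.
  have [g1 _] := edge_trace_next f1 a12 a23 a13; have [_ g2] := edge_trace_next f2 a12 a23 a13.
  by rewrite /G edge_trace_same g1 g2 !add0r.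
have ED E : D * E < 0 -> E - D != 0.
  by apply: contraTneq => /eqP; rewrite subr_eq0 => /eqP ->; rewrite -leNgt -expr2 sqr_ge0.
have qc : conforming Omega pos Th q.
  apply: (conforming_of_trace _ qG).
    move=> a b c h; apply: P1plusD; first (apply: P1plusD; first apply: P1plusD).
    - by apply: (P1plus_onT tri) => //; exact/P1plusZ/P1plus_w_edge.
    - by apply: (P1plus_onT tri) => //; exact/P1plusZ/P1plus_w_edge.
    - by apply: (P1plus_onT tri) => //; exact/P1plusZ/P1plus_w_edge.
    - by apply: (P1plus_onT tri) => //; exact: P1plus_psi_center.
  move=> p r be; rewrite /G.
  rewrite (edge_trace_boundary tri regular_Omega f1 h1' h0' n1 be).
  rewrite (edge_trace_boundary tri regular_Omega f2 h2' h0'' n2 be).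
  by rewrite (edge_trace_boundary tri regular_Omega f3 h3' h0 n3 be) !addr0.
have qf : mean_free q.
  move=> T p r T_Th pT rT pr; rewrite (qG T p r T_Th pT rT pr).
  apply: zero_fluxD; first apply: zero_fluxD; apply: zero_flux_pair;
    by rewrite /zero_flux ?u1 ?u2 ?u3 /= subrr.
exists q; split => //.
- move=> T x T_Th ix; rewrite /psi_cell s1 s2 s3 r1 r2 r3.
  rewrite (on_cell_onT tri _ h1 T_Th ix) (on_cell_onT tri _ h2 T_Th ix).
  by rewrite (on_cell_onT tri _ h3 T_Th ix) (on_cell_onT tri _ h0 T_Th ix).
- move=> a b c h.
  have [_ _ L1 _] := cell_dot h1; have [_ _ L2 _] := cell_dot h2.
  have [_ _ L3 _] := cell_dot h3.
  have [i1 i2 i3] := cell_mem a1 a2 a3.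
  (* The moment may be read off on any edge. In the central cell and in the three neighbours it is
     computed on an edge shared by two of them; in every other cell the family is 0. *)
  case: (eqVneq [set a; b; c]%SET [set a1; a2; a3]%SET) => [e|ne0].
    rewrite (cell_moment_order qc qf h0 (esym e)).
    by apply: (moment_center _ (ED _ DE1)) => //; rewrite (qG _ _ _ h0) ?G23.
  case: (eqVneq [set a; b; c]%SET [set b1; a2; a3]%SET) => [e|ne1].
    have [_ j2 j3] := cell_mem b1 a2 a3.
    rewrite (cell_moment_order qc qf h1 (esym e)).
    apply: (moment_neighbour _ (ED _ DE1)) => //; first exact: cross2_rot.
    by rewrite (qG _ _ _ h1) ?G23.
  case: (eqVneq [set a; b; c]%SET [set b2; a3; a1]%SET) => [e|ne2].
    have [_ j2 j3] := cell_mem b2 a3 a1.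
    rewrite (cell_moment_order qc qf h2 (esym e)).
    apply: (moment_neighbour _ (ED _ DE2)) => //; first exact: cross2_rot.
    by rewrite (qG _ _ _ h2) ?G31.
  case: (eqVneq [set a; b; c]%SET [set b3; a1; a2]%SET) => [e|ne3].
    have [_ j2 j3] := cell_mem b3 a1 a2.
    rewrite (cell_moment_order qc qf h3 (esym e)).
    apply: (moment_neighbour _ (ED _ DE3)) => //; first exact: cross2_rot.
    by rewrite (qG _ _ _ h3) ?G12.
  have q0 : q [set a; b; c]%SET = fun=> 0.
    apply/funext => x; rewrite /q /onT (negbTE ne0) (negbTE ne1) (negbTE ne2) (negbTE ne3).
    by rewrite !addr0.
  by rewrite /cell_moment q0 /moment trace0 /= !mulr0 mul0r addr0.
Qed.

End psi_specs.

(** * The edge functions as conforming families *)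

Section psi_edge_specs.
Variable R : realType.
Variables (Omega : set (R * R)) (V : finType) (pos : V -> R * R).
Variable Th : {set {set V}}.
Implicit Types (a b c p r u v : V) (T : {set V}) (x y z : R * R).
Hypothesis tri : triangulation Omega pos Th.
Hypothesis regular_Omega : (closure Omega)° = Omega.
Local Notation tr q a b := (trace q (pos a) (pos b)).
Local Notation field := (R * R -> R * R).

Lemma angleC (x y z : R * R) : angle x y z = angle x z y.
Proof.
by rewrite /angle [dist2 x y * _]mulrC; congr (acos (_ / _)); rewrite /dot2 /=; ring.
Qed.

Lemma edge_traceC a b f p r :
  edge_trace pos [set a; b]%SET f p r = edge_trace pos [set b; a]%SET f p r.
Proof. by rewrite finset.setUC. Qed.

Lemma flux_edge_trace a b f p r : a != b -> (tr f a b).1.1 + (tr f a b).1.2 = 2 ->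
  let t := edge_trace pos [set a; b]%SET f p r in
  t.1.1 + t.1.2 = if (p, r) == (a, b) then 2 else if (p, r) == (b, a) then -2 else 0.
Proof.
move=> ab h; rewrite /edge_trace; case: (eqVneq [set p; r]%SET) => [e|ne].
  case: (set2_eq e) => -[-> ->]; first by rewrite eqxx.
  rewrite [tr f b a]trace_rev; move: (tr f a b) h => t h.
  rewrite [(b, a) == (a, b)]xpair_eqE [b == a]eq_sym (negbTE ab) eqxx /=.
  by rewrite -opprD addrC h.
rewrite !xpair_eqE /= addr0; case: eqP => [pa|_]; case: eqP => [rb|_] //=.
- by rewrite pa rb eqxx in ne.
- by case: eqP => // pb; case: eqP => // ra; rewrite pb ra finset.setUC eqxx in ne.
- by case: eqP => // pb; case: eqP => // ra; rewrite pb ra finset.setUC eqxx in ne.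
- by case: eqP => // pb; case: eqP => // ra; rewrite pb ra finset.setUC eqxx in ne.
Qed.

Lemma add_pairs_boundary (x0 x1 y0 y4 z3 z4 g0 g1 g4 : R * R * R) :
  z3 + x1 = g1 -> x0 + y0 = g0 -> z4 + y4 = g4 ->
  x1 + 0 + x0 + (y0 + 0 + y4) + z3 + z4 = g1 + g0 + g4.
Proof. by move=> <- <- <-; apply: pairP => /=; ring. Qed.

Lemma P1plusN (x1 x2 x3 : R * R) (f : field) : P1plus x1 x2 x3 f ->
  P1plus x1 x2 x3 (fun z => - f z).
Proof.
move=> /(P1plusZ (-1)); congr P1plus; apply/funext => z.
by rewrite scaleN1r.
Qed.

Section common.
Variables a1 a2 a3 a4 : V.
Hypotheses (h1 : [set a1; a2; a3]%SET \in Th) (h2 : [set a1; a3; a4]%SET \in Th).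
Hypotheses (o1 : cross2 (pos a3 - pos a1) (pos a2 - pos a1) < 0)
  (o2 : 0 < cross2 (pos a3 - pos a1) (pos a4 - pos a1)).
Let D1 := cross2 (pos a2 - pos a1) (pos a3 - pos a1).
Let D2 := cross2 (pos a3 - pos a1) (pos a4 - pos a1).

Lemma D1_gt0 : 0 < D1.
Proof. by rewrite /D1 cross2C oppr_gt0. Qed.

Lemma rotD : [/\ cross2 (pos a3 - pos a2) (pos a1 - pos a2) = D1,
  cross2 (pos a1 - pos a3) (pos a2 - pos a3) = D1,
  cross2 (pos a4 - pos a3) (pos a1 - pos a3) = D2 &
  cross2 (pos a1 - pos a4) (pos a3 - pos a4) = D2].
Proof.
split; [exact: esym (cross2_rot _ _ _)|exact: cross2_rot|exact: esym (cross2_rot _ _ _)|exact: cross2_rot].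
Qed.

Lemma dists_neq0 : [/\ dist2 (pos a1) (pos a2) != 0, dist2 (pos a2) (pos a3) != 0,
  dist2 (pos a3) (pos a4) != 0, dist2 (pos a4) (pos a1) != 0 & dist2 (pos a1) (pos a3) != 0].
Proof.
have [e1 e2 e3 e4] := rotD.
have D10 : D1 != 0 by rewrite gt_eqF// D1_gt0.
have D20 : D2 != 0 by rewrite gt_eqF.
split; first exact: dist2_neq0 D10.
- by apply: (@dist2_neq0 _ _ _ (pos a1)); rewrite e1.
- by apply: (@dist2_neq0 _ _ _ (pos a1)); rewrite e3.
- by apply: (@dist2_neq0 _ _ _ (pos a3)); rewrite e4.
- exact: dist2_neq0 D20.
Qed.

Lemma sin_sum_A3 : dist2 (pos a2) (pos a3) * dist2 (pos a3) (pos a4) *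
  sin (angle (pos a3) (pos a1) (pos a4) + angle (pos a3) (pos a1) (pos a2)) =
  cross2 (pos a4 - pos a3) (pos a2 - pos a3).
Proof.
have [e1 e2 e3 e4] := rotD; have [n1 n2 n3 n4 n5] := dists_neq0.
rewrite (dist2C (pos a2)) sin_angle_sum ?e2 ?e3 ?D1_gt0//.
by rewrite dist2C.
Qed.

Lemma sin_sum_A1 : dist2 (pos a1) (pos a2) * dist2 (pos a4) (pos a1) *
  sin (angle (pos a1) (pos a2) (pos a3) + angle (pos a1) (pos a3) (pos a4)) =
  cross2 (pos a2 - pos a1) (pos a4 - pos a1).
Proof.
have [e1 e2 e3 e4] := rotD; have [n1 n2 n3 n4 n5] := dists_neq0.
rewrite (dist2C (pos a4)) (angleC _ (pos a2)) [dist2 _ _ * _]mulrC sin_angle_sum//.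
- by rewrite dist2C.
- exact: D1_gt0.
Qed.

Lemma area_T1 : area (pos a1) (pos a2) (pos a3) = D1 / 2.
Proof. exact/norm_pos/D1_gt0. Qed.

Lemma area_T2 : area (pos a1) (pos a3) (pos a4) = D2 / 2.
Proof. exact: norm_pos. Qed.

End common.

(** With [E < 0 < D] the areas are [- E / 2] and [D / 2], so this and the next lemmas translate area
    ratios into the rational coefficients of the trace computations. *)
Lemma half_ratio (D E : R) : E - D != 0 -> (- E / 2) / (- E / 2 + D / 2) = E / (E - D).
Proof. by move=> h; field; rewrite h; apply: contra_neq h => h; lra. Qed.

Lemma half_ratio2 (D E : R) : E - D != 0 ->
  (- E / 2) / (2 * (- E / 2 + D / 2)) = E / (2 * (E - D)).
Proof. by move=> h; field; rewrite h; apply: contra_neq h => h; lra. Qed.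

Lemma half_diff (D E s t u X : R) : D + E != 0 -> s * t * u = X ->
  (1 / 2 * s * t * u - (D / 2 + E / 2)) / (D / 2 + E / 2) = (X - (D + E)) / (D + E).
Proof.
move=> c0 <-; have -> : D / 2 + E / 2 = (D + E) / 2 by field.
by move: (D + E) c0 => F F0; field.
Qed.

Lemma half_diff2 (D E s t u s' t' u' X X' : R) : D + E != 0 ->
  s * t * u = X -> s' * t' * u' = X' ->
  (1 / 2 * s * t * u - 1 / 2 * s' * t' * u') / (2 * (D / 2 + E / 2)) =
  (X - X') / (2 * (D + E)).
Proof.
move=> c0 <- <-; have -> : D / 2 + E / 2 = (D + E) / 2 by field.
by move: (D + E) c0 => F F0; field.
Qed.

Lemma neg_opposite (D E : R) : 0 < D -> D * E < 0 -> E < 0 /\ E - D != 0.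
Proof.
move=> D0; rewrite pmulr_rlt0// => E0; split => //.
by rewrite lt_eqF// subr_lt0 (lt_trans E0).
Qed.

Lemma trace_sum6 (f1 f2 f3 f4 f5 f6 : field) (y z : R * R) :
  trace (fun x => f1 x + f2 x + f3 x + f4 x + f5 x + f6 x) y z =
  trace f1 y z + trace f2 y z + trace f3 y z + trace f4 y z + trace f5 y z + trace f6 y z.
Proof. by rewrite !traceD. Qed.

Lemma add_pairs_interior (x0 x1 x2 y0 y3 y4 z3 z4 z5 z6 g0 g1 g2 g3 g4 : R * R * R) :
  z3 + x1 = g1 -> x0 + y0 = g0 -> z4 + y4 = g4 -> z5 + y3 = g3 -> z6 + x2 = g2 ->
  x1 + x2 + x0 + (y0 + y3 + y4) + z3 + z4 + z5 + z6 = g1 + g0 + g4 + g3 + g2.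
Proof. by move=> <- <- <- <- <-; apply: pairP => /=; ring. Qed.

Lemma trace_onT_cell a b c T f p r : [set a; b; c]%SET \in Th -> T \in Th ->
  p \in T -> r \in T -> p != r ->
  let only E := if T == [set a; b; c]%SET then edge_trace pos E f p r else 0 in
  tr (onT [set a; b; c]%SET f T) p r =
  only [set a; b]%SET + only [set b; c]%SET + only [set c; a]%SET.
Proof.
move=> h T_Th pT rT pr only; rewrite (trace_onT tri f h T_Th pT rT pr) /only.
by case: eqP; rewrite ?addr0.
Qed.

Lemma trace_onT_zero a b (T0 T : {set V}) f p r : tr f a b = 0 ->
  (if T == T0 then edge_trace pos [set a; b]%SET f p r else 0) = 0 :> R * R * R.
Proof. by move=> z; rewrite (edge_trace0 _ _ z) if_same. Qed.

Lemma flux_sum (s t : R * R * R) (k : R) : zero_flux s -> t.1.1 + t.1.2 = k ->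
  (s + t).1.1 + (s + t).1.2 = k.
Proof. by rewrite /zero_flux /= => h <-; rewrite addrACA h add0r. Qed.

Section pieces.
Variables a1 a2 a3 a4 b3 b4 : V.
Hypotheses (h1 : [set a1; a2; a3]%SET \in Th) (h2 : [set a1; a3; a4]%SET \in Th)
  (n24 : a2 != a4).
Hypotheses (h3 : [set b3; a1; a2]%SET \in Th) (n3 : b3 != a3)
  (h4 : [set b4; a4; a1]%SET \in Th) (n4 : b4 != a3).
Variables f1 f2 f3 f4 : field.
Hypotheses (P1 : P1plus (pos a1) (pos a2) (pos a3) f1)
  (P2 : P1plus (pos a1) (pos a3) (pos a4) f2)
  (P3 : P1plus (pos b3) (pos a1) (pos a2) f3)
  (P4 : P1plus (pos b4) (pos a4) (pos a1) f4).
Hypotheses (t12 : tr f1 a1 a2 = tr f3 a1 a2) (t13 : tr f1 a1 a3 = tr f2 a1 a3)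
  (t41 : tr f2 a4 a1 = tr f4 a4 a1).
Hypotheses (z3 : tr f3 b3 a1 = 0 /\ tr f3 a2 b3 = 0)
  (z4 : tr f4 b4 a4 = 0 /\ tr f4 a1 b4 = 0).
Hypotheses (fl12 : zero_flux (tr f3 a1 a2)) (fl41 : zero_flux (tr f4 a4 a1))
  (fl13 : (tr f1 a1 a3).1.1 + (tr f1 a1 a3).1.2 = 2).

Let h3' : [set a1; a2; b3]%SET \in Th. Proof. by rewrite -set3_rot. Qed.
Let h4' : [set a4; a1; b4]%SET \in Th. Proof. by rewrite -set3_rot. Qed.
Let h1' : [set a1; a3; a2]%SET \in Th. Proof. by rewrite set3_swap. Qed.
Let h2' : [set a4; a1; a3]%SET \in Th. Proof. by rewrite set3_rot. Qed.

Lemma pair12 T p r : T \in Th -> p \in T -> r \in T ->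
  (if T == [set b3; a1; a2]%SET then edge_trace pos [set a1; a2]%SET f3 p r else 0) +
  (if T == [set a1; a2; a3]%SET then edge_trace pos [set a1; a2]%SET f1 p r else 0) =
  edge_trace pos [set a1; a2]%SET f3 p r.
Proof.
move=> T_Th pT rT; rewrite (edge_trace_eq _ _ t12) (set3_rot b3).
exact: (edge_trace_pair tri f3 h3' h1 n3).
Qed.

Lemma pair13 T p r : T \in Th -> p \in T -> r \in T ->
  (if T == [set a1; a2; a3]%SET then edge_trace pos [set a3; a1]%SET f1 p r else 0) +
  (if T == [set a1; a3; a4]%SET then edge_trace pos [set a1; a3]%SET f2 p r else 0) =
  edge_trace pos [set a1; a3]%SET f1 p r.
Proof.
move=> T_Th pT rT; rewrite -(edge_trace_eq _ _ t13) edge_traceC (set3_swap a1 a2).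
exact: (edge_trace_pair tri f1 h1' h2 n24).
Qed.

Lemma pair41 T p r : T \in Th -> p \in T -> r \in T ->
  (if T == [set b4; a4; a1]%SET then edge_trace pos [set a4; a1]%SET f4 p r else 0) +
  (if T == [set a1; a3; a4]%SET then edge_trace pos [set a4; a1]%SET f2 p r else 0) =
  edge_trace pos [set a4; a1]%SET f4 p r.
Proof.
move=> T_Th pT rT; rewrite (edge_trace_eq _ _ t41) (set3_rot b4) -(set3_rot a4).
exact: (edge_trace_pair tri f4 h4' h2' n4).
Qed.

Let a13 : a1 != a3. Proof. by case: (cell_uniq tri h1). Qed.

(** The pieces are added as families, so cells that coincide, such as T_3 = T_4, need no separate
    treatment. Each outer edge pairs one outer piece with [f1] or [f2], and the edge [a1 a3] pairs
    [f1] with [f2]. *)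
Lemma edge_spec_interior (b5 b6 : V) (f5 f6 psi : field) :
  [set b5; a3; a4]%SET \in Th -> b5 != a1 -> [set b6; a2; a3]%SET \in Th -> b6 != a1 ->
  P1plus (pos b5) (pos a3) (pos a4) f5 -> P1plus (pos b6) (pos a2) (pos a3) f6 ->
  tr f2 a3 a4 = tr f5 a3 a4 -> tr f1 a2 a3 = tr f6 a2 a3 ->
  tr f5 b5 a3 = 0 /\ tr f5 a4 b5 = 0 -> tr f6 b6 a2 = 0 /\ tr f6 a3 b6 = 0 ->
  zero_flux (tr f5 a3 a4) -> zero_flux (tr f6 a2 a3) ->
  (forall T x, T \in Th -> (hull pos T)° x ->
     psi x = onT [set a1; a2; a3]%SET f1 T x + onT [set a1; a3; a4]%SET f2 T x +
             onT [set b3; a1; a2]%SET f3 T x + onT [set b4; a4; a1]%SET f4 T x +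
             onT [set b5; a3; a4]%SET f5 T x + onT [set b6; a2; a3]%SET f6 T x) ->
  edge_spec Omega pos Th psi a1 a3.
Proof.
move=> h5 n5 h6 n6 P5 P6 t34 t23 z5 z6 fl34 fl23 psiE.
pose q T x := onT [set a1; a2; a3]%SET f1 T x + onT [set a1; a3; a4]%SET f2 T x +
   onT [set b3; a1; a2]%SET f3 T x + onT [set b4; a4; a1]%SET f4 T x +
   onT [set b5; a3; a4]%SET f5 T x + onT [set b6; a2; a3]%SET f6 T x.
pose G p r := edge_trace pos [set a1; a2]%SET f3 p r + edge_trace pos [set a1; a3]%SET f1 p r
  + edge_trace pos [set a4; a1]%SET f4 p r + edge_trace pos [set a3; a4]%SET f5 p r
  + edge_trace pos [set a2; a3]%SET f6 p r.
have h5' : [set a3; a4; b5]%SET \in Th by rewrite -set3_rot.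
have h6' : [set a2; a3; b6]%SET \in Th by rewrite -set3_rot.
have h1s : [set a2; a3; a1]%SET \in Th by rewrite -set3_rot.
have h2s : [set a3; a4; a1]%SET \in Th by rewrite -set3_rot.
have pair34 T p r : T \in Th -> p \in T -> r \in T ->
    (if T == [set b5; a3; a4]%SET then edge_trace pos [set a3; a4]%SET f5 p r else 0) +
    (if T == [set a1; a3; a4]%SET then edge_trace pos [set a3; a4]%SET f2 p r else 0) =
    edge_trace pos [set a3; a4]%SET f5 p r.
  move=> T_Th pT rT; rewrite (edge_trace_eq _ _ t34) (set3_rot b5) (set3_rot a1).
  exact: (edge_trace_pair tri f5 h5' h2s n5).
have pair23 T p r : T \in Th -> p \in T -> r \in T ->
    (if T == [set b6; a2; a3]%SET then edge_trace pos [set a2; a3]%SET f6 p r else 0) +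
    (if T == [set a1; a2; a3]%SET then edge_trace pos [set a2; a3]%SET f1 p r else 0) =
    edge_trace pos [set a2; a3]%SET f6 p r.
  move=> T_Th pT rT; rewrite (edge_trace_eq _ _ t23) (set3_rot b6) (set3_rot a1).
  exact: (edge_trace_pair tri f6 h6' h1s n6).
have qG T p r : T \in Th -> p \in T -> r \in T -> p != r -> tr (q T) p r = G p r.
  move=> T_Th pT rT pr.
  have S := trace_sum6 (onT [set a1; a2; a3]%SET f1 T) (onT [set a1; a3; a4]%SET f2 T)
    (onT [set b3; a1; a2]%SET f3 T) (onT [set b4; a4; a1]%SET f4 T)
    (onT [set b5; a3; a4]%SET f5 T) (onT [set b6; a2; a3]%SET f6 T) (pos p) (pos r).
  have O1 := trace_onT_cell f1 h1 T_Th pT rT pr.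
  have O2 := trace_onT_cell f2 h2 T_Th pT rT pr.
  have O3 := trace_onT_edge tri h3 T_Th pT rT pr z3.1 z3.2.
  have O4 := trace_onT_edge tri h4 T_Th pT rT pr z4.1 z4.2.
  have O5 := trace_onT_edge tri h5 T_Th pT rT pr z5.1 z5.2.
  have O6 := trace_onT_edge tri h6 T_Th pT rT pr z6.1 z6.2.
  rewrite O1 O2 O3 O4 O5 O6 in S; apply: (etrans S).
  exact: add_pairs_interior (pair12 T_Th pT rT) (pair13 T_Th pT rT) (pair41 T_Th pT rT)
    (pair34 T p r T_Th pT rT) (pair23 T p r T_Th pT rT).
exists q; split => //.
  apply: (conforming_of_trace _ qG).
    move=> a b c h; do 5 ?apply: P1plusD; by apply: (P1plus_onT tri).
  move=> p r be; rewrite /G (edge_trace_boundary tri regular_Omega f3 h3' h1 n3 be).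
  rewrite (edge_trace_boundary tri regular_Omega f1 h1' h2 n24 be).
  rewrite (edge_trace_boundary tri regular_Omega f5 h5' h2s n5 be).
  rewrite (edge_trace_boundary tri regular_Omega f6 h6' h1s n6 be).
  by rewrite (edge_trace_boundary tri regular_Omega f4 h4' h2' n4 be) !addr0.
move=> T p r T_Th pT rT pr; rewrite (qG T p r T_Th pT rT pr).
(* The term of [a1 a3], which alone carries flux, is moved to the end. *)
have -> : G p r = edge_trace pos [set a2; a3]%SET f6 p r +
    (edge_trace pos [set a3; a4]%SET f5 p r + (edge_trace pos [set a1; a2]%SET f3 p r +
    (edge_trace pos [set a4; a1]%SET f4 p r + edge_trace pos [set a1; a3]%SET f1 p r))).
  rewrite /G addrC; congr (_ + _); rewrite addrC; congr (_ + _).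
  by rewrite -addrA; congr (_ + _); exact: addrC.
do 4 (apply: flux_sum; first exact: zero_flux_pair).
exact: flux_edge_trace.
Qed.

Lemma edge_spec_boundary (psi : field) : tr f1 a2 a3 = 0 -> tr f2 a3 a4 = 0 ->
  (forall T x, T \in Th -> (hull pos T)° x ->
     psi x = onT [set a1; a2; a3]%SET f1 T x + onT [set a1; a3; a4]%SET f2 T x +
             onT [set b3; a1; a2]%SET f3 T x + onT [set b4; a4; a1]%SET f4 T x) ->
  edge_spec Omega pos Th psi a1 a3.
Proof.
move=> z23 z34 psiE.
pose q T x := onT [set a1; a2; a3]%SET f1 T x + onT [set a1; a3; a4]%SET f2 T x +
   onT [set b3; a1; a2]%SET f3 T x + onT [set b4; a4; a1]%SET f4 T x.
pose G p r := edge_trace pos [set a1; a2]%SET f3 p r + edge_trace pos [set a1; a3]%SET f1 p r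
  + edge_trace pos [set a4; a1]%SET f4 p r.
have qG T p r : T \in Th -> p \in T -> r \in T -> p != r -> tr (q T) p r = G p r.
  move=> T_Th pT rT pr.
  have S := trace_sum4 (onT [set a1; a2; a3]%SET f1 T) (onT [set a1; a3; a4]%SET f2 T)
    (onT [set b3; a1; a2]%SET f3 T) (onT [set b4; a4; a1]%SET f4 T) (pos p) (pos r).
  have O1 := trace_onT_cell f1 h1 T_Th pT rT pr.
  have O2 := trace_onT_cell f2 h2 T_Th pT rT pr.
  have O3 := trace_onT_edge tri h3 T_Th pT rT pr z3.1 z3.2.
  have O4 := trace_onT_edge tri h4 T_Th pT rT pr z4.1 z4.2.
  rewrite /= (trace_onT_zero _ _ _ _ z23) in O1; rewrite /= (trace_onT_zero _ _ _ _ z34) in O2.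
  rewrite O1 O2 O3 O4 in S; apply: (etrans S).
  exact: add_pairs_boundary (pair12 T_Th pT rT) (pair13 T_Th pT rT) (pair41 T_Th pT rT).
exists q; split => //.
  apply: (conforming_of_trace _ qG).
    move=> a b c h; do 3 ?apply: P1plusD; by apply: (P1plus_onT tri).
  move=> p r be; rewrite /G (edge_trace_boundary tri regular_Omega f3 h3' h1 n3 be).
  rewrite (edge_trace_boundary tri regular_Omega f1 h1' h2 n24 be).
  by rewrite (edge_trace_boundary tri regular_Omega f4 h4' h2' n4 be) !addr0.
move=> T p r T_Th pT rT pr; rewrite (qG T p r T_Th pT rT pr).
have -> : G p r = edge_trace pos [set a1; a2]%SET f3 p r +
    (edge_trace pos [set a4; a1]%SET f4 p r + edge_trace pos [set a1; a3]%SET f1 p r).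
  by rewrite /G -addrA; congr (_ + _); exact: addrC.
apply: flux_sum; first exact: zero_flux_pair.
apply: flux_sum; first exact: zero_flux_pair.
exact: flux_edge_trace.
Qed.

End pieces.

Lemma psi_edge_boundaryP a1 a2 a3 a4 b3 b4 :
  [set a1; a2; a3]%SET \in Th -> [set a1; a3; a4]%SET \in Th ->
  cross2 (pos a3 - pos a1) (pos a2 - pos a1) < 0 ->
  0 < cross2 (pos a3 - pos a1) (pos a4 - pos a1) ->
  [set a1; a2; b3]%SET \in Th -> b3 != a3 -> [set a4; a1; b4]%SET \in Th -> b4 != a3 ->
  edge_spec Omega pos Th (psi_edge_boundary pos a1 a2 a3 a4 b3 b4) a1 a3.
Proof.
move=> h1 h2 o1 o2 h3 n3 h4 n4.
have [e1 e2 e3 e4] := rotD a1 a2 a3 a4.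
set D1 := cross2 (pos a2 - pos a1) (pos a3 - pos a1) in e1 e2.
set D2 := cross2 (pos a3 - pos a1) (pos a4 - pos a1) in o2 e3 e4.
have D1_0 : 0 < D1 := D1_gt0 o1.
have h2' : [set a4; a1; a3]%SET \in Th by rewrite set3_rot.
pose D3 := cross2 (pos a2 - pos a1) (pos b3 - pos a1).
pose D4 := cross2 (pos a1 - pos a4) (pos b4 - pos a4).
have [D3_0 D31] : D3 < 0 /\ D3 - D1 != 0 := neg_opposite D1_0 (opposite_det tri h1 h3 n3).
have [D4_0 D42] : D4 < 0 /\ D4 - D2 != 0.
  by apply: (neg_opposite o2); rewrite -e4; exact: (opposite_det tri h2' h4 n4).
have [m1 m2 m3 m4 m5] := dists_neq0 o1 o2.
have [[t12 t13 t41] [t23 t34] [y3 y3' y4 y4'] [z12 z41 fl]] :=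
  boundary_edge_traces D1_0 o2 D3_0 D4_0.
have m1' : dist2 (pos a2) (pos a1) != 0 by rewrite dist2C.
have m3' : dist2 (pos a4) (pos a3) != 0 by rewrite dist2C.
(* From here on cosines, sines and areas are replaced by the rational expressions for which the
   traces were computed. *)
have k1E := cos_angle_proj m1' m2; have k2E := cos_angle_proj m4 m3'.
rewrite (dist2C (pos a1) (pos a4)) (dist2C (pos a4) (pos a3)) in k2E.
have D1_gt := D1_gt0 o1.
have A1 := area_T1 o1; have A2 := area_T2 o2; have A3 := norm_neg D3_0; have A4 := norm_neg D4_0.
have s3E := half_ratio D31; have s4E := half_ratio D42.
have cE : (1 / 2 * dist2 (pos a2) (pos a3) * dist2 (pos a3) (pos a4) *
    sin (angle (pos a3) (pos a1) (pos a4) + angle (pos a3) (pos a1) (pos a2)) -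
    (D1 / 2 + D2 / 2)) / (D1 / 2 + D2 / 2) =
    (cross2 (pos a4 - pos a3) (pos a2 - pos a3) - (D1 + D2)) / (D1 + D2).
  by apply: half_diff (sin_sum_A3 o1 o2); rewrite gt_eqF// addr_gt0.
have n24 : a2 != a4 by apply: contraTneq o1 => ->; rewrite -leNgt ltW.
have h3s : [set b3; a1; a2]%SET \in Th by rewrite set3_rot.
have h4s : [set b4; a4; a1]%SET \in Th by rewrite set3_rot.
apply: (edge_spec_boundary h1 h2 n24 h3s n3 h4s n4 _ _ _ _ t12 t13 t41 (conj y3' y3)
  (conj y4' y4) z12 z41 fl t23 t34).
- apply: P1plusD; first apply: P1plusD; first apply: P1plusD.
  + exact: P1plus_y_vert.
  + exact/P1plusZ/P1plus_w_vert.
  + by apply: P1plusZ; rewrite (P1plus_rot (pos a3)); exact: P1plus_w_edge.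
  + by apply: P1plusZ; rewrite -P1plus_swap (P1plus_rot (pos a2)); exact: P1plus_w_edge.
- apply: P1plusD; first apply: P1plusD; first apply: P1plusD.
  + apply: (P1plusN (P1plus_y_vert _ _ _)).
  + exact/P1plusZ/P1plus_w_vert.
  + by apply: P1plusZ; rewrite -P1plus_rot; exact: P1plus_w_edge.
  + by apply: P1plusZ; rewrite (P1plus_rot (pos a4)); exact: P1plus_w_edge.
- exact/P1plusZ/P1plus_w_edge.
- exact/P1plusZ/P1plus_w_edge.
- move=> T x T_Th ix; rewrite /psi_edge_boundary k1E k2E A1 A2 A3 A4 s3E s4E cE.
  rewrite (on_cell_onT tri _ h1 T_Th ix) (on_cell_onT tri _ h2 T_Th ix).
  rewrite (on_cell_onT tri _ h3 T_Th ix) (on_cell_onT tri _ h4 T_Th ix).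
  by rewrite (set3_rot b3 a1 a2) (set3_rot b4 a4 a1).
Qed.

Lemma psi_edge_interiorP a1 a2 a3 a4 b3 b4 b5 b6 :
  [set a1; a2; a3]%SET \in Th -> [set a1; a3; a4]%SET \in Th ->
  cross2 (pos a3 - pos a1) (pos a2 - pos a1) < 0 ->
  0 < cross2 (pos a3 - pos a1) (pos a4 - pos a1) ->
  [set a1; a2; b3]%SET \in Th -> b3 != a3 -> [set a4; a1; b4]%SET \in Th -> b4 != a3 ->
  [set a3; a4; b5]%SET \in Th -> b5 != a1 -> [set a2; a3; b6]%SET \in Th -> b6 != a1 ->
  edge_spec Omega pos Th (psi_edge_interior pos a1 a2 a3 a4 b3 b4 b5 b6) a1 a3.
Proof.
move=> h1 h2 o1 o2 h3 n3 h4 n4 h5 n5 h6 n6.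
have [e1 e2 e3 e4] := rotD a1 a2 a3 a4.
set D1 := cross2 (pos a2 - pos a1) (pos a3 - pos a1) in e1 e2.
set D2 := cross2 (pos a3 - pos a1) (pos a4 - pos a1) in o2 e3 e4.
have D1_0 : 0 < D1 := D1_gt0 o1.
have h2' : [set a4; a1; a3]%SET \in Th by rewrite set3_rot.
have h2s : [set a3; a4; a1]%SET \in Th by rewrite -set3_rot.
have h1s : [set a2; a3; a1]%SET \in Th by rewrite -set3_rot.
pose D3 := cross2 (pos a2 - pos a1) (pos b3 - pos a1).
pose D4 := cross2 (pos a1 - pos a4) (pos b4 - pos a4).
pose D5 := cross2 (pos a4 - pos a3) (pos b5 - pos a3).
pose D6 := cross2 (pos a3 - pos a2) (pos b6 - pos a2).
have [D3_0 D31] : D3 < 0 /\ D3 - D1 != 0 := neg_opposite D1_0 (opposite_det tri h1 h3 n3).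
have [D4_0 D42] : D4 < 0 /\ D4 - D2 != 0.
  by apply: (neg_opposite o2); rewrite -e4; exact: (opposite_det tri h2' h4 n4).
have [D5_0 D52] : D5 < 0 /\ D5 - D2 != 0.
  by apply: (neg_opposite o2); rewrite -e3; exact: (opposite_det tri h2s h5 n5).
have [D6_0 D61] : D6 < 0 /\ D6 - D1 != 0.
  by apply: (neg_opposite D1_0); rewrite -e1; exact: (opposite_det tri h1s h6 n6).
have [m1 m2 m3 m4 m5] := dists_neq0 o1 o2.
have [[t12 t13 t41 t34 t23] [y3 y3' y4 y4'] [y5 y5' y6 y6'] [z12 z41 z34 z23] fl] :=
  interior_edge_traces D1_0 o2 D3_0 D4_0 D5_0 D6_0.
have m5' : dist2 (pos a3) (pos a1) != 0 by rewrite dist2C.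
have m2' : dist2 (pos a3) (pos a2) != 0 by rewrite dist2C.
have m4' : dist2 (pos a1) (pos a4) != 0 by rewrite dist2C.
have k1E : dist2 (pos a2) (pos a3) * cos (angle (pos a3) (pos a1) (pos a2)) /
    dist2 (pos a1) (pos a3) =
    dot2 (pos a1 - pos a3) (pos a2 - pos a3) / dot2 (pos a3 - pos a1) (pos a3 - pos a1).
  rewrite angleC (dist2C (pos a1)) (cos_angle_proj m2' m5').
  by congr (_ / _); rewrite /dot2 /=; ring.
have k2E : dist2 (pos a4) (pos a1) * cos (angle (pos a1) (pos a3) (pos a4)) /
    dist2 (pos a1) (pos a3) =
    dot2 (pos a4 - pos a1) (pos a3 - pos a1) / dot2 (pos a3 - pos a1) (pos a3 - pos a1).
  by rewrite angleC (cos_angle_proj m4' m5).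
have A1 := area_T1 o1; have A2 := area_T2 o2; have A3 := norm_neg D3_0; have A4 := norm_neg D4_0.
have A5 := norm_neg D5_0; have A6 := norm_neg D6_0.
have s3E := half_ratio2 D31; have s4E := half_ratio2 D42.
have s5E := half_ratio2 D52; have s6E := half_ratio2 D61.
have cE := half_diff2 (lt0r_neq0 (addr_gt0 D1_0 o2)) (sin_sum_A3 o1 o2) (sin_sum_A1 o1 o2).
have n24 : a2 != a4 by apply: contraTneq o1 => ->; rewrite -leNgt ltW.
have h3s : [set b3; a1; a2]%SET \in Th by rewrite set3_rot.
have h4s : [set b4; a4; a1]%SET \in Th by rewrite set3_rot.
have h5s : [set b5; a3; a4]%SET \in Th by rewrite set3_rot.
have h6s : [set b6; a2; a3]%SET \in Th by rewrite set3_rot.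
have PZ x1 x2 x3 k (f : field) : P1plus x1 x2 x3 f -> P1plus x1 x2 x3 (fun z => k *: f z).
  exact: P1plusZ.
apply: (edge_spec_interior h1 h2 n24 h3s n3 h4s n4 _ _ _ _ t12 t13 t41 (conj y3' y3)
  (conj y4' y4) z12 z41 fl h5s n5 h6s n6 _ _ t34 t23 (conj y5' y5) (conj y6' y6) z34 z23).
- do 6 ?[apply: P1plusD]; apply: PZ.
  + by rewrite (P1plus_rot (pos a3)); exact: P1plus_w_edge.
  + exact: P1plus_w_edge.
  + by rewrite -P1plus_swap (P1plus_rot (pos a2)); exact: P1plus_w_edge.
  + by rewrite -P1plus_swap (P1plus_rot (pos a2)); exact: P1plus_w_vert.
  + exact: P1plus_w_vert.
  + by rewrite (P1plus_rot (pos a3)); exact: P1plus_w_vert.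
  + by rewrite -P1plus_swap (P1plus_rot (pos a2)); exact: P1plus_y_vert.
- do 6 ?[apply: P1plusD]; apply: PZ.
  + by rewrite -P1plus_rot; exact: P1plus_w_edge.
  + exact: P1plus_w_edge.
  + by rewrite (P1plus_rot (pos a4)); exact: P1plus_w_edge.
  + by rewrite (P1plus_rot (pos a4)); exact: P1plus_w_vert.
  + exact: P1plus_w_vert.
  + by rewrite -P1plus_swap (P1plus_rot (pos a3)); exact: P1plus_w_vert.
  + by rewrite (P1plus_rot (pos a4)); exact: P1plus_y_vert.
- exact/PZ/P1plus_w_edge.
- exact/PZ/P1plus_w_edge.
- exact/PZ/P1plus_w_edge.
- exact/PZ/P1plus_w_edge.
- move=> T x T_Th ix; rewrite /psi_edge_interior k1E k2E A1 A2 A3 A4 A5 A6 s3E s4E s5E s6E cE.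
  rewrite (on_cell_onT tri _ h1 T_Th ix) (on_cell_onT tri _ h2 T_Th ix).
  rewrite (on_cell_onT tri _ h3 T_Th ix) (on_cell_onT tri _ h4 T_Th ix).
  rewrite (on_cell_onT tri _ h5 T_Th ix) (on_cell_onT tri _ h6 T_Th ix).
  rewrite (set3_rot b3 a1 a2) (set3_rot b4 a4 a1) (set3_rot b5 a3 a4) (set3_rot b6 a2 a3).
  congr (_ + _ + _ + _ + _ + _); rewrite /onT; case: eqP => // _.
  + by rewrite scaleNr scale1r.
  + by rewrite scaleNr scaleN1r.
Qed.

End psi_edge_specs.

(** * Conforming families are combinations of the functions psi *)

Section linear_span.
Variable R : realType.
Implicit Types (A : set (R * R -> R * R)) (v w : R * R -> R * R).

Lemma linear_span0 A : linear_span A (fun=> 0).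
Proof.
exists 0, (fun=> 0), (fun=> fun=> 0); split; first by case.
by apply/funext => x; rewrite big_ord0.
Qed.

Lemma linear_spanD A v w : linear_span A v -> linear_span A w ->
  linear_span A (fun x => v x + w x).
Proof.
move=> [n [k [f [Af ->]]]] [m [l [g [Ag ->]]]].
exists (n + m)%N, (fun i => match fintype.split i with inl j => k j | inr j => l j end),
  (fun i => match fintype.split i with inl j => f j | inr j => g j end).
split; first by move=> i; case: (fintype.split i).
apply/funext => x; rewrite big_split_ord /=; congr (_ + _); apply: eq_bigr => i _.
  by rewrite (unsplitK (inl i)).
by rewrite (unsplitK (inr i)).
Qed.

Lemma linear_spanZ A (c : R) v : linear_span A v -> linear_span A (fun x => c *: v x).
Proof.
move=> [n [k [f [Af ->]]]]; exists n, (fun i => c * k i), f; split => //.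
by apply/funext => x; rewrite scaler_sumr; apply: eq_bigr => i _; rewrite scalerA.
Qed.

Lemma linear_span_sub A v : A v -> linear_span A v.
Proof.
move=> Av; exists 1, (fun=> 1), (fun=> v); split => //.
by apply/funext => x; rewrite big_ord1 scale1r.
Qed.

End linear_span.

Section basis.
Variable R : realType.
Variables (Omega : set (R * R)) (V : finType) (pos : V -> R * R).
Variable Th : {set {set V}}.
Variable start : {set V} -> V.
Implicit Types (a b c p r u v : V) (T E : {set V}) (x y z : R * R).
Hypothesis tri : triangulation Omega pos Th.
Hypothesis regular_Omega : (closure Omega)° = Omega.
Hypothesis open_Omega : open Omega.
Local Notation tr q a b := (trace q (pos a) (pos b)).
Local Notation field := (R * R -> R * R).
Local Notation family := ({set V} -> R * R -> R * R).
Local Notation psis :=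
  (edge_functions Omega pos Th start `|` cell_functions Omega pos Th).
Local Notation conf := (conforming Omega pos Th).

Lemma edge_dichotomy E : edge Th E -> interior_edge Omega pos Th E \/ boundary_edge Omega pos Th E.
Proof.
move=> e; case: (pselect (hull pos E `<=` closure Omega `\` Omega)) => h.
  by right.
by left.
Qed.

Lemma neighbour a b c : interior_edge Omega pos Th [set a; b]%SET ->
  [set a; b; c]%SET \in Th -> exists2 c', [set a; b; c']%SET \in Th & c' != c.
Proof.
move=> ie h; have D0 := cell_det tri h.
have [c' h' s] := interior_edge_side tri open_Omega (0 < det3 pos a b c) ie.
exists c' => //; apply/eqP => c'c; rewrite c'c in s.
case: (boolP (0 < det3 pos a b c)) s => d; first by rewrite expr1 mulN1r; lra.
by rewrite expr0 mul1r (negbTE d).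
Qed.

(** The edges from the interior vertex A_1 are interior, so each has a second cell: this provides
    T_3 and T_4. If A_3 is interior as well, the same argument provides T_5 and T_6. *)
Lemma edge_function_exists E : interior_edge Omega pos Th E ->
  start E \in E /\ interior_vertex Omega pos (start E) ->
  exists a1 a3 psi, [/\ a1 != a3, E = [set a1; a3]%SET,
    edge_functions Omega pos Th start psi & edge_spec Omega pos Th psi a1 a3].
Proof.
move=> ie [sE si]; have [[E2 _] _] := ie.
have [a3 nE a3E] : exists2 a3, start E != a3 & E = [set start E; a3]%SET.
  have /cards1P[a3 h] : #|(E :\ start E)%SET| == 1%N.
    by move: E2; rewrite (cardsD1 (start E)) sE add1n => -[->].
  exists a3; last by have := finset.setD1K sE; rewrite h => /esym.
  have : a3 \in (E :\ start E)%SET by rewrite h set11.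
  by rewrite !inE => /andP[]; rewrite eq_sym.
move Ea1: (start E) sE si nE a3E => a1 sE ia1 n13 EE.
exists a1, a3; rewrite EE in ie sE E2 Ea1.
(* [true] selects the cell to the right of the edge directed from A_1 to A_3, [false] the one to the
   left. *)
have [a2 h1 o1] := interior_edge_side tri open_Omega true ie.
have [a4 h2 o2] := interior_edge_side tri open_Omega false ie.
rewrite expr1 mulN1r oppr_gt0 in o1; rewrite expr0 mul1r in o2.
rewrite set3_swap in h1.
have i12 : interior_edge Omega pos Th [set a1; a2]%SET.
  exact: (interior_vertex_edge ia1 (cell_edge tri h1)).
have h2' : [set a4; a1; a3]%SET \in Th by rewrite set3_rot.
have e14 : edge Th [set a1; a4]%SET by rewrite finset.setUC; exact: (cell_edge tri h2').
have i41 : interior_edge Omega pos Th [set a4; a1]%SET.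
  by rewrite finset.setUC; exact: (interior_vertex_edge ia1 e14).
have [b3 h3 n3] := neighbour i12 h1.
have [b4 h4 n4] := neighbour i41 h2'.
have [ia3|ba3] := pselect (interior_vertex Omega pos a3).
  have h1s : [set a2; a3; a1]%SET \in Th by rewrite -set3_rot.
  have h1' : [set a3; a2; a1]%SET \in Th by rewrite set3_rot set3_swap.
  have h2s : [set a3; a4; a1]%SET \in Th by rewrite -set3_rot.
  have i34 := interior_vertex_edge ia3 (cell_edge tri h2s).
  have i23 : interior_edge Omega pos Th [set a2; a3]%SET.
    by rewrite finset.setUC; exact: (interior_vertex_edge ia3 (cell_edge tri h1')).
  have [b5 h5 n5] := neighbour i34 h2s.
  have [b6 h6 n6] := neighbour i23 h1s.
  exists (psi_edge_interior pos a1 a2 a3 a4 b3 b4 b5 b6); split => //.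
    exists a1, a2, a3, a4, b3, b4; split => //; right; split => //.
    by exists b5, b6.
  exact: psi_edge_interiorP.
(* Being in the closure, a vertex that is not interior is a boundary vertex. *)
have ca3 : closure Omega (pos a3).
  apply: (hull_sub_closure tri h1); apply/(hull_cellE tri _ h1).
  have [[_ _ ->] [_ _ ->] [_ _ ->]] := bary_vertices (cell_det tri h1).
  by split; rewrite ?ler01.
exists (psi_edge_boundary pos a1 a2 a3 a4 b3 b4); split => //; last exact: psi_edge_boundaryP.
by exists a1, a2, a3, a4, b3, b4; split => //; left.
Qed.

Lemma set2_of_card E : #|E| = 2%N -> exists a b, a != b /\ E = [set a; b]%SET.
Proof. by move=> h; have /cards2P[a [b [ab ->]]] : #|E| == 2%N by [rewrite h]; exists a, b. Qed.

Lemma cell_function_exists T : interior_cell Omega pos Th T ->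
  exists2 psi, cell_functions Omega pos Th psi & cell_spec Omega pos Th psi T.
Proof.
move=> [T_Th iT]; have [a1 [a2 [a3 TE]]] := cell_elim tri T_Th.
rewrite TE in T_Th iT *; have [a12 a23 a13] := cell_uniq tri T_Th.
have ie a b : a \in [set a1; a2; a3]%SET -> b \in [set a1; a2; a3]%SET -> a != b ->
    interior_edge Omega pos Th [set a; b]%SET.
  by move=> ha hb ab; apply: iT; [rewrite cards2 ab|rewrite finset.subUset !finset.sub1set ha].
have [i1 i2 i3] := cell_mem a1 a2 a3.
have h2 : [set a2; a3; a1]%SET \in Th by rewrite -set3_rot.
have h3 : [set a3; a1; a2]%SET \in Th by rewrite set3_rot.
have a31 : a3 != a1 by rewrite eq_sym.
have [b1 k1 n1] := neighbour (ie _ _ i2 i3 a23) h2.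
have [b2 k2 n2] := neighbour (ie _ _ i3 i1 a31) h3.
have [b3 k3 n3] := neighbour (ie _ _ i1 i2 a12) T_Th.
rewrite -set3_rot in k1; rewrite -set3_rot in k2; rewrite -set3_rot in k3.
exists (psi_cell pos a1 a2 a3 b1 b2 b3); last exact: psi_cellP.
by exists a1, a2, a3, b1, b2, b3.
Qed.

Lemma edge_functionP psi : edge_functions Omega pos Th start psi ->
  exists2 q, conf q & agrees pos Th psi q.
Proof.
move=> [a1 [a2 [a3 [a4 [b3 [b4 [_ [h1 h2 o1 o2] [h3 n3] [h4 n4]]]]]]]].
suff : edge_spec Omega pos Th psi a1 a3 -> exists2 q, conf q & agrees pos Th psi q.
  move=> S [[_ e]|[_ [b5 [b6 [[h5 n5] [h6 n6] e]]]]]; apply: S; rewrite e.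
    exact: psi_edge_boundaryP.
  exact: psi_edge_interiorP.
by move=> [q [qc qa _]]; exists q.
Qed.

Lemma cell_functionP psi : cell_functions Omega pos Th psi ->
  exists2 q, conf q & agrees pos Th psi q.
Proof.
move=> [a1 [a2 [a3 [b1 [b2 [b3 [[T_Th _] h1 h2 h3 ->]]]]]]].
by have [q [qc qa _ _]] := psi_cellP tri regular_Omega T_Th h1 h2 h3; exists q.
Qed.

Lemma conforming0 : conf (fun _ _ => 0).
Proof. by split => *; rewrite ?trace0//; exact: P1plus0. Qed.

Lemma conformingD q q' : conf q -> conf q' -> conf (fun T x => q T x + q' T x).
Proof.
move=> [P C B] [P' C' B']; split.
- by move=> a b c h; apply: P1plusD; [exact: P|exact: P'].
- move=> T T' a b T_Th T'_Th aT bT aT' bT' ab; rewrite !traceD.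
  by rewrite (C T T')// (C' T T').
- by move=> T a b be T_Th aT bT ab; rewrite traceD (B T)// (B' T)// addr0.
Qed.

Lemma conformingZ (k : R) q : conf q -> conf (fun T x => k *: q T x).
Proof.
move=> [P C B]; split.
- by move=> a b c h; apply: P1plusZ; exact: P.
- by move=> T T' a b T_Th T'_Th aT bT aT' bT' ab; rewrite !traceZ (C T T').
- by move=> T a b be T_Th aT bT ab; rewrite traceZ (B T)// scaler0.
Qed.

Lemma linear_span_conforming (v : field) : linear_span psis v ->
  exists2 q, conf q & agrees pos Th v q.
Proof.
move=> [n [k [f [Af ->]]]]; elim: n k f Af => [|n IH] k f Af.
  by exists (fun _ _ => 0) => [|T x _ _]; [exact: conforming0|rewrite big_ord0].
have [q qc qa] := IH (fun i => k (widen_ord (leqnSn n) i))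
  (fun i => f (widen_ord (leqnSn n) i)) (fun i => Af _).
have [p pc pa] : exists2 q, conf q & agrees pos Th (f ord_max) q.
  by case: (Af ord_max); [exact: edge_functionP|exact: cell_functionP].
exists (fun T x => q T x + k ord_max *: p T x).
  by apply: conformingD => //; exact: conformingZ.
by move=> T x T_Th ix; rewrite big_ord_recr /= (pa T)// -(qa T).
Qed.

(** Linear combinations are tracked as families, so that traces can be computed, alongside the field
    in the span that they represent. *)
Definition spanned (q : family) := conf q /\
  exists2 w : field, linear_span psis w & agrees pos Th w q.

Lemma spanned0 : spanned (fun _ _ => 0).
Proof. by split; [exact: conforming0|exists (fun=> 0) => //; exact: linear_span0]. Qed.

Lemma spannedDZ (k : R) q q' : spanned q -> spanned q' ->
  spanned (fun T x => q T x + k *: q' T x).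
Proof.
move=> [qc [v sv va]] [qc' [v' sv' va']]; split.
  by apply: conformingD => //; exact: conformingZ.
exists (fun x => v x + k *: v' x); first by apply: linear_spanD => //; exact: linear_spanZ.
by move=> T x T_Th ix; rewrite (va T)// (va' T).
Qed.

Lemma traceB (f g : field) (k : R) (y z : R * R) :
  trace (fun x => f x - k *: g x) y z = trace f y z - k *: trace g y z.
Proof.
have -> : (fun x => f x - k *: g x) = (fun x => f x + (- k) *: g x).
  by apply/funext => x; rewrite scaleNr.
by rewrite traceD traceZ scaleNr.
Qed.

Hypothesis startP : forall E, interior_edge Omega pos Th E ->
  start E \in E /\ interior_vertex Omega pos (start E).

(** Induction on a list of edges: subtracting a multiple of psi_e alters the flux through e alone,
    so the edges already treated stay without flux. *)
Lemma remove_flux q (s : seq {set V}) : conf q -> exists2 r, spanned r &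
  forall T a b, T \in Th -> a \in T -> b \in T -> a != b -> [set a; b]%SET \in s ->
    zero_flux (tr (fun x => q T x - r T x) a b).
Proof.
move=> qc; elim: s => [|E s [r rs rz]].
  by exists (fun _ _ => 0); first exact: spanned0.
have [qP qC qB] := qc; have [[rP rC rB] _] := rs.
pose dif T x := q T x - r T x.
have difT T a b : tr (dif T) a b = tr (q T) a b - tr (r T) a b.
  have := traceB (q T) (r T) 1 (pos a) (pos b); rewrite scale1r => <-.
  by congr trace; apply/funext => x; rewrite /dif scale1r.
have [ie|nie] := pselect (interior_edge Omega pos Th E); last first.
  (* A set that is not an interior edge needs no correction: either it is no edge, or it is a
     boundary edge, where all traces vanish. *)
  exists r => // T a b T_Th aT bT ab; rewrite in_cons => /orP[/eqP e|]; last exact: rz.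
  have [|ie|be] := edge_dichotomy (E := E); last 2 first.
  - by [].
  - rewrite -e in be; rewrite -/(dif T) difT.
    by rewrite (qB T)// (rB T)// subrr /zero_flux /= addr0.
  - rewrite -e; have [c TE] := cell_at tri T_Th aT bT ab; rewrite TE in T_Th.
    exact: (cell_edge tri T_Th).
have [a1 [a3 [psi [n13 EE fpsi [p [pc pa pflux]]]]]] := edge_function_exists ie (startP ie).
have ps : spanned p.
  split => //; exists psi => //; apply: linear_span_sub; left; exact: fpsi.
have [[_ [T0 T0_Th]]] := ie; rewrite EE finset.subUset !finset.sub1set => /andP[aT0 bT0] _.
(* The end values of psi_e on its edge sum to 2. By conformity the flux may be measured in any cell
   [T0] containing the edge. *)
pose k := ((tr (dif T0) a1 a3).1.1 + (tr (dif T0) a1 a3).1.2) / 2.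
have kE : k * 2 = (tr (dif T0) a1 a3).1.1 + (tr (dif T0) a1 a3).1.2.
  by rewrite /k divfK// pnatr_eq0.
clearbody k.
exists (fun T x => r T x + k *: p T x); first exact: spannedDZ.
have key T a b : tr (fun x => q T x - (r T x + k *: p T x)) a b =
    tr (dif T) a b - k *: tr (p T) a b.
  by rewrite -traceB; congr trace; apply/funext => x; rewrite /dif opprD addrA.
have flux13 T : T \in Th -> a1 \in T -> a3 \in T ->
    zero_flux (tr (fun x => q T x - (r T x + k *: p T x)) a1 a3).
  move=> T_Th aT bT; have pf := pflux T a1 a3 T_Th aT bT n13.
  rewrite eqxx in pf; rewrite key.
  have -> : tr (dif T) a1 a3 = tr (dif T0) a1 a3.
    by rewrite !difT (qC T T0)// (rC T T0).
  move: (tr (dif T0) a1 a3) (tr (p T) a1 a3) kE pf => t u kE pf.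
  by rewrite /zero_flux /= addrACA -opprD -kE /GRing.scale /= -mulrDr pf subrr.
move=> T a b T_Th aT bT ab; rewrite in_cons.
case: (eqVneq [set a; b]%SET [set a1; a3]%SET) => [e _|ne /= ins].
  case: (set2_eq e) => -[ea eb]; rewrite ea eb in aT bT *.
    exact: flux13.
  by apply: zero_flux_rev; apply: flux13.
have pf := pflux T a b T_Th aT bT ab.
have fl := rz T a b T_Th aT bT ab ins.
rewrite key; rewrite -/(dif T) in fl.
move: (tr (dif T) a b) (tr (p T) a b) fl pf => t u fl.
rewrite !xpair_eqE; case: (eqVneq a a1) => [ea|_] /=.
  case: (eqVneq b a3) => [eb|_] /=; first by rewrite ea eb eqxx in ne.
  rewrite ea (negbTE n13) /= => pf.
  by rewrite /zero_flux /= addrACA fl -opprD /GRing.scale /= -mulrDr pf mulr0 subr0.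
case: (eqVneq a a3) => [ea|_] /=.
  case: (eqVneq b a1) => [eb|_] /=; first by rewrite ea eb finset.setUC eqxx in ne.
  by move=> pf; rewrite /zero_flux /= addrACA fl -opprD /GRing.scale /= -mulrDr pf mulr0 subr0.
by move=> pf; rewrite /zero_flux /= addrACA fl -opprD /GRing.scale /= -mulrDr pf mulr0 subr0.
Qed.

Lemma boundary_moment q T : conf q -> mean_free pos Th q -> T \in Th ->
  ~ interior_cell Omega pos Th T ->
  forall a b c, T = [set a; b; c]%SET -> cell_moment pos q a b c = 0.
Proof.
move=> qc qf T_Th nT a b c TE.
have [E [E2 sE nE]] : exists E : {set V}, [/\ #|E| = 2%N, E \subset T &
    ~ interior_edge Omega pos Th E].
  apply: contrapT => h; apply: nT; split => // E E2 sE; apply: contrapT => nE.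
  by apply: h; exists E.
have [//|bE] : interior_edge Omega pos Th E \/ boundary_edge Omega pos Th E.
  by apply: edge_dichotomy; split => //; exists T.
have [p [r [pr EE]]] := set2_of_card E2.
rewrite EE in bE sE; move: sE; rewrite finset.subUset !finset.sub1set => /andP[pT rT].
have [s Ts] := cell_at tri T_Th pT rT pr; rewrite set3_rot set3_rot in Ts.
have [_ _ qB] := qc.
have spr : [set s; p; r]%SET \in Th by rewrite -Ts.
rewrite (@cell_moment_order _ _ _ _ _ tri q s p r a b c qc qf spr); last by rewrite -Ts.
by rewrite /cell_moment /moment -Ts (qB T)//= !mulr0 mul0r addr0.
Qed.

Lemma spanned_linear (q r : family) : conf q -> spanned r -> conf (fun T x => q T x - r T x).
Proof.
move=> qc [rc _]; have := conformingD qc (conformingZ (-1) rc).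
by congr conforming; apply/funext => T; apply/funext => x; rewrite scaleN1r.
Qed.

(** The functions psi_T carry no flux and have moment 0 outside T, so each correction preserves what
    was achieved before. Cells with a boundary edge need none. *)
Lemma remove_moment q (s : seq {set V}) : conf q -> mean_free pos Th q ->
  exists2 r, spanned r & mean_free pos Th (fun T x => q T x - r T x) /\
    forall a b c, [set a; b; c]%SET \in Th -> [set a; b; c]%SET \in s ->
      cell_moment pos (fun T x => q T x - r T x) a b c = 0.
Proof.
move=> qc qf; elim: s => [|T0 s [r rs [rf rz]]].
  exists (fun _ _ => 0); first exact: spanned0.
  by split => //; under eq_fun do under eq_fun do rewrite subr0.
have rc := spanned_linear qc rs.
have [iT|nT] := pselect (interior_cell Omega pos Th T0); last first.
  exists r => //; split => // a b c h; rewrite in_cons => /orP[/eqP e|]; last exact: rz.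
  by apply: (boundary_moment rc rf _ nT); rewrite -e.
have [psi fpsi [p [pc pa pf pm]]] := cell_function_exists iT.
have ps : spanned p.
  split => //; exists psi => //; apply: linear_span_sub; right; exact: fpsi.
have [a0 [b0 [c0 TE]]] := cell_elim tri iT.1.
(* The divisor is the moment of psi_T on its own cell. *)
pose k := cell_moment pos (fun T x => q T x - r T x) a0 b0 c0 / (-2).
exists (fun T x => r T x + k *: p T x); first exact: spannedDZ.
have key T a b : tr (fun x => q T x - (r T x + k *: p T x)) a b =
    tr (fun x => q T x - r T x) a b - k *: tr (p T) a b.
  by rewrite -traceB; congr trace; apply/funext => x; rewrite opprD addrA.
have f' : mean_free pos Th (fun T x => q T x - (r T x + k *: p T x)).
  move=> T a b T_Th aT bT ab; rewrite key.
  have := rf T a b T_Th aT bT ab; have := pf T a b T_Th aT bT ab.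
  move: (tr (p T) a b) (tr (fun x => q T x - r T x) a b) => t u ht hu.
  by rewrite /zero_flux /= addrACA hu -opprD /GRing.scale /= -mulrDr ht mulr0 subr0.
have mk a b c : cell_moment pos (fun T x => q T x - (r T x + k *: p T x)) a b c =
    cell_moment pos (fun T x => q T x - r T x) a b c - k * cell_moment pos p a b c.
  rewrite /cell_moment /moment key.
  move: (trace (fun x => q _ x - _) _ _) (trace (p _) _ _) => t u /=.
  rewrite /GRing.scale /=; ring.
split => // a b c h; rewrite in_cons mk (pm _ _ _ h).
case: eqP => [e _|_ /= ins]; last by rewrite (rz a b c h ins) mulr0 subrr.
have e' : [set a0; b0; c0]%SET = [set a; b; c]%SET by rewrite -TE e.
rewrite (cell_moment_order tri rc rf _ e'); last by rewrite e'.
rewrite /k divfK ?subrr// oppr_eq0; lra.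
Qed.

Lemma moment_free_zero q : conf q -> mean_free pos Th q ->
  (forall a b c, [set a; b; c]%SET \in Th -> cell_moment pos q a b c = 0) ->
  forall T, T \in Th -> forall x, q T x = 0.
Proof.
move=> qc qf qm T T_Th; have [qP qC qB] := qc.
have tz a b c : [set a; b; c]%SET \in Th -> tr (q [set a; b; c]%SET) a b = 0.
  move=> h; have [ab bc ac] := cell_uniq tri h; have [ia ib ic] := cell_mem a b c.
  have [ie|be] := edge_dichotomy (cell_edge tri h); last exact: (qB _ a b be h).
  have [c' h' nc] := neighbour ie h.
  have [ia' ib' _] := cell_mem a b c'.
  have hs : [set c; a; b]%SET \in Th by rewrite set3_rot.
  have hs' : [set c'; a; b]%SET \in Th by rewrite set3_rot.
  have DD := opposite_det tri h h' nc.
  have [_ L0 _ _] := cell_dot tri h.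
  have m1 := qm _ _ _ hs; have m2 := qm _ _ _ hs'.
  rewrite /cell_moment /moment set3_rot cross2_rot in m1.
  rewrite /cell_moment /moment set3_rot cross2_rot in m2.
  rewrite -(qC _ _ a b h h' ia ib ia' ib' ab) in m2.
  have := qf _ a b h ia ib ab; move: m1 m2.
  move: (tr (q [set a; b; c]%SET) a b) => t m1 m2 fl.
  set D := cross2 _ _ in DD m1; set D' := cross2 _ _ in DD m2.
  set L := dot2 _ _ in L0 m1 m2.
  have DD0 : D - D' != 0.
    apply: contraTneq DD => /eqP; rewrite subr_eq0 => /eqP ->.
    by rewrite -leNgt -expr2 sqr_ge0.
  have t2 : t.2 = 0.
    (* The difference of the two moments no longer contains the normal value, and [D] and [D']
       differ because their product is negative. *)
    have : (D - D') * t.2 = 0.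
      have -> : (D - D') * t.2 = L / 2 * ((2 * t.1.2 + 2 * D * t.2 / L) -
        (2 * t.1.2 + 2 * D' * t.2 / L)) by field.
      by rewrite m1 m2 subrr mulr0.
    by move/eqP; rewrite mulf_eq0 (negbTE DD0) => /eqP.
  have t12 : t.1.2 = 0 by move: m1; rewrite t2 mulr0 mul0r addr0; lra.
  have t11 : t.1.1 = 0 by move: fl; rewrite /zero_flux t12 addr0.
  exact: pairP.
have [a [b [c TE]]] := cell_elim tri T_Th; rewrite TE in T_Th *.
have [D0 _ L0 _] := cell_dot tri T_Th.
have h2 : [set b; c; a]%SET \in Th by rewrite -set3_rot.
have h3 : [set c; a; b]%SET \in Th by rewrite set3_rot.
apply: (P1plus_unisolvent D0 L0 (qP a b c T_Th) (tz a b c T_Th)).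
  by rewrite set3_rot; exact: tz h2.
by rewrite -set3_rot; exact: tz h3.
Qed.

Lemma conforming_linear_span q : conf q ->
  exists2 w : field, linear_span psis w & agrees pos Th w q.
Proof.
(* All subsets of vertices are enumerated; those that are not edges, or below not cells, are
   harmless. *)
move=> qc; have [r1 s1 f1] := remove_flux (enum {set V}) qc.
have qc1 := spanned_linear qc s1.
have qf1 : mean_free pos Th (fun T x => q T x - r1 T x).
  by move=> T a b T_Th aT bT ab; apply: f1; rewrite ?mem_enum.
have [r2 s2 [f2 m2]] := remove_moment (enum {set V}) qc1 qf1.
have qc2 := spanned_linear qc1 s2.
have q0 := moment_free_zero qc2 f2 (fun a b c h => m2 a b c h (mem_enum _ _)).
have [_ [w ws wa]] := spannedDZ 1 s1 s2; exists w => // T x T_Th ix.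
rewrite (wa T)// scale1r.
by have := q0 T T_Th x; rewrite -addrA -opprD => /subr0_eq ->.
Qed.

End basis.

(** * Conforming families and H_0(div) *)

Section cell_green.
Variable R : realType.
Implicit Types (a b c x : R * R) (q : R * R -> R * R).
Local Notation mR2 := (measurableTypeR R * measurableTypeR R)%type.
Local Notation area2 := (@lebesgue_measure R \x @lebesgue_measure R)%E.

Definition div2 q x := dx (fun z => (q z).1) x + dy (fun z => (q z).2) x.

(** The terms with [k] are the components of the curl of l1 l2 l3, written out so that only first
    derivatives of affine functions occur. A curl has no divergence, so that of the affine part is
    left, a constant. *)
Lemma affine_products_div (f g l1 l2 l3 : R * R -> R) (k f0 f1 f2 g0 g1 g2 a0 a1 a2 b0 b1 b2 c0 c1 c2 : R) :
  (forall z, f z = f0 + f1 * z.1 + f2 * z.2) -> (forall z, g z = g0 + g1 * z.1 + g2 * z.2) ->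
  (forall z, l1 z = a0 + a1 * z.1 + a2 * z.2) -> (forall z, l2 z = b0 + b1 * z.1 + b2 * z.2) ->
  (forall z, l3 z = c0 + c1 * z.1 + c2 * z.2) ->
  let F := fun z => f z + k * (a2 * (l2 z * l3 z) + b2 * (l3 z * l1 z) + c2 * (l1 z * l2 z)) in
  let G := fun z => g z + - k * (a1 * (l2 z * l3 z) + b1 * (l3 z * l1 z) + c1 * (l1 z * l2 z)) in
  [/\ C1 F, C1 G & forall x, dx F x + dy G x = f1 + g2].
Proof.
move=> fE gE l1E l2E l3E F G.
have Cf : C1 f by apply: C1_affine; exists f0, f1, f2.
have Cg : C1 g by apply: C1_affine; exists g0, g1, g2.
have Ca : C1 l1 by apply: C1_affine; exists a0, a1, a2.
have Cb : C1 l2 by apply: C1_affine; exists b0, b1, b2.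
have Cc : C1 l3 by apply: C1_affine; exists c0, c1, c2.
have Cbc := C1_mul Cb Cc; have Cca := C1_mul Cc Ca; have Cab := C1_mul Ca Cb.
have CC (s : R) h : C1 h -> C1 (fun z => s * h z) by exact/C1_mul/C1_cst.
have DC (s : R) h x v : C1 h -> 'D_v (fun z => s * h z) x = s * 'D_v h x.
  move=> Ch; rewrite (derive_mulf _ _ (C1_cst s) Ch) (_ : 'D_v (fun=> s) x = 0) ?mulr0 ?addr0//.
  exact: derive_cst.
have CS s t u : C1 (fun z => s * (l2 z * l3 z) + t * (l3 z * l1 z) + u * (l1 z * l2 z)).
  by apply: C1_add; [apply: C1_add|]; exact: CC.
have DS s t u x v : 'D_v (fun z => s * (l2 z * l3 z) + t * (l3 z * l1 z) + u * (l1 z * l2 z)) x =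
    s * (l2 x * 'D_v l3 x + l3 x * 'D_v l2 x) + t * (l3 x * 'D_v l1 x + l1 x * 'D_v l3 x)
    + u * (l1 x * 'D_v l2 x + l2 x * 'D_v l1 x).
  rewrite (derive_addf _ _ (C1_add (CC s _ Cbc) (CC t _ Cca)) (CC u _ Cab)).
  rewrite (derive_addf _ _ (CC s _ Cbc) (CC t _ Cca)) !DC//.
  by rewrite (derive_mulf _ _ Cb Cc) (derive_mulf _ _ Cc Ca) (derive_mulf _ _ Ca Cb).
split; [exact: C1_add Cf (CC _ _ (CS _ _ _))|exact: C1_add Cg (CC _ _ (CS _ _ _))|].
move=> x; rewrite /dx /dy (derive_addf _ _ Cf (CC _ _ (CS _ _ _))).
rewrite (derive_addf _ _ Cg (CC _ _ (CS _ _ _))) !(DC _ _ _ _ (CS _ _ _)) !DS.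
rewrite !(derive_affine _ _ fE) !(derive_affine _ _ gE) !(derive_affine _ _ l1E).
rewrite !(derive_affine _ _ l2E) !(derive_affine _ _ l3E) /=; ring.
Qed.

Lemma bary_coef a b c : exists k0 k1 k2, curl_bary a b c = (k2, - k1) /\
  forall z, bary a b c z = k0 + k1 * z.1 + k2 * z.2.
Proof.
have [k0 [k1 [k2 E]]] := bary_affine a b c; exists k0, k1, k2; split => //.
rewrite -(curl_baryE _ _ _ 0) /curl /dx /dy !(derive_affine _ _ E) /=.
by rewrite !mulr0 !mulr1 add0r addr0.
Qed.

Lemma P1plus_C1 a b c q : P1plus a b c q ->
  [/\ C1 (fun z => (q z).1), C1 (fun z => (q z).2) & forall x, div2 q x = div2 q 0].
Proof.
move=> [f [g [k [[f0 [f1 [f2 fE]]] [g0 [g1 [g2 gE]]] qE]]]].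
have [a0 [a1 [a2 [ca aE]]]] := bary_coef a b c.
have [b0 [b1 [b2 [cb bE]]]] := bary_coef b c a.
have [c0 [c1 [c2 [cc cE]]]] := bary_coef c a b.
have [C1F C1G D] := affine_products_div k fE gE aE bE cE.
have q1 : (fun z => (q z).1) = (fun z => f z + k * (a2 * (bary b c a z * bary c a b z) +
     b2 * (bary c a b z * bary a b c z) + c2 * (bary a b c z * bary b c a z))).
  apply/funext => z; rewrite qE -[curl _ z]/(curl (bubble a b c) z) curl_bubble ca cb cc /=.
  by rewrite /GRing.scale /= /GRing.scale /=; ring.
have q2 : (fun z => (q z).2) = (fun z => g z + - k * (a1 * (bary b c a z * bary c a b z) +
     b1 * (bary c a b z * bary a b c z) + c1 * (bary a b c z * bary b c a z))).
  apply/funext => z; rewrite qE -[curl _ z]/(curl (bubble a b c) z) curl_bubble ca cb cc /=.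
  by rewrite /GRing.scale /= /GRing.scale /=; ring.
by rewrite /div2 q1 q2; split => // x; rewrite !D.
Qed.

Lemma C1_dot_grad (F G phi : R * R -> R) x : C1 F -> C1 G -> C1 phi ->
  dx (fun z => phi z * F z) x + dy (fun z => phi z * G z) x =
  dot2 (F x, G x) (grad phi x) + (dx F x + dy G x) * phi x.
Proof.
move=> CF CG Cp; rewrite /dx /dy !derive_mulf// /dot2 /grad /dx /dy /=; ring.
Qed.

Lemma P1plus_continuous a b c q (phi : R * R -> R) : P1plus a b c q -> C1 phi ->
  continuous (fun x => dot2 (q x) (grad phi x) + div2 q 0 * phi x).
Proof.
move=> /P1plus_C1[C1F C1G _] Cp; have [_ px py] := Cp; have pc := C1_continuous Cp.
have Fc := C1_continuous C1F; have Gc := C1_continuous C1G.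
move=> x; apply: cvgD; last by apply: cvgM; [exact: cvg_cst|exact: pc].
by apply: cvgD; apply: cvgM; [exact: Fc|exact: px|exact: Gc|exact: py].
Qed.

(** The divergence theorem applied to [phi] times [q]. The divergence of [q] is constant, so its
    value at 0 stands for all of them. *)
Lemma green_cell a b c q (phi : R * R -> R) : cross2 (b - a) (c - a) != 0 ->
  P1plus a b c q -> C1 phi ->
  let flux p r := seg_int (fun x => phi x * cross2 (r - p) (q x)) p r in
  (\int[area2]_(x in open_tri a b c) (dot2 (q x) (grad phi x) + div2 q 0 * phi x) =
   - Num.sg (cross2 (b - a) (c - a)) * (flux a b + flux b c + flux c a))%R.
Proof.
move=> D0 /P1plus_C1[C1F C1G D] Cp flux.
have := green_tri (C1_mul Cp C1F) (C1_mul Cp C1G) D0; rewrite /=.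
have fE p r : seg_int (fun x => cross2 (r - p) (phi x * (q x).1, phi x * (q x).2)) p r = flux p r.
  by congr seg_int; apply/funext => x; rewrite /cross2 /=; ring.
rewrite !fE => <-; apply: eq_Rintegral => x _.
rewrite (C1_dot_grad _ C1F C1G Cp) -[dx _ x + dy _ x]/(div2 q x) D.
by rewrite -surjective_pairing.
Qed.

End cell_green.

(** * Integrals of functions equal almost everywhere *)

Section ae_integral.
Context d (T : measurableType d) (R : realType) (mu : {measure set T -> \bar R}).
Local Open Scope ereal_scope.

(** Measurability of [f] is a hypothesis, since equality almost everywhere does not transfer it when
    the measure is not complete. *)
Lemma ae_eq_integrable (D : set T) (f g : T -> R) : measurable D -> measurable_fun D f ->
  mu.-integrable D (EFin \o g) -> f = g %[ae mu in D] ->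
  mu.-integrable D (EFin \o f) /\
  (\int[mu]_(x in D) f x = \int[mu]_(x in D) g x)%R.
Proof.
move=> mD mf ig fg; have [mg gfin] := integrableP _ _ _ ig.
have mf' : measurable_fun D (EFin \o f) by exact/measurable_EFinP.
have e1 : EFin \o f = EFin \o g %[ae mu in D].
  by apply: filterS fg => x h Dx /=; rewrite h.
split; last by congr fine; exact: ae_eq_integral.
apply/integrableP; split => //; rewrite (le_lt_trans _ gfin)//.
rewrite le_eqVlt; apply/orP; left; apply/eqP; apply: ge0_ae_eq_integral => //.
- exact: measurableT_comp.
- exact: measurableT_comp.
- by apply: filterS fg => x h Dx /=; rewrite h.
Qed.

Lemma Rintegral_sum (I : Type) (s : seq I) (P : pred I) (F : I -> T -> R) (D : set T) :
  measurable D -> (forall i, P i -> mu.-integrable D (EFin \o F i)) ->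
  mu.-integrable D (EFin \o (fun x => (\sum_(i <- s | P i) F i x)%R)) /\
  (\int[mu]_(x in D) (\sum_(i <- s | P i) F i x) =
   \sum_(i <- s | P i) \int[mu]_(x in D) F i x)%R.
Proof.
move=> mD iF; elim: s => [|i s [IH1 IH2]].
  rewrite big_nil.
  have -> : (fun x => (\sum_(i <- [::] | P i) F i x)%R) = cst 0%R.
    by apply/funext => x; rewrite big_nil.
  split; last by rewrite (Rintegral_cst mu mD 0) mul0r.
  by have := integrable0 mu D.
rewrite big_cons; case: ifP => Pi; last first.
  have -> // : (fun x => (\sum_(j <- i :: s | P j) F j x)%R) =
      (fun x => (\sum_(j <- s | P j) F j x)%R).
  by apply/funext => x; rewrite big_cons Pi.
have -> : (fun x => (\sum_(j <- i :: s | P j) F j x)%R) =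
    (fun x => (F i x + \sum_(j <- s | P j) F j x)%R).
  by apply/funext => x; rewrite big_cons Pi.
split; last by rewrite RintegralD//; [rewrite IH2|exact: iF].
exact: (integrableD mD (iF i Pi) IH1).
Qed.

End ae_integral.

#[local] Instance area2_ae_filter (R : realType) :
  Filter (almost_everywhere (@lebesgue_measure R \x @lebesgue_measure R)%E).
Proof. exact: ae_filter_ringOfSetsType. Qed.

(** * Integrals over the domain as sums over cells *)

Section cells.
Variable R : realType.
Variables (Omega : set (R * R)) (V : finType) (pos : V -> R * R).
Variable Th : {set {set V}}.
Implicit Types (a b c p r u v : V) (T E : {set V}) (x y z : R * R).
Hypothesis tri : triangulation Omega pos Th.
Hypothesis regular_Omega : (closure Omega)° = Omega.
Hypothesis open_Omega : open Omega.
Local Notation mR2 := (measurableTypeR R * measurableTypeR R)%type.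
Local Notation area2 := (@lebesgue_measure R \x @lebesgue_measure R)%E.

(** Whole lines through two vertices rather than the edges: the set is larger, but still null, and
    is described by equations alone. *)
Definition skeleton : set (R * R) :=
  [set x | exists b c, b != c /\ cross2 (pos c - pos b) (x - pos b) = 0].

Lemma skeleton_negligible : area2.-negligible (skeleton : set mR2).
Proof.
have [inj _ _ _ _] := tri.
pose L (p : V * V) : set (R * R) :=
  [set x | p.1 != p.2 /\ cross2 (pos p.2 - pos p.1) (x - pos p.1) = 0].
have negL (p : V * V) : area2.-negligible (L p : set mR2).
  case: (eqVneq p.1 p.2) => [e|ne].
    apply: (@negligibleS _ _ _ _ set0); last exact: negligible_set0.
    by move=> x [/=]; rewrite e eqxx.
  pose l := [set x | cross2 (pos p.2 - pos p.1) (x - pos p.1) = 0].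
  have l0 : area2 (l : set mR2) = 0%E.
    apply: line_null; rewrite subr_eq0; apply: contra_neq ne => /inj.
    by move->.
  apply: (@negligibleS _ _ _ _ (l : set mR2)) => [x []//|].
  apply/negligibleP => //.
  have lc : continuous (fun x => cross2 (pos p.2 - pos p.1) (x - pos p.1)).
    apply: affine2_continuous.
    set u := pos p.2 - pos p.1; set w := pos p.1.
    exists (- cross2 u w), (- u.2), u.1 => x; rewrite /cross2 /=; ring.
  have -> : l = (fun x => cross2 (pos p.2 - pos p.1) (x - pos p.1)) @^-1` [set 0] by [].
  rewrite -[X in measurable X]setTI; apply: (continuous_measurable2 lc) => //.
apply: (@negligibleS _ _ _ _ (\big[setU/set0]_(p : V * V) (L p : set mR2))).
  move=> x [b [c [bc h]]]; rewrite (bigD1 (b, c))//=; left; split => //.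
by elim/big_ind: _ => //; [exact: negligible_set0|exact: negligibleU].
Qed.

Lemma skeletonP T x : T \in Th -> hull pos T x -> ~ skeleton x -> (hull pos T)° x.
Proof.
move=> T_Th hx ns; have [a [b [c TE]]] := cell_elim tri T_Th; rewrite TE in T_Th hx *.
rewrite (interior_cell_hull tri T_Th).
have [la lb lc] := (hull_cellE tri x T_Th).1 hx.
have [ab bc ac] := cell_uniq tri T_Th.
have pos_bary u v w : v != w -> det3 pos u v w != 0 -> 0 <= bary (pos u) (pos v) (pos w) x ->
    0 < bary (pos u) (pos v) (pos w) x.
  move=> vw D0 l0; rewrite lt_neqAle l0 andbT; apply/eqP => /esym e; apply: ns.
  exists v, w; split => //.
  by move: e; rewrite baryE => /eqP; rewrite mulf_eq0 invr_eq0 (negbTE D0) orbF => /eqP.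
have D0 := cell_det tri T_Th.
have Db : det3 pos b c a != 0 by rewrite det3_rot.
have Dc : det3 pos c a b != 0 by rewrite det3_rot.
split; [exact: (pos_bary a b c bc D0 la)| |exact: (pos_bary c a b ab Dc lc)].
by apply: (pos_bary b c a _ Db lb); rewrite eq_sym.
Qed.

Lemma cell_interior_sub T : T \in Th -> (hull pos T)° `<=` Omega.
Proof.
move=> T_Th; have [a [b [c TE]]] := cell_elim tri T_Th; rewrite TE in T_Th *.
by rewrite (interior_cell_hull tri T_Th); exact: (cell_subset_Omega tri regular_Omega T_Th).
Qed.

Lemma cell_interior_uniq T T' x : T \in Th -> T' \in Th ->
  (hull pos T)° x -> (hull pos T')° x -> T = T'.
Proof.
move=> T_Th T'_Th; have [a [b [c TE]]] := cell_elim tri T_Th; rewrite TE in T_Th *.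
rewrite (interior_cell_hull tri T_Th) => ix /interior_subset hx.
by rewrite (open_cell_meet tri T_Th T'_Th ix hx).
Qed.

Definition piecewise (h : {set V} -> R * R -> R) x :=
  \sum_(T in Th) ((h T) \_ ((hull pos T)°)) x.

Lemma piecewise_cell h T x : T \in Th -> (hull pos T)° x -> piecewise h x = h T x.
Proof.
move=> T_Th ix; rewrite /piecewise (bigD1 T)//= patchE mem_set// big1 ?addr0//.
move=> T' /andP[T'_Th]; apply: contraNeq; rewrite patchE; case: ifPn; rewrite ?eqxx// inE => ix' _.
by rewrite (cell_interior_uniq T_Th T'_Th ix ix').
Qed.

Lemma Omega_ae_cell (P : R * R -> Prop) :
  (forall T x, T \in Th -> (hull pos T)° x -> P x) ->
  \forall x \ae area2, Omega x -> P x.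
Proof.
move=> h; apply: negligibleS skeleton_negligible => x /= n.
apply: contrapT => ns; apply: n => Ox; have [T T_Th hx] := Omega_cover tri Ox.
exact: h T_Th (skeletonP T_Th hx ns).
Qed.

Lemma integrable_cell T (f : R * R -> R) : T \in Th -> continuous f ->
  area2.-integrable ((hull pos T)° : set mR2) (EFin \o f).
Proof.
move=> T_Th fc; have [a [b [c TE]]] := cell_elim tri T_Th; rewrite TE in T_Th *.
by rewrite (interior_cell_hull tri T_Th); exact: integrable_tri.
Qed.

Lemma piecewise_integrable h : (forall T, T \in Th -> continuous (h T)) ->
  area2.-integrable (Omega : set mR2) (EFin \o piecewise h) /\
  (\int[area2]_(x in Omega) piecewise h x =
   \sum_(T in Th) \int[area2]_(x in (hull pos T)°) h T x)%R.
Proof.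
move=> hc; have mO : measurable (Omega : set mR2) by exact: open_measurable2.
have mi T : measurable ((hull pos T)° : set mR2).
  by apply: open_measurable2; exact: open_interior.
have key T : T \in Th -> area2.-integrable (Omega : set mR2)
    (EFin \o (h T \_ (hull pos T)°)) /\
    (\int[area2]_(x in Omega) (h T \_ (hull pos T)°) x =
     \int[area2]_(x in (hull pos T)°) h T x)%R.
  move=> T_Th; have sO : (hull pos T)° `&` Omega = (hull pos T)°.
    by apply: setIidl; exact: cell_interior_sub.
  have it := integrable_cell T_Th (hc T T_Th).
  split; last by rewrite -Rintegral_mkcondl sO.
  have := (integrable_mkcond _ (mi T)).1 it.
  rewrite restrict_EFin => iT; exact: (integrableS measurableT).
have piE : piecewise h = fun x => \sum_(T in Th) (h T \_ (hull pos T)°) x by [].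
rewrite piE.
have [i1 ->] := Rintegral_sum (index_enum {set V}) mO (fun T h => (key T h).1).
by split => //; apply: eq_bigr => T T_Th; exact: (key T T_Th).2.
Qed.

(** Off the null set [skeleton] every point of [Omega] is interior to exactly one cell, so [f]
    equals the piecewise function almost everywhere. *)
Lemma integral_cells (f : R * R -> R) h : measurable_fun (Omega : set mR2) f ->
  (forall T, T \in Th -> continuous (h T)) ->
  (\forall x \ae area2, Omega x -> forall T, T \in Th -> (hull pos T)° x -> f x = h T x) ->
  area2.-integrable (Omega : set mR2) (EFin \o f) /\
  (\int[area2]_(x in Omega) f x =
   \sum_(T in Th) \int[area2]_(x in (hull pos T)°) h T x)%R.
Proof.
move=> mf hc fh; have [ip <-] := piecewise_integrable hc.
apply: ae_eq_integrable => //; first exact: open_measurable2.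
have c : \forall x \ae area2, Omega x -> exists2 T, T \in Th & (hull pos T)° x.
  by apply: Omega_ae_cell => T x T_Th ix; exists T.
apply: filterS2 fh c => x e c Ox; have [T T_Th ix] := c Ox.
by rewrite (piecewise_cell h T_Th ix); exact: e.
Qed.

End cells.

Section square_integrable.
Context d (T : measurableType d) (R : realType) (mu : {measure set T -> \bar R}).

Lemma Lfun2_of_sqr (f : T -> R) : measurable_fun setT f ->
  mu.-integrable setT (EFin \o (fun x => f x ^+ 2)) -> f \in Lfun mu 2%:E.
Proof.
move=> mf /integrableP[_ fin]; rewrite inE/=; apply/andP; split; rewrite inE//=.
rewrite /finite_norm unlock poweR_lty//; apply: le_lt_trans fin.
rewrite le_eqVlt; apply/orP; left; apply/eqP; apply: eq_integral => x _ /=.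
by rewrite normrX powR_mulrn.
Qed.

End square_integrable.

Section green_Omega.
Variable R : realType.
Variables (Omega : set (R * R)) (V : finType) (pos : V -> R * R).
Variable Th : {set {set V}}.
Implicit Types (a b c p r u w : V) (T E : {set V}) (x y z : R * R).
Hypothesis tri : triangulation Omega pos Th.
Hypothesis regular_Omega : (closure Omega)° = Omega.
Hypothesis open_Omega : open Omega.
Local Notation mR2 := (measurableTypeR R * measurableTypeR R)%type.
Local Notation area2 := (@lebesgue_measure R \x @lebesgue_measure R)%E.
Local Notation field := (R * R -> R * R).
Local Notation pw := (piecewise pos Th).

Lemma measurable_Omega : measurable (Omega : set mR2).
Proof. exact: open_measurable2. Qed.
#[local] Hint Resolve measurable_Omega : core.

Lemma integrable_const_Omega (k : R) : area2.-integrable (Omega : set mR2) (EFin \o cst k).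
Proof.
have h T : T \in Th -> continuous (cst k : R * R -> R) by move=> _ x; exact: cvg_cst.
have kk : \forall x \ae area2, Omega x -> forall T, T \in Th -> (hull pos T)° x ->
    cst k x = cst k x :> R by apply: aeW.
have mk : measurable_fun (Omega : set mR2) (cst k) by exact: measurable_cst.
exact: (integral_cells tri regular_Omega open_Omega (h := fun _ => cst k) mk h kk).1.
Qed.

Lemma L2_measurable (f : R * R -> R) : L2 Omega f -> measurable_fun (Omega : set mR2) f.
Proof.
rewrite /L2 inE => /andP[]; rewrite inE/= => mf _.
exact/(measurable_restrictT _ measurable_Omega).
Qed.

(** [Omega] has finite measure and |f| <= 1 + f^2. *)
Lemma L2_integrable (f : R * R -> R) : L2 Omega f ->
  area2.-integrable (Omega : set mR2) (EFin \o f).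
Proof.
move=> h; have mf := L2_measurable h.
have := integrable_const_Omega 1 => i1.
have i2 := Lfun2_integrable_sqr h.
have i2' := integrableS measurableT measurable_Omega (@subsetT _ _) i2.
have i3 := integrableD measurable_Omega i1 i2'.
apply: le_integrable i3 => //; first exact/measurable_EFinP.
move=> x Ox /=; rewrite patchE mem_set//.
rewrite lee_fin [leRHS]ger0_norm ?addr_ge0 ?sqr_ge0//.
rewrite -[f x ^+ 2]real_normK ?num_real//; nra.
Qed.

Lemma piecewise_L2 (k : {set V} -> R) : L2 Omega (pw (fun T => cst (k T))).
Proof.
have c1 (h : {set V} -> R) : forall T, T \in Th -> continuous (cst (h T) : R * R -> R).
  by move=> T _ x; exact: cvg_cst.
have [i1 _] := piecewise_integrable tri regular_Omega open_Omega (c1 k).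
have [i2 _] := piecewise_integrable tri regular_Omega open_Omega (c1 (fun T => k T ^+ 2)).
have sqrE : (fun x => (pw (fun T => cst (k T)) \_ Omega) x ^+ 2) =
    pw (fun T => cst (k T ^+ 2)) \_ Omega.
  apply/funext => x; rewrite !patchE; case: ifPn => [|_]; last by rewrite expr0n.
  rewrite inE => Ox; case: (pselect (exists2 T, T \in Th & (hull pos T)° x)).
    by move=> [T T_Th ix]; rewrite !(piecewise_cell tri _ T_Th ix).
  move=> n; rewrite /piecewise !big1 ?expr0n//.
    by move=> T T_Th; rewrite patchE memNset// => ix; apply: n; exists T.
  by move=> T T_Th; rewrite patchE memNset// => ix; apply: n; exists T.
apply: Lfun2_of_sqr.
  apply/(measurable_restrictT _ measurable_Omega).
  by have /integrableP[/measurable_EFinP] := i1.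
rewrite sqrE -restrict_EFin.
exact/(integrable_mkcond _ measurable_Omega).1.
Qed.

Definition pw_div (q : {set V} -> field) := pw (fun T => cst (div2 (q T) 0)).

Definition P1plus_family (q : {set V} -> field) :=
  forall a b c, [set a; b; c]%SET \in Th ->
    P1plus (pos a) (pos b) (pos c) (q [set a; b; c]%SET).

Lemma green_cells (v : field) q (phi : R * R -> R) : L2_field Omega v -> P1plus_family q ->
  C1 phi ->
  (\forall x \ae area2, Omega x -> forall T, T \in Th -> (hull pos T)° x -> v x = q T x) ->
  area2.-integrable (Omega : set mR2)
    (EFin \o (fun x => dot2 (v x) (grad phi x) + pw_div q x * phi x)) /\
  green Omega v (pw_div q) phi =
  \sum_(T in Th) (\int[area2]_(x in (hull pos T)°)
    (dot2 (q T x) (grad phi x) + div2 (q T) 0 * phi x))%R.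
Proof.
move=> [v1 v2] qP Cp vq; have [_ px py] := Cp; have pc := C1_continuous Cp.
apply: (integral_cells tri regular_Omega open_Omega
   (h := fun T x => dot2 (q T x) (grad phi x) + div2 (q T) 0 * phi x)).
- have mc (f : R * R -> R) : continuous f -> measurable_fun (Omega : set mR2) f.
    by move=> fc; exact: measurable_funTS (continuous_measurable2 fc).
  apply: measurable_funD; first apply: measurable_funD.
  + exact: measurable_funM (L2_measurable v1) (mc _ px).
  + exact: measurable_funM (L2_measurable v2) (mc _ py).
  + exact: measurable_funM (L2_measurable (piecewise_L2 _)) (mc _ pc).
- move=> T T_Th; have [a [b [c TE]]] := cell_elim tri T_Th; rewrite TE in T_Th *.
  exact: P1plus_continuous (qP _ _ _ T_Th) Cp.
- apply: filterS vq => x h Ox T T_Th ix; rewrite (h Ox T T_Th ix).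
  by rewrite /pw_div (piecewise_cell tri _ T_Th ix).
Qed.

End green_Omega.

(** * Green's formula on the domain as a sum over edges *)

Section boundary_terms.
Variable R : realType.
Variables (Omega : set (R * R)) (V : finType) (pos : V -> R * R).
Variable Th : {set {set V}}.
Implicit Types (a b c p r u w : V) (T E : {set V}) (x y z : R * R).
Hypothesis tri : triangulation Omega pos Th.
Hypothesis regular_Omega : (closure Omega)° = Omega.
Hypothesis open_Omega : open Omega.
Local Notation mR2 := (measurableTypeR R * measurableTypeR R)%type.
Local Notation area2 := (@lebesgue_measure R \x @lebesgue_measure R)%E.
Local Notation field := (R * R -> R * R).
Local Notation tr q a b := (trace q (pos a) (pos b)).
Local Notation family := (P1plus_family pos Th).

(** For distinct vertices [b], [c] of a cell only the third vertex contributes, the determinant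
    being 0 when [a] is [b] or [c]. The sum avoids having to name that vertex. *)
Definition cell_sign T b c : R := \sum_(a in T) Num.sg (det3 pos a b c).

Definition edge_flux (phi : R * R -> R) (f : field) b c : R :=
  seg_int (fun x => phi x * cross2 (pos c - pos b) (f x)) (pos b) (pos c).

(* Every edge is counted twice, as [b c] and as [c b]; [cell_sign] and [edge_flux]
   both change sign in between. *)
Definition boundary_sum (q : {set V} -> field) (phi : R * R -> R) : R :=
  \sum_(T in Th) \sum_(b in T) \sum_(c in T) cell_sign T b c * edge_flux phi (q T) b c.

Lemma sum_in_cell a b c (W : zmodType) (k : V -> W) : [set a; b; c]%SET \in Th ->
  \sum_(v in [set a; b; c]%SET) k v = k a + k b + k c.
Proof.
move=> h; rewrite big_mkcond (sum_cell tri (k := fun v => if v \in _ then k v else 0) h).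
  by have [-> -> ->] := cell_mem a b c.
by move=> v /negbTE ->.
Qed.

Lemma det3_diag a b : [/\ det3 pos a a b = 0, det3 pos a b a = 0 & det3 pos a b b = 0].
Proof. by rewrite /det3 /cross2 !subrr /= !mul0r !mulr0 subrr mulrC subrr. Qed.

Lemma cell_signE a b c : [set a; b; c]%SET \in Th ->
  cell_sign [set a; b; c]%SET b c = Num.sg (det3 pos a b c).
Proof.
move=> h; rewrite /cell_sign (sum_in_cell _ h).
have [-> _ _] := det3_diag b c; have [_ -> _] := det3_diag c b.
by rewrite sgr0 !addr0.
Qed.

Lemma cell_sign_diag T b : cell_sign T b b = 0.
Proof. by rewrite /cell_sign big1// => a _; have [_ _ ->] := det3_diag a b; rewrite sgr0. Qed.

Lemma cell_signC T b c : cell_sign T c b = - cell_sign T b c.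
Proof. by rewrite /cell_sign -sumrN; apply: eq_bigr => a _; rewrite det3_swap sgrN. Qed.

Lemma edge_fluxC (phi : R * R -> R) (f : field) b c : continuous phi ->
  continuous (fun x => (f x).1) -> continuous (fun x => (f x).2) ->
  edge_flux phi f c b = - edge_flux phi f b c.
Proof.
move=> pc f1 f2; rewrite /edge_flux.
have Gc : continuous (fun x => phi x * cross2 (pos c - pos b) (f x)).
  move=> x; apply: cvgM; first exact: pc.
  by apply: cvgB; apply: cvgM; [exact: cvg_cst|exact: f2|exact: cvg_cst|exact: f1].
have GN : (fun x => phi x * cross2 (pos b - pos c) (f x)) =
    (fun x => -1 * (phi x * cross2 (pos c - pos b) (f x))).
  by apply/funext => x; rewrite /cross2 /=; ring.
rewrite GN (seg_intC (pos b) (pos c) Gc) /seg_int RintegralZl ?mulN1r//.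
apply: integrable_segment => s.
exact: (continuous_comp (@continuous_segment _ _ _ s) (Gc _)).
Qed.

Lemma family_continuous q T : family q -> T \in Th ->
  continuous (fun x => (q T x).1) /\ continuous (fun x => (q T x).2).
Proof.
move=> qP T_Th; have [a [b [c TE]]] := cell_elim tri T_Th; rewrite TE in T_Th *.
have [C1F C1G _] := P1plus_C1 (qP _ _ _ T_Th).
by split; exact: C1_continuous.
Qed.

(** The factor 1/2 compensates for counting each edge in both directions. *)
Lemma cell_boundary_sum q (phi : R * R -> R) T : family q -> C1 phi -> T \in Th ->
  (\int[area2]_(x in (hull pos T)°)
    (dot2 (q T x) (grad phi x) + div2 (q T) 0 * phi x))%R =
  - 2^-1 * \sum_(b in T) \sum_(c in T) cell_sign T b c * edge_flux phi (q T) b c.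
Proof.
move=> qP Cp T_Th; have [f1 f2] := family_continuous qP T_Th.
have pc := C1_continuous Cp; have F := edge_fluxC _ _ pc f1 f2.
have [a [b [c TE]]] := cell_elim tri T_Th; rewrite TE in T_Th F *.
rewrite (interior_cell_hull tri T_Th) (green_cell (cell_det tri T_Th) (qP _ _ _ T_Th) Cp).
rewrite !(sum_in_cell _ T_Th) !cell_sign_diag !mul0r.
have s1 := cell_signE T_Th.
have s2 : cell_sign [set a; b; c]%SET c a = Num.sg (det3 pos a b c).
  by rewrite set3_rot -det3_rot; apply: cell_signE; rewrite -set3_rot.
have s3 : cell_sign [set a; b; c]%SET a b = Num.sg (det3 pos a b c).
  by rewrite -set3_rot det3_rot; apply: cell_signE; rewrite set3_rot.
rewrite (cell_signC _ a b) (cell_signC _ b c) (cell_signC _ c a) s1 s2 s3.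
rewrite (F a b) (F b c) (F c a) -/(det3 pos a b c) -/(edge_flux _ _ a b)
  -/(edge_flux _ _ b c) -/(edge_flux _ _ c a).
set S := Num.sg _; set x1 := edge_flux _ _ a b; set x2 := edge_flux _ _ b c.
set x3 := edge_flux _ _ c a.
clearbody S x1 x2 x3; lra.
Qed.

Lemma green_boundary_sum (v : field) q (phi : R * R -> R) : L2_field Omega v ->
  family q -> C1 phi ->
  (\forall x \ae area2, Omega x -> forall T, T \in Th -> (hull pos T)° x -> v x = q T x) ->
  green Omega v (pw_div pos Th q) phi = - 2^-1 * boundary_sum q phi.
Proof.
move=> v2 qP Cp vq; have [_ ->] := green_cells tri regular_Omega open_Omega v2 qP Cp vq.
by rewrite mulr_sumr; apply: eq_bigr => T T_Th; exact: cell_boundary_sum.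
Qed.

Lemma sum_cell_edges (F : {set V} -> V -> V -> R) :
  \sum_(T in Th) \sum_(b in T) \sum_(c in T) F T b c =
  \sum_b \sum_c \sum_(T in Th | (b \in T) && (c \in T)) F T b c.
Proof.
under eq_bigr => T _.
  rewrite big_mkcond.
  under eq_bigr => b _.
    have -> : (if b \in T then \sum_(c in T) F T b c else 0) =
        \sum_c (if (b \in T) && (c \in T) then F T b c else 0).
      by case: (b \in T); [rewrite big_mkcond|rewrite big1].
    over.
  over.
rewrite exchange_big; apply: eq_bigr => b _ /=.
rewrite exchange_big; apply: eq_bigr => c _ /=.
by rewrite big_mkcondr.
Qed.

Lemma sum_two_cells a b c c' (X : {set V} -> R) : [set a; b; c]%SET \in Th ->
  [set a; b; c']%SET \in Th -> c != c' ->
  \sum_(T in Th | (a \in T) && (b \in T)) X T = X [set a; b; c]%SET + X [set a; b; c']%SET.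
Proof.
move=> h h' cc'; have [ia ib _] := cell_mem a b c; have [ia' ib' _] := cell_mem a b c'.
have ne : [set a; b; c']%SET != [set a; b; c]%SET :> {set V}.
  apply: contra_neq cc' => /setP/(_ c); rewrite !inE eqxx !orbT.
  have [_ bc ac] := cell_uniq tri h.
  by rewrite (eq_sym c a) (eq_sym c b) (negbTE ac) (negbTE bc) => /eqP.
rewrite (bigD1 [set a; b; c]%SET) ?h ?ia ?ib//= (bigD1 [set a; b; c']%SET) /=; last first.
  by rewrite h' ia' ib'.
rewrite big1 ?addr0// => T /andP[/andP[/andP[T_Th /andP[aT bT]] n1] n2].
by case: (cell_dichotomy tri h h' cc' T_Th aT bT) => e; rewrite e eqxx in n1 n2.
Qed.

Lemma edge_fluxE q (phi : R * R -> R) a b c : family q -> [set a; b; c]%SET \in Th ->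
  edge_flux phi (q [set a; b; c]%SET) b c =
  (\int[@lebesgue_measure R]_(s in `[0, 1]%classic)
    (phi (pos b + s *: (pos c - pos b)) *
     ((1 - s) * (tr (q [set a; b; c]%SET) b c).1.1 + s * (tr (q [set a; b; c]%SET) b c).1.2)))%R.
Proof.
move=> qP h; apply: eq_Rintegral => s _.
by rewrite (P1plus_normal _ (qP _ _ _ h)).
Qed.

(** The flux integral depends only on the trace. The two cells at an interior edge have equal traces
    and opposite signs, and on a boundary edge the trace is 0. *)
Lemma conforming_boundary_sum q phi : conforming Omega pos Th q -> boundary_sum q phi = 0.
Proof.
move=> [qP qC qB]; rewrite /boundary_sum sum_cell_edges.
apply: big1 => b _; apply: big1 => c _.
have [->|bc] := eqVneq b c.
  by apply: big1 => T _; rewrite cell_sign_diag mul0r.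
have [[T T_Th [bT cT]]|n] := pselect (exists2 T, T \in Th & b \in T /\ c \in T); last first.
  by apply: big1 => T /andP[T_Th /andP[bT cT]]; exfalso; apply: n; exists T.
have [a TE] := cell_at tri T_Th bT cT bc; rewrite TE in T_Th.
have [ie|be] := edge_dichotomy Omega pos (cell_edge tri T_Th); last first.
  apply: big1 => T' /andP[T'_Th /andP[bT' cT']].
  have [a' TE'] := cell_at tri T'_Th bT' cT' bc; rewrite set3_rot set3_rot in TE'.
  have h' : [set a'; b; c]%SET \in Th by rewrite -TE'.
  rewrite TE' (edge_fluxE _ qP h') -TE' (qB T' _ _ be)//=.
  rewrite (_ : Rintegral _ _ _ = 0) ?mulr0//.
  under eq_Rintegral do rewrite !mulr0 addr0 mulr0.
  by rewrite Rintegral_cst// mul0r.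
have [a' h' na] := neighbour tri open_Omega ie T_Th.
have hs : [set a; b; c]%SET \in Th by rewrite -set3_rot in T_Th *.
have hs' : [set a'; b; c]%SET \in Th by rewrite -set3_rot in h' *.
rewrite (sum_two_cells _ T_Th h'); last by rewrite eq_sym.
have [ib ic _] := cell_mem b c a; have [ib' ic' _] := cell_mem b c a'.
have t := qC _ _ b c T_Th h' ib ic ib' ic' bc.
have D := opposite_det tri T_Th h' na.
rewrite -!(set3_rot _ b c) in t *.
rewrite (edge_fluxE _ qP hs) (edge_fluxE _ qP hs') !cell_signE// t -mulrDl.
rewrite -(det3_rot pos a b c) -(det3_rot pos a' b c).
rewrite (_ : _ + _ = 0) ?mul0r//; move: D; rewrite -/(det3 pos b c a) -/(det3 pos b c a').
move: (det3 pos b c a) (det3 pos b c a') => s s' ss.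
have [s0|s0|s0] := ltrgt0P s; have [s0'|s0'|s0'] := ltrgt0P s';
  rewrite ?(gtr0_sg s0) ?(ltr0_sg s0) ?(gtr0_sg s0') ?(ltr0_sg s0'); try nra.
Qed.

End boundary_terms.

(** * Test functions concentrating on an edge *)

Section tests.
Variable R : realType.
Implicit Types (x p r u : R * R) (s t k y : R).

(** The square of the positive part. Squaring removes the kink at 0, and the derivative [y + |y|] is
    continuous. *)
Definition ramp_sqr y : R := ((y + `|y|) / 2) ^+ 2.

Lemma ramp_sqr_quotient y (e : R) : `|ramp_sqr (e + y) - ramp_sqr y - (y + `|y|) * e| <= `|e| ^+ 2.
Proof.
rewrite /ramp_sqr real_normK ?num_real//; have e2 := sqr_ge0 e.
have [y0|y0] := lerP 0 y; have [s0|s0] := lerP 0 (e + y);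
  rewrite ?(ger0_norm y0) ?(ltr0_norm y0) ?(ger0_norm s0) ?(ltr0_norm s0) ler_norml;
  apply/andP; split; nra.
Qed.

Lemma is_derive_ramp_sqr y : is_derive y 1 ramp_sqr (y + `|y|).
Proof.
have c : (fun e : R => e^-1 *: (ramp_sqr (e *: 1 + y) - ramp_sqr y)) e @[e --> 0^'] --> y + `|y|.
  apply/cvgrPdist_le => eps eps0; near=> e.
  have e0 : e != 0 by near: e; exact: nbhs_dnbhs_neq.
  have ele : `|e| <= eps by near: e; exact: dnbhs0_le.
  apply: le_trans ele; rewrite distrC /GRing.scale /= mulr1.
  have -> : e^-1 * (ramp_sqr (e + y) - ramp_sqr y) - (y + `|y|) =
      e^-1 * (ramp_sqr (e + y) - ramp_sqr y - (y + `|y|) * e) by field.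
  rewrite normrM normfV ler_pdivrMl ?normr_gt0// -expr2.
  exact: ramp_sqr_quotient.
by split; [apply/cvg_ex; eexists; exact: c|exact/cvg_lim].
Unshelve. all: by end_near.
Qed.

Lemma is_derive_decay k y : 0 <= k -> is_derive y 1 (fun z => (1 + k * z ^+ 2)^-1)
  (- (2 * k * y) / (1 + k * y ^+ 2) ^+ 2).
Proof.
move=> k0; have d0 : 1 + k * y ^+ 2 != 0.
  by rewrite gt_eqF// ltr_pwDl// mulr_ge0// sqr_ge0.
apply: is_derive_eq; coords; field; exact: d0.
Qed.

(** [along] is the parameter of the orthogonal projection to the line, with values 0 at [p] and 1 at
    [r]; [across] is the signed distance to the line multiplied by the length of the segment. *)
Definition along p r x : R := dot2 (r - p) (x - p) / dot2 (r - p) (r - p).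
Definition across p r x : R := cross2 (r - p) (x - p).
Definition decay k y : R := (1 + k * y ^+ 2)^-1.

Lemma along_affine p r : affine2 (along p r).
Proof.
pose L := (dot2 (r - p) (r - p))^-1; pose u := r - p.
exists (- dot2 u p * L), (u.1 * L), (u.2 * L) => x.
by rewrite /along -/L -/u /dot2 /=; ring.
Qed.

Lemma across_affine p r : affine2 (across p r).
Proof.
pose u := r - p; exists (- cross2 u p), (- u.2), u.1 => x.
by rewrite /across -/u /cross2 /=; ring.
Qed.

(* Constant in the direction normal to [p r], and supported over the segment. *)
Definition edge_bump (j0 j1 : R) p r x : R :=
  let s := along p r x in ((1 - s) * j0 + s * j1) * ramp_sqr (s * (1 - s)).

Definition edge_test (j0 j1 : R) p r (k : R) x : R := edge_bump j0 j1 p r x * decay k (across p r x).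

Lemma C1_edge_bump j0 j1 p r : C1 (edge_bump j0 j1 p r).
Proof.
have Cs : C1 (along p r) by apply: C1_affine; exact: along_affine.
have Cs' : C1 (fun x => 1 - along p r x).
  have -> : (fun x => 1 - along p r x) = (fun x => 1 + -1 * along p r x).
    by apply/funext => x; rewrite mulN1r.
  by apply: C1_add; [exact: C1_cst|apply: C1_mul => //; exact: C1_cst].
apply: C1_mul.
  by apply: C1_add; apply: C1_mul => //; exact: C1_cst.
apply: (C1_comp (C1_mul Cs Cs') is_derive_ramp_sqr) => y.
by apply: cvgD; [exact: cvg_id|exact: cvg_norm cvg_id].
Qed.

Lemma decay_bounds k y : 0 <= k -> 0 <= decay k y <= 1.
Proof.
move=> k0; have h : 1 <= 1 + k * y ^+ 2 by rewrite lerDl mulr_ge0// sqr_ge0.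
rewrite /decay invr_ge0 (le_trans _ h)//= invf_le1// (lt_le_trans _ h)//.
Qed.

Lemma C1_edge_test j0 j1 p r k : 0 <= k -> C1 (edge_test j0 j1 p r k).
Proof.
move=> k0; apply: C1_mul; first exact: C1_edge_bump.
apply: (C1_comp (C1_affine (across_affine p r)) (fun y => is_derive_decay y k0)) => y.
have d0 : (1 + k * y ^+ 2) != 0 by rewrite gt_eqF// ltr_pwDl// mulr_ge0// sqr_ge0.
have c : continuous (fun z : R => 1 + k * z ^+ 2).
  move=> z; apply: cvgD; first exact: cvg_cst.
  by apply: cvgM; [exact: cvg_cst|exact: exprn_continuous].
apply: cvgM.
  apply: cvgN; apply: cvgM; [exact: cvg_cst|exact: cvg_id].
apply: cvgV; first by rewrite expf_neq0.
exact: (cvgM (c y) (c y)).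
Qed.

Lemma edge_test_le j0 j1 p r k x : 0 <= k ->
  `|edge_test j0 j1 p r k x| <= `|edge_bump j0 j1 p r x|.
Proof.
move=> k0; have /andP[d0 d1] := decay_bounds (across p r x) k0.
by rewrite normrM (ger0_norm d0) ler_piMr.
Qed.

(** The bound (1 + n y^2)^-1 <= (1 + y^-2) / (n + 1) follows from (1 + n y^2)(1 + y^-2) = 1 + n + n
    y^2 + y^-2. *)
Lemma decay_cvg y : y != 0 -> (fun n : nat => decay n%:R y) @ \oo --> (0 : R).
Proof.
move=> y0; have a0 : 0 < y ^+ 2 by rewrite exprn_even_gt0.
have h : (fun n : nat => (1 + (y ^+ 2)^-1) * harmonic n) @ \oo --> (0 : R).
  by rewrite -[X in _ --> X](mulr0 (1 + (y ^+ 2)^-1)); apply: cvgM; [exact: cvg_cst|exact: cvg_harmonic].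
apply: (squeeze_cvgr _ (cvg_cst 0) h).
near=> n; have /andP[-> _] := decay_bounds y (ler0n R n).
rewrite /decay /harmonic /= -[leRHS]invrK lef_pV2 ?posrE; last 2 first.
- by rewrite ltr_pwDl// mulr_ge0// ltW.
- by rewrite invr_gt0 mulr_gt0// ?invr_gt0// addr_gt0// invr_gt0.
rewrite invfM invrK ler_pdivrMl ?addr_gt0 ?invr_gt0// -natr1.
have p1 : 0 <= n%:R * y ^+ 2 by rewrite mulr_ge0// ltW.
have p2 : 0 <= (y ^+ 2)^-1 by rewrite invr_ge0 ltW.
have p3 : (y ^+ 2)^-1 * (n%:R * y ^+ 2) = n%:R by rewrite mulrCA mulVf ?mulr1// gt_eqF.
rewrite mulrDl mul1r mulrDr mulr1 p3; lra.
Unshelve. all: by end_near.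
Qed.

Lemma edge_test_cvg j0 j1 p r x :
  (across p r x = 0 -> along p r x <= 0 \/ 1 <= along p r x) ->
  (fun n : nat => edge_test j0 j1 p r n%:R x) @ \oo --> (0 : R).
Proof.
move=> h; have [t0|t0] := eqVneq (across p r x) 0.
  have -> : (fun n : nat => edge_test j0 j1 p r n%:R x) = cst 0.
    apply/funext => n; rewrite /edge_test /edge_bump /ramp_sqr.
    set s := along p r x; have s0 : s * (1 - s) <= 0 by case: (h t0) => hs; rewrite -/s in hs; nra.
    by rewrite (ler0_norm s0) subrr mul0r expr0n mulr0 mul0r.
  exact: cvg_cst.
rewrite -(mulr0 (edge_bump j0 j1 p r x)); apply: cvgM; first exact: cvg_cst.
exact: decay_cvg.
Qed.

Lemma along_segment p r s : dot2 (r - p) (r - p) != 0 -> along p r (p + s *: (r - p)) = s.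
Proof.
move=> L0; rewrite /along addrAC subrr add0r.
have -> : dot2 (r - p) (s *: (r - p)) = s * dot2 (r - p) (r - p).
  by rewrite /dot2 /= /GRing.scale /=; ring.
by rewrite mulfK.
Qed.

Lemma across_segment p r s : across p r (p + s *: (r - p)) = 0.
Proof. by rewrite /across addrAC subrr add0r /cross2 /= /GRing.scale /=; ring. Qed.

Lemma edge_test_on_segment j0 j1 p r k s : dot2 (r - p) (r - p) != 0 -> 0 <= s <= 1 ->
  edge_test j0 j1 p r k (p + s *: (r - p)) = ((1 - s) * j0 + s * j1) * (s * (1 - s)) ^+ 2.
Proof.
move=> L0 /andP[s0 s1]; rewrite /edge_test /edge_bump along_segment// across_segment /decay.
rewrite expr0n mulr0 addr0 invr1 mulr1 /ramp_sqr ger0_norm; last by rewrite mulr_ge0// subr_ge0.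
by congr (_ * _ ^+ 2); field.
Qed.

(** 1/105 and 1/140 are the beta integrals of s^2 (1 - s)^4 and of s^3 (1 - s)^3 over [0, 1]. *)
Lemma edge_weight_integral (j0 j1 N0 N1 : R) :
  (\int[@lebesgue_measure R]_(s in `[0, 1]%classic)
     (((1 - s) * j0 + s * j1) * (s * (1 - s)) ^+ 2 * ((1 - s) * N0 + s * N1)))%R =
  N0 * (j0 / 105 + j1 / 140) + N1 * (j0 / 140 + j1 / 105).
Proof.
pose c2 := j0 * N0.
pose c3 := (j1 - j0) * N0 + j0 * (N1 - N0) - 2 * (j0 * N0).
pose c4 := (j1 - j0) * (N1 - N0) - 2 * ((j1 - j0) * N0 + j0 * (N1 - N0)) + j0 * N0.
pose c5 := (j1 - j0) * N0 + j0 * (N1 - N0) - 2 * ((j1 - j0) * (N1 - N0)).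
pose c6 := (j1 - j0) * (N1 - N0).
pose F (s : R) := c2 / 3 * s ^+ 3 + c3 / 4 * s ^+ 4 + c4 / 5 * s ^+ 5 + c5 / 6 * s ^+ 6 + c6 / 7 * s ^+ 7.
pose f (s : R) := c2 * s ^+ 2 + c3 * s ^+ 3 + c4 * s ^+ 4 + c5 * s ^+ 5 + c6 * s ^+ 6.
have fE : (fun s => ((1 - s) * j0 + s * j1) * (s * (1 - s)) ^+ 2 * ((1 - s) * N0 + s * N1)) = f.
  by apply/funext => s; rewrite /f /c2 /c3 /c4 /c5 /c6; ring.
have dF (s : R) : is_derive s 1 F (f s).
  by apply: is_derive_eq; rewrite /f; coords; field.
have cF : continuous F by move=> s; apply: differentiable_continuous; apply/derivable1_diffP.
have cf : continuous f.
  have e (k : R) n : continuous (fun s : R => k * s ^+ n).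
    by move=> s; apply: cvgM; [exact: cvg_cst|exact: exprn_continuous].
  by move=> s; do 4 (apply: cvgD; last exact: e); exact: e.
rewrite fE /Rintegral (@continuous_FTC2 _ _ F)//=.
- by rewrite /F /c2 /c3 /c4 /c5 /c6; field.
- exact: continuous_subspaceT.
- split; first by move=> s _; exact: (@ex_derive _ _ _ _ _ _ _ (dF s)).
  + by apply: cvg_at_right_filter; exact: cF.
  + by apply: cvg_at_left_filter; exact: cF.
- by move=> s _; rewrite derive1E derive_val.
Qed.

End tests.

Section dominated.
Context d (T : measurableType d) (R : realType) (mu : {measure set T -> \bar R}).

Lemma Rintegral_cvg0 (D : set T) (f : nat -> T -> R) (g : T -> R) : measurable D ->
  (forall n, measurable_fun D (f n)) -> mu.-integrable D (EFin \o g) ->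
  (forall n x, D x -> `|f n x| <= g x) ->
  (\forall x \ae mu, D x -> (fun n => f n x) @ \oo --> (0 : R)) ->
  (fun n => \int[mu]_(x in D) f n x)%R @ \oo --> (0 : R).
Proof.
move=> mD mf ig fg f0.
have [|||||_ _ c] := @dominated_convergence _ _ _ mu D mD (fun n => EFin \o f n)
  (cst 0%E) (EFin \o g).
- by move=> n; exact/measurable_EFinP.
- exact: measurable_cst.
- by apply: filterS f0 => x h Dx; apply/fine_cvgP; split; [exact: nearW|exact: h].
- exact: ig.
- by apply: aeW => x n Dx /=; rewrite lee_fin fg.
rewrite integral0 in c.
exact: (fine_cvg c).
Qed.

End dominated.

(** * Limits of the test integrals *)

Section balance.
Variable R : realType.
Variables (Omega : set (R * R)) (V : finType) (pos : V -> R * R).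
Variable Th : {set {set V}}.
Implicit Types (a b c p r u w : V) (T E : {set V}) (x y z : R * R).
Hypothesis tri : triangulation Omega pos Th.
Hypothesis regular_Omega : (closure Omega)° = Omega.
Hypothesis open_Omega : open Omega.
Local Notation mR2 := (measurableTypeR R * measurableTypeR R)%type.
Local Notation area2 := (@lebesgue_measure R \x @lebesgue_measure R)%E.
Local Notation field := (R * R -> R * R).
Local Notation tr q a b := (trace q (pos a) (pos b)).
Local Notation family := (P1plus_family pos Th).
Local Notation bar a b c := (bary (pos a) (pos b) (pos c)).

Lemma bary_edge_point b c a s : det3 pos b c a != 0 ->
  let x := pos b + s *: (pos c - pos b) in
  [/\ bar b c a x = 1 - s, bar c a b x = s & bar a b c x = 0].
Proof.
move=> D0 x; have [[b1 b2 b3] [c1 c2 c3] [a1 a2 a3]] := bary_vertices D0.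
by rewrite !bary_line b1 b2 c1 c2 a1 a2 !mulr0 !mulr1 !addr0 !add0r.
Qed.

(** Otherwise the point would be in the relative interior of [b c], so the cell of the other edge
    would contain [b] and [c], with positive coordinates of the point at both. A point of the edge
    [b' c'] has coordinate 0 at the vertex off that edge, so the two edges would be the same. *)
Lemma other_edge a b c T b' c' (s : R) : [set b; c; a]%SET \in Th -> T \in Th ->
  b' \in T -> c' \in T -> b' != c' -> [set b'; c']%SET != [set b; c]%SET -> 0 <= s <= 1 ->
  let x := pos b' + s *: (pos c' - pos b') in
  across (pos b) (pos c) x = 0 -> along (pos b) (pos c) x <= 0 \/ 1 <= along (pos b) (pos c) x.
Proof.
move=> h T_Th b'T c'T bc' ne /andP[s0 s1] x ax.
have [le0|gt0] := lerP (along (pos b) (pos c) x) 0; first by left.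
have [le1|lt1] := lerP 1 (along (pos b) (pos c) x); first by right.
exfalso; have D0 := cell_det tri h; have [_ L0 _ _] := cell_dot tri h.
have [bc _ _] := cell_uniq tri h.
set t := along _ _ _ in gt0 lt1.
have xE : x = pos b + t *: (pos c - pos b).
  by rewrite -(cross2_parallel L0 ax) addrC subrK.
have [e1 e2 e3] := bary_edge_point t D0; rewrite -xE in e1 e2 e3.
have [d' TE] := cell_at tri T_Th b'T c'T bc'.
have hT : hull pos T x.
  rewrite TE in T_Th *; apply/(hull_cellE tri _ T_Th).
  have [-> -> ->] := bary_edge_point s (cell_det tri T_Th).
  by split => //; rewrite subr_ge0.
have bcT : (b \in T) && (c \in T).
  by apply: (edge_point_meet tri h T_Th _ _ e3 hT); rewrite ?e1 ?e2// subr_gt0.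
have [bT cT] := andP bcT; have [d TE2] := cell_at tri T_Th bT cT bc.
rewrite TE2 in T_Th b'T c'T; have D1 := cell_det tri T_Th.
have [f1 f2 f3] := bary_edge_point t D1; rewrite -xE in f1 f2 f3.
have [[b1 b2 b3] [c1 c2 c3] _] := bary_vertices D1.
(* The coordinate of a vertex other than [b'] and [c'] vanishes along the edge [b' c']. *)
have zero u v w : (forall o : V, o \in [set b; c; d]%SET -> o != u -> bar u v w (pos o) = 0) ->
    u != b' -> u != c' -> bar u v w x = 0.
  move=> hz ub uc; rewrite /x bary_line !hz ?mulr0 ?addr0//; by rewrite eq_sym.
have [bin|bnin] := boolP (b \in [set b'; c']%SET); last first.
  move: bnin; rewrite !inE negb_or => /andP[n1 n2].
  have z : bar b c d x = 0.
    apply: zero => // o; rewrite !inE.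
    by move=> /orP[/orP[]|] /eqP ->; rewrite ?eqxx.
  by rewrite f1 in z; lra.
have [cin|cnin] := boolP (c \in [set b'; c']%SET); last first.
  move: cnin; rewrite !inE negb_or => /andP[n1 n2].
  have z : bar c d b x = 0.
    apply: zero => // o; rewrite !inE.
    by move=> /orP[/orP[]|] /eqP ->; rewrite ?eqxx.
  by rewrite f2 in z; lra.
move: ne; rewrite eq_sym => /negP; apply.
by rewrite eqEcard finset.subUset !finset.sub1set bin cin !cards2 bc bc'.
Qed.

Lemma Omega_bounded : exists M, Omega `<=` `[- M, M]%classic `*` `[- M, M]%classic.
Proof.
exists (\sum_v (`|(pos v).1| + `|(pos v).2|)) => x Ox.
have [T T_Th [k [k0 _ k1 ->]]] := Omega_cover tri Ox.
have kle1 v : k v <= 1.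
  by rewrite -k1 (bigD1 v)//= lerDl sumr_ge0.
have fstE : (\sum_v k v *: pos v).1 = \sum_v k v * (pos v).1.
  by apply: (big_morph (fun z : R * R => z.1)).
have sndE : (\sum_v k v *: pos v).2 = \sum_v k v * (pos v).2.
  by apply: (big_morph (fun z : R * R => z.2)).
split => /=; rewrite in_itv/= -ler_norml ?fstE ?sndE.
  apply: le_trans (ler_norm_sum _ _ _) _; apply: ler_sum => v _.
  by rewrite normrM (ger0_norm (k0 v)) (le_trans (ler_piMl _ (kle1 v)))// lerDl.
apply: le_trans (ler_norm_sum _ _ _) _; apply: ler_sum => v _.
by rewrite normrM (ger0_norm (k0 v)) (le_trans (ler_piMl _ (kle1 v)))// lerDr.
Qed.

(** Dominated convergence: the tests are bounded by the bump, which is bounded on [Omega], and they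
    tend to 0 off the line of the edge, a null set. *)
Lemma edge_test_integral_cvg0 (h : R * R -> R) j0 j1 b c : b != c ->
  area2.-integrable (Omega : set mR2) (EFin \o h) ->
  (fun n : nat => \int[area2]_(x in Omega)
     (h x * edge_test j0 j1 (pos b) (pos c) n%:R x))%R @ \oo --> (0 : R).
Proof.
move=> bc ih; have [M OM] := Omega_bounded.
have [inj _ _ _ _] := tri.
have [K bK] := continuous_box_bounded M (C1_continuous (C1_edge_bump j0 j1 (pos b) (pos c))).
have mO : measurable (Omega : set mR2) by exact: open_measurable2.
have mh : measurable_fun (Omega : set mR2) h by case/integrableP: ih => /measurable_EFinP.
apply: (@Rintegral_cvg0 _ mR2 R area2 Omega
  (fun n x => h x * edge_test j0 j1 (pos b) (pos c) n%:R x) (fun x => K * `|h x|)) => //.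
- move=> n; apply: measurable_funM => //; apply: measurable_funTS.
  apply: continuous_measurable2; apply: C1_continuous; exact: C1_edge_test (ler0n _ _).
- have := integrable_abse ih; have := @integrableZl _ _ _ area2 _ mO K.
  by move=> hK /hK.
- move=> n x Ox; rewrite normrM mulrC ler_wpM2r//.
  exact: le_trans (edge_test_le _ _ _ _ _ (ler0n _ _)) (bK _ (OM _ Ox)).
pose L := [set x : R * R | cross2 (pos c - pos b) (x - pos b) = 0].
have L0 : area2 (L : set mR2) = 0%E.
  by apply: line_null; rewrite subr_eq0; apply: contra_neq bc => /inj ->.
have mL : measurable (L : set mR2).
  have -> : L = (across (pos b) (pos c)) @^-1` [set 0] by [].
  rewrite -[X in measurable X]setTI.
  by apply: (continuous_measurable2 (affine2_continuous (across_affine _ _))).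
apply: (@negligibleS _ _ _ _ (L : set mR2)); last exact/negligibleP.
move=> x /= nx; apply: contrapT => nL; apply: nx => Ox.
rewrite -[X in _ --> X](mulr0 (h x)); apply: cvgM; first exact: cvg_cst.
by apply: edge_test_cvg => e; exfalso; exact: nL.
Qed.

End balance.

Lemma cvg_sum (R : realType) (I : Type) (r : seq I) (P : pred I) (f : I -> nat -> R) (l : I -> R) :
  (forall i, P i -> f i @ \oo --> l i) ->
  (fun n => \sum_(i <- r | P i) f i n) @ \oo --> \sum_(i <- r | P i) l i.
Proof. exact: (cvg_big add_continuous). Qed.

(** * The space of fields and conforming families *)

Section vel0.
Variable R : realType.
Variables (Omega : set (R * R)) (V : finType) (pos : V -> R * R).
Variable Th : {set {set V}}.
Implicit Types (a b c p r u w : V) (T E : {set V}) (x y z : R * R).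
Hypothesis tri : triangulation Omega pos Th.
Hypothesis regular_Omega : (closure Omega)° = Omega.
Hypothesis open_Omega : open Omega.
Local Notation mR2 := (measurableTypeR R * measurableTypeR R)%type.
Local Notation area2 := (@lebesgue_measure R \x @lebesgue_measure R)%E.
Local Notation field := (R * R -> R * R).
Local Notation tr q a b := (trace q (pos a) (pos b)).
Local Notation family := (P1plus_family pos Th).
Local Notation test j0 j1 b c n := (edge_test j0 j1 (pos b) (pos c) n%:R).

Lemma edge_flux_cvg0 q j0 j1 a b c T b' c' : family q -> [set b; c; a]%SET \in Th ->
  T \in Th -> b' \in T -> c' \in T -> b' != c' -> [set b'; c']%SET != [set b; c]%SET ->
  (fun n : nat => edge_flux pos (test j0 j1 b c n) (q T) b' c') @ \oo --> (0 : R).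
Proof.
move=> qP h T_Th bT cT bc ne; have [f1 f2] := family_continuous tri qP T_Th.
have Nc : continuous (fun x => cross2 (pos c' - pos b') (q T x)).
  by move=> x; apply: cvgB; apply: cvgM; [exact: cvg_cst|exact: f2|exact: cvg_cst|exact: f1].
have lc := @continuous_segment R (pos b') (pos c').
have Gc (G : R * R -> R) : continuous G -> continuous (fun s : R => G (pos b' + s *: (pos c' - pos b'))).
  by move=> cG s; exact: (continuous_comp (lc s) (cG _)).
have Bc := C1_continuous (C1_edge_bump j0 j1 (pos b) (pos c)).
have Tc n := C1_continuous (C1_edge_test j0 j1 (pos b) (pos c) (ler0n R n)).
apply: (@Rintegral_cvg0 _ _ R (@lebesgue_measure R) `[0, 1]%classic
  (fun n s => test j0 j1 b c n (pos b' + s *: (pos c' - pos b')) *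
     cross2 (pos c' - pos b') (q T (pos b' + s *: (pos c' - pos b'))))
  (fun s => `|edge_bump j0 j1 (pos b) (pos c) (pos b' + s *: (pos c' - pos b')) *
     cross2 (pos c' - pos b') (q T (pos b' + s *: (pos c' - pos b')))|)) => //.
- move=> n; apply: measurable_funTS; apply: continuous_measurable_fun => s.
  by apply: cvgM; [exact: (Gc _ (Tc n))|exact: (Gc _ Nc)].
- apply: integrable_segment => s; apply: cvg_norm.
  by apply: cvgM; [exact: (Gc _ Bc)|exact: (Gc _ Nc)].
- move=> n s _; rewrite normrM [leRHS]normrM ler_wpM2r//; exact: edge_test_le (ler0n _ _).
- apply: aeW => s; rewrite /= in_itv /= => s01.
  rewrite -(mul0r (cross2 (pos c' - pos b') (q T (pos b' + s *: (pos c' - pos b'))))).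
  apply: cvgM; last exact: cvg_cst.
  by apply: edge_test_cvg; exact: (other_edge tri h T_Th bT cT bc ne s01).
Qed.

Definition edge_weight (j0 j1 : R) (t : R * R * R) : R :=
  t.1.1 * (j0 / 105 + j1 / 140) + t.1.2 * (j0 / 140 + j1 / 105).

Lemma edge_flux_self q j0 j1 b c T (n : nat) : family q -> T \in Th -> b \in T -> c \in T ->
  b != c -> edge_flux pos (test j0 j1 b c n) (q T) b c = edge_weight j0 j1 (tr (q T) b c).
Proof.
move=> qP T_Th bT cT bc; have [a TE] := cell_at tri T_Th bT cT bc.
rewrite set3_rot set3_rot in TE; rewrite TE in T_Th *.
have [_ _ L0 _] := cell_dot tri T_Th.
rewrite (edge_fluxE _ qP T_Th) /edge_weight -edge_weight_integral.
apply: eq_Rintegral => s; rewrite inE /= in_itv /= => s01.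
by rewrite (edge_test_on_segment _ _ _ L0 s01).
Qed.

(** The terms of all other edges tend to 0, and those of [b c] do not depend on [n]. The factor 2
    accounts for the two directions of this edge. *)
Lemma boundary_sum_cvg q j0 j1 a b c : family q -> [set b; c; a]%SET \in Th ->
  (fun n : nat => boundary_sum pos Th q (test j0 j1 b c n)) @ \oo -->
  2 * \sum_(T in Th | (b \in T) && (c \in T))
    cell_sign pos T b c * edge_weight j0 j1 (tr (q T) b c).
Proof.
move=> qP h; have [bc _ _] := cell_uniq tri h.
set S := \sum_(T in Th | _) _.
pose lim b' c' : R := ((b' == b) && (c' == c))%:R * S + ((b' == c) && (c' == b))%:R * S.
have -> : 2 * S = \sum_b' \sum_c' lim b' c'.
  transitivity (\sum_b' ((b' == b)%:R * S + (b' == c)%:R * S)).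
    rewrite big_split /= -!mulr_suml.
    have one d : \sum_(b' : V) (b' == d)%:R = 1 :> R.
      by rewrite (bigD1 d)//= eqxx big1 ?addr0// => o /negbTE ->.
    by rewrite !one; ring.
  apply: eq_bigr => b' _; rewrite /lim big_split /=; congr (_ + _).
    rewrite -mulr_suml; congr (_ * _).
    by rewrite (bigD1 c)//= eqxx andbT big1 ?addr0// => o /negbTE ->; rewrite andbF.
  rewrite -mulr_suml; congr (_ * _).
  by rewrite (bigD1 b)//= eqxx andbT big1 ?addr0// => o /negbTE ->; rewrite andbF.
have -> : (fun n : nat => boundary_sum pos Th q (test j0 j1 b c n)) =
    (fun n : nat => \sum_b' \sum_c' \sum_(T in Th | (b' \in T) && (c' \in T))
      cell_sign pos T b' c' * edge_flux pos (test j0 j1 b c n) (q T) b' c').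
  by apply/funext => n; rewrite /boundary_sum sum_cell_edges.
apply: cvg_sum => b' _; apply: cvg_sum => c' _.
have pc n := C1_continuous (C1_edge_test j0 j1 (pos b) (pos c) (ler0n R n)).
have [/eqP e|ne] := boolP ([set b'; c']%SET == [set b; c]%SET).
  case: (set2_eq e) => -[-> ->]; rewrite /lim !eqxx.
    rewrite (negbTE bc) mul1r mul0r addr0.
    have -> : S = \sum_(T in Th | (b \in T) && (c \in T))
        cell_sign pos T b c * edge_weight j0 j1 (tr (q T) b c) by [].
    have -> : (fun n : nat => \sum_(T in Th | (b \in T) && (c \in T))
        cell_sign pos T b c * edge_flux pos (test j0 j1 b c n) (q T) b c) = (fun=> S).
      apply/funext => n; apply: eq_bigr => T /andP[T_Th /andP[bT cT]].
      by rewrite (edge_flux_self _ _ _ qP T_Th bT cT bc).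
    exact: cvg_cst.
  rewrite [c == b]eq_sym (negbTE bc) mul0r mul1r add0r.
  have -> : (fun n : nat => \sum_(T in Th | (c \in T) && (b \in T))
      cell_sign pos T c b * edge_flux pos (test j0 j1 b c n) (q T) c b) = (fun=> S).
    apply/funext => n; rewrite /S.
    rewrite (eq_bigl (fun T => (T \in Th) && ((b \in T) && (c \in T)))); last first.
      by move=> T; rewrite [(c \in T) && _]andbC.
    apply: eq_bigr => T /andP[T_Th /andP[bT cT]].
    have [f1 f2] := family_continuous tri qP T_Th.
    rewrite cell_signC (edge_fluxC pos b c (pc n) f1 f2) mulrNN.
    by rewrite (edge_flux_self _ _ _ qP T_Th bT cT bc).
  exact: cvg_cst.
have -> : lim b' c' = \sum_(T in Th | (b' \in T) && (c' \in T)) 0.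
  rewrite big1// /lim; have [e|_] := boolP ((b' == b) && (c' == c)).
    by move: ne; case/andP: e => /eqP -> /eqP ->; rewrite eqxx.
  have [e|_] := boolP ((b' == c) && (c' == b)); last by rewrite !mul0r addr0.
  by move: ne; case/andP: e => /eqP -> /eqP ->; rewrite finset.setUC eqxx.
apply: cvg_sum => T /andP[T_Th /andP[bT cT]].
have [->|bc'] := eqVneq b' c'.
  by rewrite cell_sign_diag; under eq_fun do rewrite mul0r; exact: cvg_cst.
rewrite -(mulr0 (cell_sign pos T b' c')); apply: cvgM; first exact: cvg_cst.
exact: (edge_flux_cvg0 _ _ qP h T_Th bT cT bc' ne).
Qed.

(** The boundary sum equals twice the integral of [g - pw_div q] against the test. The latter tends
    to 0, whatever [g] is, which forces the limit of the former to vanish. *)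
Lemma normal_balance (v : field) (g : R * R -> R) q a b c j0 j1 : L2_field Omega v ->
  L2 Omega g -> (forall phi, C1 phi -> green Omega v g phi = 0) -> family q ->
  (\forall x \ae area2, Omega x -> forall T, T \in Th -> (hull pos T)° x -> v x = q T x) ->
  [set b; c; a]%SET \in Th ->
  \sum_(T in Th | (b \in T) && (c \in T))
    cell_sign pos T b c * edge_weight j0 j1 (tr (q T) b c) = 0.
Proof.
move=> v2 g2 G0 qP vq h; have [bc _ _] := cell_uniq tri h.
have mO : measurable (Omega : set mR2) by exact: open_measurable2.
have ig : area2.-integrable (Omega : set mR2) (EFin \o (fun x => g x - pw_div pos Th q x)).
  have i1 := L2_integrable tri regular_Omega open_Omega g2.
  have i2 := L2_integrable tri regular_Omega open_Omega
    (piecewise_L2 tri regular_Omega open_Omega (fun T => div2 (q T) 0)).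
  exact: (integrableB mO i1 i2).
have [M OM] := Omega_bounded tri.
have key n : boundary_sum pos Th q (test j0 j1 b c n) =
    2 * (\int[area2]_(x in Omega) ((g x - pw_div pos Th q x) * test j0 j1 b c n x))%R.
  have Ct := C1_edge_test j0 j1 (pos b) (pos c) (ler0n R n).
  have [i1 _] := green_cells tri regular_Omega open_Omega v2 qP Ct vq.
  have := green_boundary_sum tri regular_Omega open_Omega v2 qP Ct vq.
  have i2 : area2.-integrable (Omega : set mR2)
      (EFin \o (fun x => (g x - pw_div pos Th q x) * test j0 j1 b c n x)).
    have mt := continuous_measurable2 (C1_continuous Ct).
    have := @integrableMl _ _ _ area2 _ mO _ _ ig (measurable_funTS mt).
    move=> /(_ _); apply.
    have [K bK] := continuous_box_bounded M (C1_continuous Ct).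
    exists K; split; first exact: num_real.
    by move=> K' KK' x Ox /=; rewrite (le_trans (bK x (OM x Ox)))// ltW.
  have G := G0 _ Ct; rewrite /green in G *.
  (* [g] is split into the cellwise divergence, to which Green's formula applies, and an integrable
     remainder. *)
  have E : (\int[area2]_(x in Omega) (dot2 (v x) (grad (test j0 j1 b c n) x) +
      g x * test j0 j1 b c n x))%R =
    (\int[area2]_(x in Omega) ((dot2 (v x) (grad (test j0 j1 b c n) x) +
      pw_div pos Th q x * test j0 j1 b c n x) +
      (g x - pw_div pos Th q x) * test j0 j1 b c n x))%R.
    by apply: eq_Rintegral => x _; ring.
  rewrite E (RintegralD mO i1 i2) in G.
  move: G; set X := Rintegral _ _ _; set Y := Rintegral _ _ _; lra.
have c1 := @boundary_sum_cvg q j0 j1 a b c qP h.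
have c2 : (fun n : nat => boundary_sum pos Th q (test j0 j1 b c n)) @ \oo --> (0 : R).
  under eq_fun do rewrite key.
  rewrite -(mulr0 2); apply: cvgM; first exact: cvg_cst.
  exact: (edge_test_integral_cvg0 tri open_Omega).
set S := \sum_(T in _ | _) _ in c1 *.
have /eqP : 2 * S = 0 by apply: (cvg_unique _ c1 c2); exact: norm_hausdorff.
by rewrite mulf_eq0 pnatr_eq0 => /eqP.
Qed.

(* These two choices of the bump isolate the end values of the normal component. *)
Lemma edge_weight_nodal t :
  edge_weight 4 (-3) t = t.1.1 / 60 /\ edge_weight (-3) 4 t = t.1.2 / 60.
Proof. by rewrite /edge_weight; split; field. Qed.

(** [N] stands for either end value of the normal component. Two cells at the edge have opposite
    signs, so the balance is an equality of their values; with a single cell it says that the value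
    is 0. *)
Lemma balanced_normal q b c T T' (N : R * R * R -> R) :
  (forall a, [set b; c; a]%SET \in Th ->
    \sum_(T in Th | (b \in T) && (c \in T)) cell_sign pos T b c * (N (tr (q T) b c) / 60) = 0) ->
  T \in Th -> T' \in Th -> b \in T -> c \in T -> b \in T' -> c \in T' -> b != c ->
  N (tr (q T) b c) = N (tr (q T') b c) /\
  (boundary_edge Omega pos Th [set b; c]%SET -> N (tr (q T) b c) = 0).
Proof.
move=> S0 T_Th T'_Th bT cT bT' cT' bc.
have sg0 a : [set b; c; a]%SET \in Th -> cell_sign pos [set b; c; a]%SET b c != 0.
  move=> h; rewrite -set3_rot in h *; rewrite (cell_signE tri h) sgr_eq0.
  exact: (cell_det tri h).
have [a TE] := cell_at tri T_Th bT cT bc; rewrite TE in T_Th *.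
have [a' TE'] := cell_at tri T'_Th bT' cT' bc; rewrite TE' in T'_Th *.
have S := S0 a T_Th.
have [e|ne] := eqVneq a a'.
  rewrite -e; split => // be; move: S.
  rewrite (bigD1 [set b; c; a]%SET) /=; last by have [-> -> _] := cell_mem b c a; rewrite T_Th.
  rewrite big1 => [|T0 /andP[/andP[T0_Th /andP[bT0 cT0]] n0]].
    move=> /eqP; rewrite addr0 mulf_eq0 (negbTE (sg0 a T_Th)) mulf_eq0 invr_eq0.
    by rewrite pnatr_eq0 orbF => /eqP.
  have [a0 e0] := cell_at tri T0_Th bT0 cT0 bc; rewrite e0 in T0_Th n0.
  by rewrite (boundary_one_cell tri regular_Omega be T0_Th T_Th) eqxx in n0.
split; last first.
  by move=> be; move: ne; rewrite (boundary_one_cell tri regular_Omega be T_Th T'_Th) eqxx.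
rewrite (sum_two_cells tri _ T_Th T'_Th ne) in S.
have D := opposite_sides tri T_Th T'_Th ne.
rewrite -(set3_rot a b c) -(set3_rot a' b c) in S *; rewrite -set3_rot in T_Th; rewrite -set3_rot in T'_Th.
rewrite (cell_signE tri T_Th) (cell_signE tri T'_Th) in S.
rewrite -(det3_rot pos a b c) -(det3_rot pos a' b c) in S.
move: S D; move: (det3 pos b c a) (det3 pos b c a') => s s'.
move: (N _) (N _) => x y S ss; move: S.
have [s0|s0|s0] := ltrgt0P s; have [s0'|s0'|s0'] := ltrgt0P s'; try nra.
- by rewrite (gtr0_sg s0) (ltr0_sg s0'); lra.
- by rewrite (ltr0_sg s0) (gtr0_sg s0'); lra.
Qed.

Lemma cell_dist2 T b c : T \in Th -> b \in T -> c \in T -> b != c ->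
  dist2 (pos b) (pos c) != 0.
Proof.
move=> T_Th bT cT bc; have [a TE] := cell_at tri T_Th bT cT bc; rewrite TE in T_Th.
exact: (dist2_neq0 (cell_det tri T_Th)).
Qed.

Lemma cell_tangential q T b c : family q -> T \in Th -> b \in T -> c \in T -> b != c ->
  tangential_integral (q T) (pos b) (pos c) = (tr (q T) b c).2.
Proof.
move=> qP T_Th bT cT bc; have d0 := cell_dist2 T_Th bT cT bc.
have [a TE] := cell_at tri T_Th bT cT bc; rewrite TE in T_Th *.
exact: (tangential_integralE (qP _ _ _ T_Th) d0).
Qed.

Lemma ae_cells (v : field) q : (forall T, T \in Th -> v = q T %[ae area2 in hull pos T]) ->
  \forall x \ae area2, Omega x -> forall T, T \in Th -> (hull pos T)° x -> v x = q T x.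
Proof.
move=> vq.
have H : \forall x \ae area2, forall T, T \in Th -> hull pos T x -> v x = q T x.
  apply: (@filter_forall mR2 {set V} (fun T x => T \in Th -> hull pos T x -> v x = q T x)
    _ _) => T.
  have [T_Th|nT] := boolP (T \in Th); last by apply: aeW.
  by apply: filterS (vq T T_Th) => x hx _.
by apply: filterS H => x hx _ T T_Th /interior_subset; exact: hx.
Qed.

Lemma Vel0_conforming v : Vel0 Omega pos Th v -> L2_field Omega v /\
  exists2 q, conforming Omega pos Th q &
    forall T, T \in Th -> v = q T %[ae area2 in hull pos T].
Proof.
move=> [[v2 [g [g2 _ G0]]] [q [vq qP qI qB]]]; split => //; exists q => //.
(* [B] treats the initial value of the normal component and [B'] the final one, each with the bump
   that isolates it. *)
have B T T' b c := fun T_Th T'_Th bT cT bT' cT' bc =>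
  (@balanced_normal q b c T T' (fun t => t.1.1) (fun a h => etrans (eq_bigr _ (fun T0 _ =>
     congr1 _ (esym (edge_weight_nodal (tr (q T0) b c)).1)))
     (normal_balance 4 (-3) v2 g2 G0 qP (ae_cells vq) h))
    T_Th T'_Th bT cT bT' cT' bc).
have B' T T' b c := fun T_Th T'_Th bT cT bT' cT' bc =>
  (@balanced_normal q b c T T' (fun t => t.1.2) (fun a h => etrans (eq_bigr _ (fun T0 _ =>
     congr1 _ (esym (edge_weight_nodal (tr (q T0) b c)).2)))
     (normal_balance (-3) 4 v2 g2 G0 qP (ae_cells vq) h))
    T_Th T'_Th bT cT bT' cT' bc).
have bnd T b c : boundary_edge Omega pos Th [set b; c]%SET -> T \in Th ->
    b \in T -> c \in T -> b != c -> tr (q T) b c = 0.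
  move=> be T_Th bT cT bc.
  have [_ n0] := B T T b c T_Th T_Th bT cT bT cT bc.
  have [_ n1] := B' T T b c T_Th T_Th bT cT bT cT bc.
  apply: pairP; [exact: n0|exact: n1|].
  rewrite -(cell_tangential qP T_Th bT cT bc); apply: qB => //.
  by rewrite finset.subUset !finset.sub1set bT.
split => // T T' b c T_Th T'_Th bT cT bT' cT' bc.
have eE : edge Th [set b; c]%SET.
  by split; [rewrite cards2 bc|exists T => //; rewrite finset.subUset !finset.sub1set bT].
have [ie|be] := edge_dichotomy Omega pos eE; last by rewrite !bnd.
have [n0 _] := B T T' b c T_Th T'_Th bT cT bT' cT' bc.
have [n1 _] := B' T T' b c T_Th T'_Th bT cT bT' cT' bc.
apply: pairP => //.
rewrite -(cell_tangential qP T_Th bT cT bc) -(cell_tangential qP T'_Th bT' cT' bc).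
by apply: qI => //; rewrite finset.subUset !finset.sub1set ?bT ?bT'.
Qed.

(** The cellwise divergence is the weak divergence on the whole domain, since the edge terms in
    Green's formula cancel. *)
Lemma conforming_Vel0 v q : L2_field Omega v -> conforming Omega pos Th q ->
  (\forall x \ae area2, Omega x -> forall T, T \in Th -> (hull pos T)° x -> v x = q T x) ->
  Vel0 Omega pos Th v.
Proof.
move=> v2 qc vq; have [qP qC qB] := qc.
have G0 phi : C1 phi -> green Omega v (pw_div pos Th q) phi = 0.
  move=> Cp; rewrite (green_boundary_sum tri regular_Omega open_Omega v2 qP Cp vq).
  by rewrite (conforming_boundary_sum tri open_Omega _ qc) mulr0.
split.
  split => //; exists (pw_div pos Th q); split => //.
    exact: piecewise_L2.
  by move=> phi Cp _; exact: G0.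
exists q; split => //.
(* The hull of a cell and its interior differ only by points of the null skeleton. *)
- move=> T T_Th; have sk : \forall x \ae area2, ~ skeleton pos x.
    apply: negligibleS (skeleton_negligible tri) => x /= h.
    by apply: contrapT => n; apply: h.
  apply: filterS2 vq sk => x h ns hx.
  have ix := skeletonP tri T_Th hx ns.
  by apply: h => //; exact: (cell_interior_sub tri regular_Omega T_Th ix).
- move=> b c T T' ie T_Th T'_Th.
  have bc : b != c by case: ie => -[+ _] _; rewrite cards2; case: (b != c).
  rewrite !finset.subUset !finset.sub1set => /andP[bT cT] /andP[bT' cT'].
  by rewrite !cell_tangential// (qC T T').
- move=> b c T be T_Th.
  have bc : b != c by case: be => -[+ _] _; rewrite cards2; case: (b != c).
  rewrite !finset.subUset !finset.sub1set => /andP[bT cT].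
  by rewrite cell_tangential// (qB T).
Qed.

End vel0.

Theorem lemma5p5 (R : realType) (Omega : set (R * R))
    (V : finType) (pos : V -> R * R) (Th : {set {set V}})
    (start : {set V} -> V) :
  simply_connected_domain Omega ->
  triangulation Omega pos Th ->
  (forall a : V, boundary_vertex Omega pos a ->
     exists2 b : V, interior_vertex Omega pos b & edge Th [set a; b]%SET) ->
  (forall e : {set V}, interior_edge Omega pos Th e ->
     exists2 a : V, a \in e & interior_vertex Omega pos a) ->
  (forall e : {set V}, interior_edge Omega pos Th e ->
     start e \in e /\ interior_vertex Omega pos (start e)) ->
  Vel0 Omega pos Th =
  ae_class Omega (linear_span
    (edge_functions Omega pos Th start `|` cell_functions Omega pos Th)).
Proof.
move=> [oO _ _ _ rO] tri _ _ startP; apply/seteqP; split => v.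
  move=> /(Vel0_conforming tri rO oO)[v2 [q qc vq]]; split => //.
  have [w sw wq] := conforming_linear_span tri rO oO startP qc; exists w => //.
  (* Both [v] and [w] are compared with the polynomials of the family in the interiors of the cells,
     which fill [Omega] up to a null set. *)
  have c : \forall x \ae (@lebesgue_measure R \x @lebesgue_measure R)%E,
      Omega x -> exists2 T, T \in Th & (hull pos T)° x.
    by apply: (Omega_ae_cell tri) => T x T_Th ix; exists T.
  apply: filterS2 (ae_cells Omega vq) c => x h c Ox.
  by have [T T_Th ix] := c Ox; rewrite (h Ox T T_Th ix) (wq T x T_Th ix).
move=> [v2 [w sw vw]]; have [q qc wq] := linear_span_conforming tri rO sw.
apply: (conforming_Vel0 tri rO oO v2 qc).
by apply: filterS vw => x e Ox T T_Th ix; rewrite (e Ox) (wq T x T_Th ix).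
Qed.
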